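(* Let $(R(t),\,t\geq 0)$ be a three dimensional Bessel process starting from $0$, let $(m(u),\,0\le u\leq 1)$ be a Brownian meander, and let $U$ be a uniform random variable on $[0,1]$ independent of the considered process ($R$, respectively $m$). Then: (1) The density of $R(1)$ at point $y\geq 0$ is $\sqrt{\frac{2}{\pi}}\,y^2\exp(-y^2/2)$. (2) $R(U)$ has the same law as $\sqrt{U}R(1)$, and its density at point $y\geq 0$ is $$2\sqrt{\frac{2}{\pi}}\;y\int_y^{+\infty}\exp(-z^2/2)\,dz.$$ (3) The conditional law of $R(U)$ given $R(1)$ is the same as the conditional law of $m(U)$ given $m(1)$ (that is, the conditional laws given $R(1)=r$ and given $m(1)=r$ coincide, for almost every $r>0$).
   Context: The three dimensional Bessel process starting from $0$ is the process with the law of the Euclidean norm of a standard three dimensional Brownian motion started at the origin. The Brownian meander is the process on $[0,1]$ with the law of $\big(\frac{|B_{\sigma+u(1-\sigma)}|}{\sqrt{1-\sigma}},\,0\le u\le1\big)$, where $B$ is a standard Brownian motion started at $0$ and $\sigma=\sup\{t\le 1: B_t=0\}$. *)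

(* Defs.v *)
From HB Require Import structures.
From mathcomp Require Import all_boot all_order all_algebra.
From mathcomp Require Import all_classical all_reals all_analysis.

Set Implicit Arguments.
Unset Strict Implicit.
Unset Printing Implicit Defensive.

Import Order.TTheory GRing.Theory Num.Theory.
Import numFieldNormedType.Exports.

Local Open Scope classical_set_scope.
Local Open Scope ring_scope.

Section processes.
Context {R : realType}.

(* A real process indexed by I `<=` R is a map X : R -> Omega -> R; its values
   at times outside I are irrelevant. *)

(* The product sigma-algebra on paths, generated by the evaluations at the
   times of I. The law of a process is the measure it induces on it. *)
Definition cylinder (I : set R) : set (set (R -> R)) :=
  <<s [set C | exists2 t, I t & exists2 A : set R, measurable A &
         C = [set f : R -> R | A (f t)]] >>.

Definition path_event {Omega : Type} (X : R -> Omega -> R)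
    (C : set (R -> R)) : set Omega :=
  [set w | C (X ^~ w)].

Definition same_process_law (I : set R)
    {d d' : measure_display} {Omega : measurableType d}
    {Omega' : measurableType d'}
    (P : probability Omega R) (X : R -> Omega -> R)
    (P' : probability Omega' R) (X' : R -> Omega' -> R) : Prop :=
  forall C, cylinder I C -> P (path_event X C) = P' (path_event X' C).

Section one_space.
Context {d : measure_display} {Omega : measurableType d}.
Variable P : probability Omega R.

(* All (and not only almost all) paths are continuous, so that X evaluated at
   a random time is a random variable. *)
Definition continuous_process (I : set R) (X : R -> Omega -> R) : Prop :=
  (forall t, I t -> measurable_fun [set: Omega] (X t)) /\
  (forall w, {within I, continuous (X ^~ w)}).

Definition process_indep_rv (I : set R) (X : R -> Omega -> R)
    (Y : Omega -> R) : Prop :=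
  forall (C : set (R -> R)) (A : set R), cylinder I C -> measurable A ->
    P (path_event X C `&` Y @^-1` A) = (P (path_event X C) * P (Y @^-1` A))%E.

(* Taking some of the C i equal to setT gives the product rule for all
   subfamilies. *)
Definition mutually_indep_processes (I : set R) (n : nat)
    (X : 'I_n -> R -> Omega -> R) : Prop :=
  forall C : 'I_n -> set (R -> R), (forall i, cylinder I (C i)) ->
    P (\bigcap_(i in [set: 'I_n]) path_event (X i) (C i)) =
    (\prod_(i < n) P (path_event (X i) (C i)))%E.

(* The second argument of normal_prob is the standard deviation. *)
Definition brownian_motion (B : R -> Omega -> R) : Prop :=
  [/\ continuous_process `[0, +oo[ B,
      forall w, B 0 w = 0,
      forall s t, 0 <= s -> s < t -> forall A : set R, measurable A ->
        P ((B t \- B s) @^-1` A) = normal_prob 0 (Num.sqrt (t - s)) A &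
      forall s t, 0 <= s -> s < t ->
        process_indep_rv `[0, s] B (B t \- B s)].

Definition brownian_motion_vec (n : nat) (W : 'I_n -> R -> Omega -> R) : Prop :=
  (forall i, brownian_motion (W i)) /\ mutually_indep_processes `[0, +oo[ W.

Definition euclidean_norm_process (n : nat) (W : 'I_n -> R -> Omega -> R)
    (t : R) (w : Omega) : R :=
  Num.sqrt (\sum_(i < n) W i t w ^+ 2).

Definition last_zero (B : R -> Omega -> R) (w : Omega) : R :=
  sup [set t | 0 <= t <= 1 /\ B t w = 0].

(* If last_zero B w = 1 (a null event), division by 0 makes the path
   identically 0. *)
Definition meander_process (B : R -> Omega -> R) (u : R) (w : Omega) : R :=
  `|B (last_zero B w + u * (1 - last_zero B w)) w| /
  Num.sqrt (1 - last_zero B w).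

End one_space.
End processes.

Section laws.
Context {R : realType} {d : measure_display} {Omega : measurableType d}.
Variable P : probability Omega R.

Definition bessel3 (X : R -> Omega -> R) : Prop :=
  continuous_process `[0, +oo[ X /\
  exists (d' : measure_display) (Omega' : measurableType d')
    (P' : probability Omega' R) (W : 'I_3 -> R -> Omega' -> R),
    brownian_motion_vec P' W /\
    same_process_law `[0, +oo[ P X P' (euclidean_norm_process W).

Definition brownian_meander (m : R -> Omega -> R) : Prop :=
  continuous_process `[0, 1] m /\
  exists (d' : measure_display) (Omega' : measurableType d')
    (P' : probability Omega' R) (B : R -> Omega' -> R),
    brownian_motion P' B /\
    same_process_law `[0, 1] P m P' (meander_process B).

Definition uniform01 (U : {RV P >-> R}) : Prop :=
  (forall w, 0 <= U w <= 1) /\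
  (forall A : set R, measurable A ->
     distribution P U A = uniform_prob (@ltr01 R) A).

Definition at_random_time (X : R -> Omega -> R) (U : Omega -> R) : Omega -> R :=
  fun w => X (U w) w.

Definition has_density (Y : Omega -> R) (f : R -> R) : Prop :=
  [/\ measurable_fun [set: Omega] Y,
      measurable_fun [set: R] f,
      forall y, 0 <= f y &
      forall A : set R, measurable A ->
        P (Y @^-1` A) = (\int[lebesgue_measure]_(y in A) (f y)%:E)%E].

Definition same_law (Y Z : Omega -> R) : Prop :=
  [/\ measurable_fun [set: Omega] Y, measurable_fun [set: Omega] Z &
      forall A : set R, measurable A -> P (Y @^-1` A) = P (Z @^-1` A)].

(* k is (a version of) the regular conditional law of Y given Z. *)
Definition conditional_law (Y Z : Omega -> R) (k : R.-pker R ~> R) : Prop :=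
  [/\ measurable_fun [set: Omega] Y, measurable_fun [set: Omega] Z &
      forall A B : set R, measurable A -> measurable B ->
        P (Z @^-1` A `&` Y @^-1` B) =
        (\int[P]_(w in Z @^-1` A) k (Z w) B)%E].

End laws.

(* Main.v *)
Require Import Defs.
From HB Require Import structures.
From mathcomp Require Import all_boot all_order all_algebra.
From mathcomp Require Import all_classical all_reals all_analysis.
From mathcomp Require Import measurable_realfun.
From mathcomp Require Import ring lra.

Set Implicit Arguments.
Unset Strict Implicit.
Unset Printing Implicit Defensive.

Import Order.TTheory GRing.Theory Num.Theory.
Import numFieldNormedType.Exports.

Local Open Scope classical_set_scope.
Local Open Scope ring_scope.

(** The laws involved are identified through Gaussian test functions: a finite
    measure on the quadrant is determined by the integrals of
    exp(-i x^2 - j y^2), for natural numbers i and j. For the Bessel process,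
    the product of three Brownian computations gives
      E exp(-l R(u)^2 - m R(1)^2) = D^(-3/2),
      D = 1 + 2m + 2ul + 4u(1-u)lm,
    from which (1) and (2) follow by integrating over u.
    For the meander, let g be the last zero of B before time 1 and decompose
    over the cell of a fine grid that contains g. The event that B has no zero
    on [s, 1] is handled by the reflection principle: the odd functional
    B(1) exp(-l B(q)^2 - m B(1)^2) has mean zero on the event that B vanishes on
    [s, 1], and on its complement |B(1)| = sgn(B(s)) B(1). This reduces every
    cell to a Gaussian integral, the dependence on (u, l, m) factors out, and in
    the limit
      E[m(1) exp(-l m(u)^2 - m' m(1)^2)] = kappa D^(-3/2)
    with the same D, for m' >= 1 and a constant kappa > 0. So the laws of
    (R(u), R(1)) and (m(u), m(1)) have the same conditional law given the second
    coordinate, which is that of the norm at time u of a Brownian bridge in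
    dimension three; mixing over u gives (3). *)

(** The weight m(1) is there because m(1) has a density proportional to x e^(-x^2/2) and R(1) one
    proportional to x^2 e^(-x^2/2). It depends on the conditioning variable alone and is almost
    surely positive, so it leaves the conditional law unchanged, and the value of kappa never
    matters. The factor y is also the harmonic function that turns Brownian motion avoiding 0 into a
    three dimensional Bessel process, hence the common exponent 3/2.

    The obstacle is that g is not a stopping time. With the right end s of a grid cell in its place,
    a zero in the cell is an event of the past of s, and only the absence of zeros on [s, 1] looks
    ahead. The triple (u, l, m) factors out because two Gaussian steps turn the odd functional into
    a constant times B(s) exp(-c B(s)^2 / (1 - s)); apart from the constant only c depends on the
    triple, and its effect disappears as s tends to g, where B vanishes.

    The condition m' >= 1 bounds y exp(-m' y^2) by 1, so all integrands are bounded and limits pass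
    by dominated convergence. *)

Lemma measurable_preimageT {d1 d2} {T1 : measurableType d1}
    {T2 : measurableType d2} (f : T1 -> T2) (B : set T2) :
  measurable_fun [set: T1] f -> measurable B -> measurable (f @^-1` B).
Proof. by move=> mf mB; rewrite -[X in measurable X]setTI; exact: mf. Qed.

(** * Expectations of bounded measurable functions *)

Section bounded_functions.
Context {R : realType}.

(** Under a probability such functions are integrable, and they are closed under sums and products.
    Expectations are then real numbers, and linearity and Fubini carry no further integrability
    conditions. *)
Definition bounded_measurable {d} {T : measurableType d} (f : T -> R) :=
  measurable_fun [set: T] f /\ exists M, forall x, `|f x| <= M.

Section closure.
Context {d} {T : measurableType d}.
Implicit Types f g : T -> R.

Lemma bmeas_cst (c : R) : bounded_measurable (fun _ : T => c).
Proof. by split; [exact: measurable_cst|exists `|c|]. Qed.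

Lemma bmeasM f g : bounded_measurable f -> bounded_measurable g ->
  bounded_measurable (fun x => f x * g x).
Proof.
move=> [mf [M fM]] [mg [N gN]]; split; first exact: measurable_funM.
by exists (M * N) => x; rewrite normrM ler_pM.
Qed.

Lemma bmeasD f g : bounded_measurable f -> bounded_measurable g ->
  bounded_measurable (fun x => f x + g x).
Proof.
move=> [mf [M fM]] [mg [N gN]]; split; first exact: measurable_funD.
by exists (M + N) => x; rewrite (le_trans (ler_normD _ _))// lerD.
Qed.

Lemma bmeasB f g : bounded_measurable f -> bounded_measurable g ->
  bounded_measurable (fun x => f x - g x).
Proof.
move=> [mf [M fM]] [mg [N gN]]; split; first exact: measurable_funB.
by exists (M + N) => x; rewrite (le_trans (ler_normB _ _))// lerD.
Qed.

Lemma bmeas_norm f : bounded_measurable f -> bounded_measurable (fun x => `|f x|).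
Proof.
move=> [mf [M fM]]; split; first exact: measurableT_comp.
by exists M => x; rewrite normr_id.
Qed.

Lemma bmeas_indic (A : set T) : measurable A ->
  bounded_measurable (\1_A : T -> R).
Proof.
move=> mA; split; first exact: measurable_indic.
by exists 1 => x; rewrite indicE; case: (_ \in _); rewrite ?normr0 ?normr1.
Qed.

Lemma bmeas_sum (I : Type) (s : seq I) (F : I -> T -> R) :
  (forall i, bounded_measurable (F i)) ->
  bounded_measurable (fun x => \sum_(i <- s) F i x).
Proof.
move=> mF; elim: s => [|i s IH].
  by under eq_fun do rewrite big_nil; exact: bmeas_cst.
by under eq_fun do rewrite big_cons; exact: bmeasD.
Qed.

Lemma bmeas_comp {d'} {T' : measurableType d'} (h : T' -> T) f :
  measurable_fun setT h -> bounded_measurable f ->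
  bounded_measurable (fun x => f (h x)).
Proof.
move=> mh [mf [M fM]]; split; first exact: measurableT_comp.
by exists M.
Qed.

Lemma bmeas_le (M : R) f : measurable_fun setT f -> (forall x, `|f x| <= M) ->
  bounded_measurable f.
Proof. by move=> mf fM; split => //; exists M. Qed.

End closure.

Section expectation.
Context {d} {T : measurableType d}.
Variable P : probability T R.
Implicit Types f g : T -> R.

Lemma bmeas_integrable (D : set T) f : measurable D -> bounded_measurable f ->
  P.-integrable D (EFin \o f).
Proof.
move=> mD [mf [M fM]].
apply: (@le_integrable _ _ _ _ _ mD _ (EFin \o cst M)).
- by apply/measurable_EFinP; exact: measurable_funTS.
- by move=> x _ /=; rewrite lee_fin (le_trans (fM x))// ler_norm.
- exact: finite_measure_integrable_cst.
Qed.

Lemma EZ (c : R) f : bounded_measurable f ->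
  \int[P]_w (c * f w) = c * \int[P]_w f w.
Proof. by move=> bf; rewrite RintegralZl//; exact: bmeas_integrable. Qed.

Lemma ED f g : bounded_measurable f -> bounded_measurable g ->
  \int[P]_w (f w + g w) = \int[P]_w f w + \int[P]_w g w.
Proof. by move=> bf bg; rewrite RintegralD//; exact: bmeas_integrable. Qed.

Lemma EB f g : bounded_measurable f -> bounded_measurable g ->
  \int[P]_w (f w - g w) = \int[P]_w f w - \int[P]_w g w.
Proof. by move=> bf bg; rewrite RintegralB//; exact: bmeas_integrable. Qed.

Lemma Esum (I : Type) (s : seq I) (F : I -> T -> R) :
  (forall i, bounded_measurable (F i)) ->
  \int[P]_w (\sum_(i <- s) F i w) = \sum_(i <- s) \int[P]_w F i w.
Proof.
move=> mF; elim: s => [|i s IH].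
  rewrite big_nil; under eq_Rintegral do rewrite big_nil.
  by rewrite Rintegral_cst// mul0r.
rewrite big_cons -IH -ED//; last exact: bmeas_sum.
by apply: eq_Rintegral => w _; rewrite big_cons.
Qed.

Lemma Ele f g : bounded_measurable f -> bounded_measurable g ->
  (forall w, f w <= g w) -> \int[P]_w f w <= \int[P]_w g w.
Proof.
by move=> bf bg fg; apply: le_Rintegral => //; exact: bmeas_integrable.
Qed.

Lemma Enorm f : bounded_measurable f -> `|\int[P]_w f w| <= \int[P]_w `|f w|.
Proof. by move=> bf; apply: le_normr_Rintegral => //; exact: bmeas_integrable. Qed.

Lemma Ecst (c : R) : \int[P]_w c = c.
Proof. by rewrite Rintegral_cst// [X in fine X]probability_setT/= mulr1. Qed.

Lemma EFinE f : bounded_measurable f ->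
  (\int[P]_w f w)%:E = (\int[P]_w (f w)%:E)%E.
Proof.
move=> bf; rewrite /Rintegral fineK//; apply: integrable_fin_num => //.
exact: bmeas_integrable.
Qed.

Lemma Eae f g : measurable_fun setT f -> measurable_fun setT g ->
  {ae P, forall w, f w = g w} -> \int[P]_w f w = \int[P]_w g w.
Proof.
move=> mf mg fg; rewrite /Rintegral; congr fine.
apply: ae_eq_integral => //; [exact/measurable_EFinP..|].
by case: fg => N [mN N0 sub]; exists N; split=> // w /= nfg; apply: sub => /= e;
  apply: nfg => _; rewrite e.
Qed.

Lemma Eindic (A : set T) : measurable A -> \int[P]_w (\1_A w : R) = fine (P A).
Proof. by move=> mA; rewrite /Rintegral integral_indic// setIT. Qed.

Lemma E_dct (M : R) (F : nat -> T -> R) f :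
  (forall n, measurable_fun setT (F n)) -> (forall n w, `|F n w| <= M) ->
  (forall w, F n w @[n --> \oo] --> f w) ->
  \int[P]_w F n w @[n --> \oo] --> \int[P]_w f w.
Proof.
move=> mF FM Ff; apply: fine_cvg.
have mf : measurable_fun setT f.
  by apply: (measurable_fun_cvg mF) => w _; exact: Ff.
have fM w : `|f w| <= M.
  by apply: (cvgr_to_le (cvg_norm (Ff w))); near=> n; exact: FM.
have bf : bounded_measurable f by apply: bmeas_le fM.
rewrite EFinE//.
apply: (@dominated_cvg _ _ _ _ _ measurableT _ _ (EFin \o cst M)) => //.
- by move=> n; apply/measurable_EFinP.
- by move=> w _; apply: cvg_EFin; [exact: nearW|exact: Ff].
- exact: finite_measure_integrable_cst.
- by move=> n w _; rewrite /= lee_fin.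
Unshelve. all: by end_near. Qed.

End expectation.

Section product.
Context {d1 d2} {T1 : measurableType d1} {T2 : measurableType d2}.
Variables (P : probability T1 R) (Q : probability T2 R).
Implicit Types f : T1 * T2 -> R.

Lemma bmeas_section1 f x : bounded_measurable f ->
  bounded_measurable (fun y => f (x, y)).
Proof. by move=> bf; apply: bmeas_comp bf; exact: pair1_measurable. Qed.

Lemma bmeas_section2 f y : bounded_measurable f ->
  bounded_measurable (fun x => f (x, y)).
Proof. by move=> bf; apply: bmeas_comp bf; exact: pair2_measurable. Qed.

Lemma bmeas_E1 f : bounded_measurable f ->
  bounded_measurable (fun x => \int[Q]_y f (x, y)).
Proof.
move=> bf; have [mf [M fM]] := bf.
apply: (@bmeas_le _ _ M).
  apply/measurable_EFinP.
  have -> : EFin \o (fun x => \int[Q]_y f (x, y)) = fubini_F Q (EFin \o f).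
    by apply/funext => x /=; rewrite EFinE//; exact: bmeas_section1.
  apply: (measurable_fubini_F (m1 := P)).
  exact: bmeas_integrable.
move=> x; rewrite (le_trans (Enorm _ _))//; first exact: bmeas_section1.
rewrite -[leRHS](Ecst Q); apply: Ele => //; last exact: bmeas_cst.
by apply: bmeas_norm; exact: bmeas_section1.
Qed.

Lemma E_fubini1 f : bounded_measurable f ->
  \int[(P \x Q)%E]_z f z = \int[P]_x \int[Q]_y f (x, y).
Proof.
move=> bf; apply: EFin_inj; rewrite !EFinE//; last exact: bmeas_E1.
rewrite -(integral12_prod_meas1 (f := EFin \o f)); last exact: bmeas_integrable.
by apply: eq_integral => x _; rewrite /fubini_F EFinE//; exact: bmeas_section1.
Qed.

End product.

Section transfer.
Context {d} {T : measurableType d}.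
Variable P : probability T R.

Lemma E_law {d'} {T' : measurableType d'} (Q : probability T' R) (G : T -> T')
    (phi : T' -> R) : measurable_fun setT G ->
  (forall A, measurable A -> P (G @^-1` A) = Q A) ->
  bounded_measurable phi -> \int[P]_w phi (G w) = \int[Q]_y phi y.
Proof.
move=> mG PQ bphi; apply: EFin_inj; rewrite !EFinE//; last exact: bmeas_comp bphi.
have <- : (\int[pushforward P G]_y (phi y)%:E)%E = (\int[Q]_y (phi y)%:E)%E.
  by apply: eq_measure_integral => A mA _; exact: PQ.
have bphiG : bounded_measurable (fun w => phi (G w)) by exact: bmeas_comp bphi.
rewrite (integral_pushforward mG) ?preimage_setT//.
- by apply/measurable_EFinP; case: bphi.
- exact: (bmeas_integrable P measurableT bphiG).
Qed.

End transfer.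

Section independence.
Context {d} {T : measurableType d}.
Variable P : probability T R.

(** Rectangles determine the joint law, so (F, G) has the same law under P as (F, G) read off two
    independent copies under [P \x P]. Fubini then gives the iterated integral. *)
Lemma E_indep {d1 d2} {T1 : measurableType d1} {T2 : measurableType d2}
    (F : T -> T1) (G : T -> T2) (phi : T1 * T2 -> R) :
  measurable_fun setT F -> measurable_fun setT G ->
  (forall A B, measurable A -> measurable B ->
    P (F @^-1` A `&` G @^-1` B) = (P (F @^-1` A) * P (G @^-1` B))%E) ->
  bounded_measurable phi ->
  \int[P]_w phi (F w, G w) = \int[P]_w \int[P]_w' phi (F w, G w').
Proof.
move=> mF mG FG bphi.
rewrite -(E_fubini1 P P (f := fun z => phi (F z.1, G z.2))); last first.
  by apply: (bmeas_comp (h := fun z => (F z.1, G z.2)) _ bphi);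
    apply/measurable_fun_pair; exact: measurableT_comp.
pose PF := distribution P (mfun_Sub (mem_set mF)).
pose PG := distribution P (mfun_Sub (mem_set mG)).
have mFG : measurable_fun setT (fun w => (F w, G w)) by exact: measurable_fun_pair.
have mFG2 : measurable_fun setT (fun z : T * T => (F z.1, G z.2)).
  by apply/measurable_fun_pair; exact: measurableT_comp.
rewrite (E_law (Q := (PF \x PG)%E) mFG)//; last first.
  move=> A mA; apply/esym.
  apply: (product_measure_unique (m' := pushforward P (fun w => (F w, G w)))) => //.
apply/esym; apply: (E_law (P := (P \x P)%E) mFG2) => // A mA; apply/esym.
apply: (product_measure_unique
  (m' := pushforward (P \x P)%E (fun z => (F z.1, G z.2)))) => // B C mB mC.
rewrite [LHS](_ : _ = (P \x P)%E ((F @^-1` B) `*` (G @^-1` C)))//.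
rewrite product_measure1E//; exact: measurable_preimageT.
Qed.

End independence.

End bounded_functions.

(** * Gaussian transforms determine finite measures *)

Section laplace_uniqueness.
Context {R : realType}.

Lemma bernoulli_lower (t : R) N : 0 <= t <= 1 -> 1 - N%:R * t <= (1 - t) ^+ N.
Proof.
move=> /andP[t0 t1]; elim: N => [|N IH]; first by rewrite mul0r subr0 expr0.
rewrite exprS; apply: (@le_trans _ _ ((1 - t) * (1 - N%:R * t))).
  have := mulr_ge0 (mulr_ge0 (ler0n R N) t0) t0; rewrite -natr1; lra.
by apply: ler_wpM2l => //; lra.
Qed.

Lemma bernoulli_upper (t : R) N : 0 <= t <= 1 -> (1 - t) ^+ N * (1 + N%:R * t) <= 1.
Proof.
move=> /andP[t0 t1]; elim: N => [|N IH]; first by rewrite mul0r expr0 mul1r addr0.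
have N0 := ler0n R N; have Nt := mulr_ge0 N0 t0.
apply: (le_trans _ IH); rewrite exprSr -mulrA.
apply: ler_wpM2l; first by apply: exprn_ge0; lra.
have := mulr_ge0 Nt t0; have := mulr_ge0 t0 t0; rewrite -natr1; nra.
Qed.

(* (1 - e^(-n x^2))^N with N close to n e^(n a^2) tends to 0 for |x| <= a and to
   1 for |x| > a, and it is a polynomial in e^(-x^2). *)
Definition threshold_degree (a : R) (n : nat) : nat :=
  if a < 0 then 0%N else (n * (Num.truncn (expR (n%:R * a ^+ 2))).+1)%N.

Definition threshold (a : R) (n : nat) (x : R) : R :=
  (1 - expR (- x ^+ 2) ^+ n) ^+ threshold_degree a n.

Lemma gauss_itv01 (x : R) : 0 <= expR (- x ^+ 2) <= 1.
Proof. by rewrite expR_ge0/= -expR0 ler_expR oppr_le0 sqr_ge0. Qed.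

Lemma threshold_itv01 a n x : 0 <= threshold a n x <= 1.
Proof.
have /andP[g0 g1] := gauss_itv01 x.
have h : 0 <= 1 - expR (- x ^+ 2) ^+ n <= 1.
  by rewrite subr_ge0 exprn_ile1//= lerBlDr lerDl exprn_ge0.
by move/andP: h => [h0 h1]; rewrite /threshold exprn_ge0//= exprn_ile1.
Qed.

(** Squaring e^(x/2) >= 1 + x/2 gives e^x >= x^2/4, that is n e^(-n d) <= 4 / (n d^2). The constant
    8 pays for replacing 1/n by 1/(n+1), which also covers n = 0. *)
Lemma natmul_expR_le (d : R) n : 0 < d ->
  n%:R * expR (- (n%:R * d)) <= 8 / d ^+ 2 * n.+1%:R^-1.
Proof.
move=> d0; case: n => [|n].
  by rewrite mul0r mulr_ge0// divr_ge0// sqr_ge0.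
rewrite -[n.+2%:R]natr1; set N : R := n.+1%:R.
have N1 : 1 <= N by rewrite ler1n.
have e1 : 1 + N * d / 2 <= expR (N * d / 2) by exact: expR_ge1Dx.
have e2 : expR (N * d) = expR (N * d / 2) ^+ 2.
  by rewrite -expRM_natl; congr expR; field.
have Nd : 0 < N * d by apply: mulr_gt0 => //; lra.
have e3 : (N * d) ^+ 2 / 4 <= expR (N * d).
  rewrite e2; apply: (@le_trans _ _ ((1 + N * d / 2) ^+ 2)); first by nra.
  by rewrite ler_pXn2r// ?nnegrE; nra.
have E0 := expR_gt0 (N * d); rewrite expRN; set E := expR _ in e3 E0 *.
have dN : 0 < d ^+ 2 * (N + 1) * E by rewrite !mulr_gt0// ?exprn_gt0//; lra.
rewrite -(ler_pM2r dN).
have -> : N * E^-1 * (d ^+ 2 * (N + 1) * E) = N * d ^+ 2 * (N + 1).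
  by field; rewrite gt_eqF.
have -> : 8 / d ^+ 2 * (N + 1)^-1 * (d ^+ 2 * (N + 1) * E) = 8 * E.
  by field; rewrite !gt_eqF//; lra.
apply: (@le_trans _ _ (8 * ((N * d) ^+ 2 / 4))); last lra.
have := mulr_ge0 (ltW Nd) (ltW d0); nra.
Qed.

Lemma natmul_expR_cvg0 (d : R) : 0 < d ->
  n%:R * expR (- (n%:R * d)) @[n --> \oo] --> 0.
Proof.
move=> d0; apply: (@squeeze_cvgr _ _ _ _ (fun=> 0)
    (fun n => 8 / d ^+ 2 * n.+1%:R^-1)).
- apply: nearW => n; rewrite natmul_expR_le// andbT.
  by rewrite mulr_ge0// expR_ge0.
- exact: cvg_cst.
- by rewrite -[X in _ --> X](mulr0 (8 / d ^+ 2)); apply: cvgMr; exact: cvg_harmonic.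
Qed.

(** Put t = e^(-n x^2) and let N be the degree, which for a >= 0 lies between n e^(n a^2) and that
    number plus n. If |x| <= a then N t >= n, and if |x| > a then N t tends to 0; the two Bernoulli
    inequalities turn this into the limits 0 and 1. The boundary |x| = a goes to 0, as the open
    half-line requires. For a < 0 the degree is 0 and both sides are 1. *)
Lemma threshold_cvg a x :
  threshold a n x @[n --> \oo] --> (\1_(`]a, +oo[%classic) `|x| : R).
Proof.
rewrite indicE mem_setE in_itv/= andbT.
have [a0|a0] := ltP a 0.
  have -> : a < `|x| by exact: lt_le_trans a0 _.
  rewrite (_ : threshold a ^~ x = fun=> 1); first exact: cvg_cst.
  by apply/funext => n; rewrite /threshold /threshold_degree a0 expr0.
have g n : 0 <= expR (- x ^+ 2) ^+ n <= 1.
  have /andP[g0 g1] := gauss_itv01 x.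
  by rewrite exprn_ge0//= exprn_ile1.
have gE n : expR (- x ^+ 2) ^+ n = expR (- (n%:R * `|x| ^+ 2)).
  by rewrite -expRM_natl real_normK ?num_real// mulrN.
have dE n : (threshold_degree a n)%:R =
    n%:R * (Num.truncn (expR (n%:R * a ^+ 2))).+1%:R :> R.
  by rewrite /threshold_degree ltNge a0/= natrM.
have dlb n : n%:R * expR (n%:R * a ^+ 2) <= (threshold_degree a n)%:R :> R.
  rewrite dE ler_wpM2l//; have := truncn_itv (expR_ge0 (n%:R * a ^+ 2)).
  by case/andP => _ /ltW.
have dub n : (threshold_degree a n)%:R <=
    n%:R * expR (n%:R * a ^+ 2) + n%:R :> R.
  rewrite dE -[X in _ <= _ + X]mulr1 -mulrDr ler_wpM2l//.
  have := truncn_itv (expR_ge0 (n%:R * a ^+ 2)).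
  by case/andP => + _; rewrite -natr1 lerD2r.
have [ax|xa] := ltP a `|x|; last first.
  apply: (@squeeze_cvgr _ _ _ _ (fun=> 0) (fun n => n.+1%:R^-1)); last 2 first.
  - exact: cvg_cst.
  - exact: cvg_harmonic.
  apply: nearW => n; have /andP[-> _] /= := threshold_itv01 a n x.
  have := bernoulli_upper (threshold_degree a n) (g n).
  rewrite -/(threshold a n x) => h.
  have Nt : n%:R <= (threshold_degree a n)%:R * expR (- x ^+ 2) ^+ n.
    rewrite gE; apply: (@le_trans _ _
      (n%:R * expR (n%:R * a ^+ 2) * expR (- (n%:R * `|x| ^+ 2)))).
      rewrite -mulrA -expRD -[leLHS]mulr1 ler_wpM2l// -expR0 ler_expR.
      by rewrite -mulrBr mulr_ge0// subr_ge0 ler_pXn2r// nnegrE.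
    by rewrite ler_wpM2r// expR_ge0.
  have /andP[t0 _] := threshold_itv01 a n x.
  rewrite -[leRHS]mul1r ler_pdivlMr// -natr1; apply: le_trans h.
  by rewrite ler_wpM2l//; lra.
have xa2 : 0 < `|x| ^+ 2 - a ^+ 2.
  by rewrite subr_gt0 ltr_pXn2r// ?nnegrE.
have x0 : 0 < `|x| ^+ 2 by rewrite exprn_gt0//; exact: le_lt_trans ax.
apply: (@squeeze_cvgr _ _ _ _
   (fun n => 1 - (n%:R * expR (- (n%:R * (`|x| ^+ 2 - a ^+ 2))) +
                   n%:R * expR (- (n%:R * `|x| ^+ 2)))) (fun=> 1)).
- apply: nearW => n; have /andP[_ ->] /= := threshold_itv01 a n x; rewrite andbT.
  apply: le_trans (bernoulli_lower (threshold_degree a n) (g n)).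
  rewrite lerD2l lerN2 gE.
  apply: (@le_trans _ _ ((n%:R * expR (n%:R * a ^+ 2) + n%:R) *
    expR (- (n%:R * `|x| ^+ 2)))); first by rewrite ler_wpM2r// expR_ge0.
  rewrite mulrDl -mulrA -expRD lerD2r ler_wpM2l// ler_expR; lra.
- rewrite -[X in _ --> X](subr0 1) -[X in _ --> _ - X](addr0 0).
  apply: cvgB; first exact: cvg_cst.
  by apply: cvgD; exact: natmul_expR_cvg0.
- exact: cvg_cst.
Qed.

Lemma threshold_expand a n x : threshold a n x =
  \sum_(k < (threshold_degree a n).+1)
    (-1) ^+ k *+ 'C(threshold_degree a n, k) * expR (- x ^+ 2) ^+ (n * k).
Proof.
rewrite /threshold exprBn; apply: eq_bigr => k _.
by rewrite expr1n mulr1 exprM mulrnAl.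
Qed.

Lemma measurable_gauss : measurable_fun setT (fun x : R => expR (- x ^+ 2)).
Proof.
apply: measurableT_comp => //; apply: measurableT_comp => //.
Qed.

Lemma bmeas_gauss {d} {T : measurableType d} (X : T -> R) n :
  measurable_fun setT X -> bounded_measurable (fun w => expR (- X w ^+ 2) ^+ n).
Proof.
move=> mX; apply: (@bmeas_le _ _ _ 1).
  by apply: measurable_funX; exact: (measurableT_comp measurable_gauss).
move=> w; have /andP[g0 g1] := gauss_itv01 (X w).
by rewrite ger0_norm ?exprn_ge0// exprn_ile1.
Qed.

Lemma measurable_threshold a n : measurable_fun setT (threshold a n).
Proof.
apply: measurable_funX; apply: measurable_funB => //.
apply: measurable_funX; exact: measurable_gauss.
Qed.

Section quadrant.
Context {d d'} {T : measurableType d} {T' : measurableType d'}.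
Variables (P : probability T R) (X Y rho : T -> R).
Variables (P' : probability T' R) (X' Y' rho' : T' -> R).
Hypotheses (mX : measurable_fun setT X) (mY : measurable_fun setT Y)
  (brho : bounded_measurable rho).
Hypotheses (mX' : measurable_fun setT X') (mY' : measurable_fun setT Y')
  (brho' : bounded_measurable rho').
Hypothesis laplaceE : forall i j : nat,
  \int[P]_w (rho w * (expR (- X w ^+ 2) ^+ i * expR (- Y w ^+ 2) ^+ j)) =
  \int[P']_w (rho' w * (expR (- X' w ^+ 2) ^+ i * expR (- Y' w ^+ 2) ^+ j)).

Lemma threshold_expectation a b n :
  \int[P]_w (rho w * (threshold a n (X w) * threshold b n (Y w))) =
  \int[P']_w (rho' w * (threshold a n (X' w) * threshold b n (Y' w))).
Proof.
pose c a k : R := (-1) ^+ k *+ 'C(threshold_degree a n, k).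
have expand (r x y : R) : r * (threshold a n x * threshold b n y) =
    \sum_(k < (threshold_degree a n).+1) \sum_(l < (threshold_degree b n).+1)
      c a k * c b l * (r * (expR (- x ^+ 2) ^+ (n * k) * expR (- y ^+ 2) ^+ (n * l))).
  rewrite !threshold_expand mulr_suml mulr_sumr; apply: eq_bigr => k _.
  by rewrite !mulr_sumr; apply: eq_bigr => l _; rewrite /c; ring.
under eq_Rintegral do rewrite expand.
under [RHS]eq_Rintegral do rewrite expand.
have b1 i j : bounded_measurable
    (fun w => rho w * (expR (- X w ^+ 2) ^+ i * expR (- Y w ^+ 2) ^+ j)).
  by apply: bmeasM => //; apply: bmeasM; exact: bmeas_gauss.
have b2 i j : bounded_measurable
    (fun w => rho' w * (expR (- X' w ^+ 2) ^+ i * expR (- Y' w ^+ 2) ^+ j)).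
  by apply: bmeasM => //; apply: bmeasM; exact: bmeas_gauss.
rewrite !Esum; last 2 first.
- by move=> k; apply: bmeas_sum => l; apply: bmeasM => //; exact: bmeas_cst.
- by move=> k; apply: bmeas_sum => l; apply: bmeasM => //; exact: bmeas_cst.
apply: eq_bigr => k _; rewrite !Esum; last 2 first.
- by move=> l; apply: bmeasM => //; exact: bmeas_cst.
- by move=> l; apply: bmeasM => //; exact: bmeas_cst.
by apply: eq_bigr => l _; rewrite !EZ// laplaceE.
Qed.

End quadrant.

Lemma threshold_expectation_cvg {d} {T : measurableType d} (P : probability T R)
    (X Y rho : T -> R) a b :
  measurable_fun setT X -> measurable_fun setT Y -> bounded_measurable rho ->
  \int[P]_w (rho w * (threshold a n (X w) * threshold b n (Y w))) @[n --> \oo]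
  --> \int[P]_w (rho w * (\1_(`]a, +oo[%classic) `|X w| *
                          \1_(`]b, +oo[%classic) `|Y w|)).
Proof.
move=> mX mY [mr [M rM]]; apply: (E_dct (M := M)).
- move=> n; apply: measurable_funM => //.
  by apply: measurable_funM; apply: (measurableT_comp (measurable_threshold _ _)).
- move=> n w; have /andP[t0 t1] := threshold_itv01 a n (X w).
  have /andP[u0 u1] := threshold_itv01 b n (Y w).
  rewrite normrM -[leRHS]mulr1 ler_pM// ger0_norm ?mulr_ge0// mulr_ile1//.
- move=> w; apply: cvgMr; apply: cvgM; exact: threshold_cvg.
Qed.

Section weighted.
Context {d} {T : measurableType d}.
Variables (P : probability T R) (rho : T -> R).
Hypotheses (brho : bounded_measurable rho) (rho0 : forall w, 0 <= rho w).

(** The measure with density [rho] with respect to [P]. The two properties of [rho] are arguments so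
    that the finite measure structure below can be attached to this very term. *)
Definition weighted of bounded_measurable rho & (forall w, 0 <= rho w) :=
  fun A : set T => (\int[P]_(w in A) (rho w)%:E)%E.

Local Notation mu := (weighted brho rho0).

Let mu0 : mu set0 = 0%E. Proof. by rewrite /weighted integral_set0. Qed.

Let mu_ge0 A : (0 <= mu A)%E.
Proof. by apply: integral_ge0 => w _; rewrite lee_fin. Qed.

Let mu_sigma_additive : semi_sigma_additive mu.
Proof.
move=> /= A mA tA mUA.
rewrite /weighted integral_bigcup//=; last exact: (bmeas_integrable P mUA brho).
by apply: is_cvg_ereal_nneg_natsum_cond => n _ _; exact: mu_ge0.
Qed.

HB.instance Definition _ := isMeasure.Build _ _ _ mu mu0 mu_ge0 mu_sigma_additive.

Let mu_fin : fin_num_fun mu.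
Proof.
move=> A mA; exact: (integrable_fin_num mA (bmeas_integrable P mA brho)).
Qed.

HB.instance Definition _ := Measure_isFinite.Build _ _ _ mu mu_fin.

End weighted.

Lemma half_line_unique (mu nu : {measure set R -> \bar R}) :
  (forall a, mu `]a, +oo[%classic = nu `]a, +oo[%classic) ->
  (mu setT < +oo)%E ->
  forall A, measurable A -> mu A = nu A.
Proof.
move=> munu muT A mA.
apply: (@measure_unique _ R R (@RGenOInfty.G R)
  (fun n : nat => `](- n%:R)%R, +oo[%classic) _ _ _ _ mu nu) => //.
- exact: RGenOInfty.measurableE.
- move=> _ _ [x ->] [y ->]; exists (Num.max x y).
  by apply/seteqP; split => z; rewrite /= !in_itv/= !andbT gt_max => /andP.
- by move=> n; eexists.
- apply/seteqP; split => // x _; exists (Num.truncn `|x|).+1 => //=.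
  rewrite in_itv/= andbT ltrNl (le_lt_trans (ler_norm _))// normrN.
  by have := truncn_itv (normr_ge0 x); case/andP.
- by move=> _ [a ->]; exact: munu.
- move=> k; apply: le_lt_trans muT; apply: le_measure; rewrite ?inE//.
Qed.

Lemma half_line_unique_preimage {d d'} {T : measurableType d}
    {T' : measurableType d'} (mu : {measure set T -> \bar R})
    (nu : {measure set T' -> \bar R}) (f : T -> R) (f' : T' -> R) :
  measurable_fun setT f -> measurable_fun setT f' ->
  (forall a, mu (f @^-1` `]a, +oo[%classic) = nu (f' @^-1` `]a, +oo[%classic)) ->
  (mu setT < +oo)%E ->
  forall A, measurable A -> mu (f @^-1` A) = nu (f' @^-1` A).
Proof.
move=> mf mf' munu muT A mA.
exact: (@half_line_unique
  (measure_function_pushforward__canonical__measure_function_Measure mu mf)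
  (measure_function_pushforward__canonical__measure_function_Measure nu mf') munu muT A mA).
Qed.

Section laplace_unique.
Context {d d'} {T : measurableType d} {T' : measurableType d'}.
Variables (P : probability T R) (X Y rho : T -> R).
Variables (P' : probability T' R) (X' Y' rho' : T' -> R).
Hypotheses (mX : measurable_fun setT X) (mY : measurable_fun setT Y)
  (brho : bounded_measurable rho) (rho0 : forall w, 0 <= rho w).
Hypotheses (mX' : measurable_fun setT X') (mY' : measurable_fun setT Y')
  (brho' : bounded_measurable rho') (rho'0 : forall w, 0 <= rho' w).
Hypothesis laplaceE : forall i j : nat,
  \int[P]_w (rho w * (expR (- X w ^+ 2) ^+ i * expR (- Y w ^+ 2) ^+ j)) =
  \int[P']_w (rho' w * (expR (- X' w ^+ 2) ^+ i * expR (- Y' w ^+ 2) ^+ j)).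

Lemma weighted_quadrantE {d1} {T1 : measurableType d1} (Q : probability T1 R)
    (Z W r : T1 -> R) (br : bounded_measurable r) (r0 : forall w, 0 <= r w)
    (mZ : measurable_fun setT Z) (mW : measurable_fun setT W) A B :
  measurable A -> measurable B ->
  weighted Q br r0 ((fun w => `|Z w|) @^-1` A `&` (fun w => `|W w|) @^-1` B) =
  (\int[Q]_w (r w * (\1_A `|Z w| * \1_B `|W w|)))%:E.
Proof.
move=> mA mB.
have mZA : measurable ((fun w => `|Z w|) @^-1` A).
  by apply: measurable_preimageT => //; exact: measurableT_comp.
have mWB : measurable ((fun w => `|W w|) @^-1` B).
  by apply: measurable_preimageT => //; exact: measurableT_comp.
rewrite EFinE; last first.
  by apply: bmeasM => //; apply: bmeasM; [exact: bmeas_indic mZA|exact: bmeas_indic mWB].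
rewrite /weighted integral_mkcond; apply: eq_integral => w _.
have hA : (w \in (fun w => `|Z w|) @^-1` A) = (`|Z w| \in A) by [].
have hB : (w \in (fun w => `|W w|) @^-1` B) = (`|W w| \in B) by [].
rewrite patchE in_setI !indicE hA hB {hA hB}.
move: (`|Z w| \in A) (`|W w| \in B) => [] [] /=;
  by rewrite ?mulr1 ?mulr0 ?mul0r ?mulr0.
Qed.

(** The test functions are even, so only |X| and |Y| can be identified. Thresholds give equality on
    products of half-lines. Uniqueness on a generating pi-system is then applied one coordinate at a
    time, to the measure restricted by the event that concerns the other coordinate. *)
Lemma laplace_unique A B : measurable A -> measurable B ->
  weighted P brho rho0 ((fun w => `|X w|) @^-1` A `&` (fun w => `|Y w|) @^-1` B) =
  weighted P' brho' rho'0 ((fun w => `|X' w|) @^-1` A `&` (fun w => `|Y' w|) @^-1` B).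
Proof.
have quad (a b : R) :
  weighted P brho rho0 ((fun w => `|X w|) @^-1` `]a, +oo[%classic `&`
    (fun w => `|Y w|) @^-1` `]b, +oo[%classic) =
  weighted P' brho' rho'0 ((fun w => `|X' w|) @^-1` `]a, +oo[%classic `&`
    (fun w => `|Y' w|) @^-1` `]b, +oo[%classic).
  rewrite !weighted_quadrantE//; congr EFin.
  have c := @threshold_expectation_cvg _ _ P X Y rho a b mX mY brho.
  have c' := @threshold_expectation_cvg _ _ P' X' Y' rho' a b mX' mY' brho'.
  apply: (cvg_unique _ c) => //.
  by apply: cvg_trans c'; apply: near_eq_cvg; apply: nearW => n /=; exact/esym/threshold_expectation.
have mnX : measurable_fun setT (fun w => `|X w|) by exact: measurableT_comp.
have mnX' : measurable_fun setT (fun w => `|X' w|) by exact: measurableT_comp.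
have mnY : measurable_fun setT (fun w => `|Y w|) by exact: measurableT_comp.
have mnY' : measurable_fun setT (fun w => `|Y' w|) by exact: measurableT_comp.
have step1 b (A' : set R) : measurable A' ->
  weighted P brho rho0 ((fun w => `|X w|) @^-1` A' `&`
    (fun w => `|Y w|) @^-1` `]b, +oo[%classic) =
  weighted P' brho' rho'0 ((fun w => `|X' w|) @^-1` A' `&`
    (fun w => `|Y' w|) @^-1` `]b, +oo[%classic).
  have mD : measurable ((fun w => `|Y w|) @^-1` `]b, +oo[%classic).
    exact: measurable_preimageT.
  have mD' : measurable ((fun w => `|Y' w|) @^-1` `]b, +oo[%classic).
    exact: measurable_preimageT.
  apply: (half_line_unique_preimage (mu := mrestr (weighted P brho rho0) mD)
    (nu := mrestr (weighted P' brho' rho'0) mD')) => //.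
    by move=> a; exact: quad.
  by rewrite /= /mrestr setTI -ge0_fin_numE ?measure_ge0// fin_num_measure.
move=> mA mB; rewrite setIC [in RHS]setIC.
have mD : measurable ((fun w => `|X w|) @^-1` A) by exact: measurable_preimageT.
have mD' : measurable ((fun w => `|X' w|) @^-1` A) by exact: measurable_preimageT.
move: B mB; apply: (half_line_unique_preimage (mu := mrestr (weighted P brho rho0) mD)
  (nu := mrestr (weighted P' brho' rho'0) mD')) => //.
  by move=> b; rewrite /= /mrestr setIC step1// setIC.
by rewrite /= /mrestr setTI -ge0_fin_numE ?measure_ge0// fin_num_measure.
Qed.

End laplace_unique.

End laplace_uniqueness.

(** * Gaussian integrals and the Markov property *)

Section gaussian_integrals.
Context {R : realType}.

(** The Radon-Nikodym derivative of [nu] and [r] have the same integral over every measurable set,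
    so they agree almost everywhere, and the change of variables known for the derivative holds for
    [r]. *)
Lemma ge0_integral_density {d} {T : measurableType d}
    (mu : {sigma_finite_measure set T -> \bar R})
    (nu : {finite_measure set T -> \bar R}) (r : T -> R) :
  measurable_fun setT r -> (forall x, 0 <= r x) ->
  (forall A, measurable A -> nu A = (\int[mu]_(x in A) (r x)%:E)%E) ->
  forall (f : T -> \bar R) (D : set T), measurable D -> measurable_fun D f ->
  (forall w, (0 <= f w)%E) ->
  (\int[nu]_(w in D) f w = \int[mu]_(w in D) (f w * (r w)%:E))%E.
Proof.
move=> mr r0 nuE f D mD mf f0.
have mr' : measurable_fun [set: T] (EFin \o r) by exact/measurable_EFinP.
have dom : nu `<< mu.
  apply/null_content_dominatesP => A mA PA0.
  rewrite nuE// null_set_integral//; exact: measurable_funTS.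
have iRN := Radon_Nikodym_SigmaFinite.f_integrable dom.
rewrite -(Radon_Nikodym_SigmaFinite.change_of_variables dom)//.
apply: ae_eq_integral => //.
- by apply: emeasurable_funM => //; apply: measurable_funTS; exact: measurable_int iRN.
- by apply: emeasurable_funM => //; exact: measurable_funTS.
- apply: (@ae_eqe_mul2l _ _ _ mu D _ (EFin \o r) f).
  apply: (ae_eq_subset (@subsetT _ D)).
  apply: integral_ae_eq => // E _ mE.
  by rewrite -(Radon_Nikodym_SigmaFinite.f_integral dom)// nuE.
Qed.

Lemma complete_square (l tau x z : R) : tau != 0 -> 1 + 2 * l * tau ^+ 2 != 0 ->
  - (l * (x + z) ^+ 2) + - z ^+ 2 / (tau ^+ 2 *+ 2) =
  - (l / (1 + 2 * l * tau ^+ 2) * x ^+ 2) +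
  - (z - - (2 * l * tau ^+ 2 * x / (1 + 2 * l * tau ^+ 2))) ^+ 2 /
     (tau ^+ 2 / (1 + 2 * l * tau ^+ 2) *+ 2).
Proof.
rewrite !(mulr2n (tau ^+ 2)) (mulr2n (_ / _)); move=> t0 D0; field.
by rewrite D0/= -mulr2n mulrn_eq0/= expf_neq0.
Qed.

(** After completing the square, a Gaussian weight times a centred normal density is a constant
    times another normal density. Integrals are then read off from its total mass 1. *)
Lemma normal_pdf_mul_gauss (l tau x z : R) : 0 <= l -> 0 < tau ->
  let D := 1 + 2 * l * tau ^+ 2 in
  expR (- (l * (x + z) ^+ 2)) * normal_pdf 0 tau z =
  (Num.sqrt D)^-1 * expR (- (l / D * x ^+ 2)) *
    normal_pdf (- (2 * l * tau ^+ 2 * x / D)) (tau / Num.sqrt D) z.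
Proof.
move=> l0 t0 D.
have D1 : 1 <= D by have := mulr_ge0 l0 (sqr_ge0 tau); rewrite /D; lra.
have D0 : 0 < D by exact: lt_le_trans D1.
have sD0 : 0 < Num.sqrt D by rewrite sqrtr_gt0.
have sD2 : Num.sqrt D ^+ 2 = D by rewrite sqr_sqrtr// ltW.
rewrite !normal_pdfE ?gt_eqF// ?divr_gt0// /normal_peak /normal_fun subr0.
have -> : (Num.sqrt ((tau / Num.sqrt D) ^+ 2 * pi *+ 2))^-1 =
    Num.sqrt D / Num.sqrt (tau ^+ 2 * pi *+ 2).
  have -> : (tau / Num.sqrt D) ^+ 2 * pi *+ 2 = (tau ^+ 2 * pi *+ 2) / D.
    by rewrite exprMn exprVn sD2 !mulr2n; ring.
  rewrite sqrtrM ?sqrtrV ?ltW// ?invfM ?invrK 1?mulrC//.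
  by rewrite mulrn_wgt0// mulr_gt0 ?exprn_gt0 ?pi_gt0.
have cancel (a q e e' : R) : a != 0 -> a^-1 * e * (a / q * e') = q^-1 * (e * e').
  by move=> a0; rewrite mulrACA (mulrA a^-1) mulVf// mul1r.
rewrite mulrCA cancel ?gt_eqF//; congr (_ * _); rewrite -!expRD; congr expR.
rewrite exprMn exprVn sD2 /D; apply: complete_square.
- by rewrite gt_eqF.
- by rewrite -/D gt_eqF.
Qed.

Lemma normal_gauss (l tau x : R) : 0 <= l -> 0 < tau ->
  let D := 1 + 2 * l * tau ^+ 2 in
  \int[normal_prob 0 tau]_z expR (- (l * (x + z) ^+ 2)) =
  (Num.sqrt D)^-1 * expR (- (l / D * x ^+ 2)).
Proof.
move=> l0 t0 D; rewrite /Rintegral.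
rewrite (@ge0_integral_density _ _ lebesgue_measure (normal_prob 0 tau) (normal_pdf 0 tau))//.
- under eq_integral do rewrite -EFinM normal_pdf_mul_gauss// EFinM.
  rewrite integralZl//; last exact: integrable_normal_pdf.
  by rewrite integral_normal_pdf mule1.
- exact: measurable_normal_pdf.
- exact: normal_pdf_ge0.
- apply/measurable_EFinP; apply: measurableT_comp => //.
  by apply: measurableT_comp => //; apply: measurable_funM => //;
    apply: measurable_funX; exact: measurable_funD.
Qed.

Lemma norm_mul_gauss_le (l y : R) : 0 < l ->
  `|y| * expR (- (l * y ^+ 2)) <= 1 + l^-1.
Proof.
move=> l0; rewrite expRN ler_pdivrMr ?expR_gt0//.
have h : 1 + l * y ^+ 2 <= expR (l * y ^+ 2) by exact: expR_ge1Dx.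
have li0 : 0 < l^-1 by rewrite invr_gt0.
apply: (@le_trans _ _ ((1 + l^-1) * (1 + l * y ^+ 2))); last first.
  by rewrite ler_wpM2l//; lra.
have -> : (1 + l^-1) * (1 + l * y ^+ 2) = 1 + l^-1 + l * y ^+ 2 + y ^+ 2.
  by field; rewrite gt_eqF.
have : `|y| <= 1 + y ^+ 2.
  by rewrite -(real_normK (num_real y)); have := sqr_ge0 (`|y| - 1); nra.
have := mulr_ge0 (ltW l0) (sqr_ge0 y); lra.
Qed.

(** The bound is uniform over the rates l >= 1. This is what restricting the rate at time 1 buys in
    the study of the meander: a single dominating constant for all grid cells. *)
Lemma norm_mul_gauss_le1 (l y : R) : 1 <= l -> `|y| * expR (- (l * y ^+ 2)) <= 1.
Proof.
move=> l1; rewrite expRN ler_pdivrMr ?expR_gt0// mul1r.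
have h : 1 + l * y ^+ 2 <= expR (l * y ^+ 2) by exact: expR_ge1Dx.
apply: le_trans h.
have : `|y| <= 1 + y ^+ 2.
  by rewrite -(real_normK (num_real y)); have := sqr_ge0 (`|y| - 1); nra.
have := ler_wpM2r (sqr_ge0 y) l1; lra.
Qed.

Lemma continuous_gauss (l : R) : continuous (fun y : R => expR (- (l * y ^+ 2))).
Proof.
move=> y; apply: continuous_comp; last exact: continuous_expR.
by apply: continuousN; apply: continuousM; [exact: cst_continuous|exact: exprn_continuous].
Qed.

Lemma bmeas_gauss_shift (l x : R) : 0 <= l ->
  bounded_measurable (fun z : R => expR (- (l * (x + z) ^+ 2))).
Proof.
move=> l0; apply: (@bmeas_le _ _ _ 1).
  apply: measurableT_comp => //.
  by apply: measurableT_comp => //; apply: measurable_funM => //;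
    apply: measurable_funX; exact: measurable_funD.
move=> z; rewrite ger0_norm ?expR_ge0// -expR0 ler_expR oppr_le0.
by rewrite mulr_ge0// sqr_ge0.
Qed.

Lemma is_derive_gauss (l z x : R) :
  is_derive x (1 : R) (fun x => expR (- (l * (x + z) ^+ 2)))
    (- (2 * l * ((x + z) * expR (- (l * (x + z) ^+ 2))))).
Proof.
have h : is_derive x (1:R) (fun x => - (l * (x + z) ^+ 2)) (- (2 * l * (x + z))).
  by apply: is_derive_eq; rewrite /GRing.scale/=; ring.
apply: is_derive_eq; rewrite /GRing.scale/=; ring.
Qed.

(** This is the derivative in x of the identity [normal_gauss], up to the factor -2 l.
    Differentiation under the integral is allowed because the derivative of the integrand is bounded
    by [K] uniformly in x and z. *)
Lemma normal_gauss1 (l tau x : R) : 0 < l -> 0 < tau ->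
  let D := 1 + 2 * l * tau ^+ 2 in
  \int[normal_prob 0 tau]_z ((x + z) * expR (- (l * (x + z) ^+ 2))) =
  D^-1 * (Num.sqrt D)^-1 * (x * expR (- (l / D * x ^+ 2))).
Proof.
move=> l0 t0 D.
pose f (x z : R) := expR (- (l * (x + z) ^+ 2)).
have fE y z : partial1of2 f y z = - (2 * l * ((y + z) * f y z)).
  rewrite /partial1of2 derive1E; have h := is_derive_gauss l z y.
  exact: derive_val.
pose K := 2 * l * (1 + l^-1).
have fK y z : `|partial1of2 f y z| <= K.
  have ll : 0 <= 2 * l by rewrite mulr_ge0// ltW.
  rewrite fE normrN normrM (ger0_norm ll) /K; apply: ler_wpM2l => //.
  by rewrite normrM (ger0_norm (expR_ge0 _)); exact: norm_mul_gauss_le.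
have K0 : 0 <= K by exact: le_trans (normr_ge0 _) (fK 0 0).
have xI : `]x - 1, x + 1[%classic x by rewrite /= in_itv/=; lra.
have intf y : `]x - 1, x + 1[%classic y ->
    (normal_prob 0 tau).-integrable setT (EFin \o f y).
  by move=> _; apply: bmeas_integrable => //; exact: (bmeas_gauss_shift y (ltW l0)).
have derf y z : `]x - 1, x + 1[%classic y -> setT z -> derivable (f ^~ z) y 1.
  by move=> _ _; have h := is_derive_gauss l z y; exact: ex_derive.
have intK : (normal_prob 0 tau).-integrable setT (EFin \o cst K).
  exact: finite_measure_integrable_cst.
have := differentiation_under_integral measurableT xI intf derf (fun=> K0) intK
  (fun y z _ _ => fK y z).
under [X in _ = X -> _]eq_Rintegral do rewrite fE -mulNr.
have b1 : bounded_measurable (fun z => (x + z) * f x z).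
  apply: (@bmeas_le _ _ _ (1 + l^-1)).
    apply: measurable_funM; first exact: measurable_funD.
    by have [] := bmeas_gauss_shift x (ltW l0).
  by move=> z; rewrite normrM (ger0_norm (expR_ge0 _)); exact: norm_mul_gauss_le.
rewrite EZ//.
(* The added 0 gives the right-hand side the shape handled by [is_derive_gauss] with zero shift. *)
have -> : (fun y => \int[normal_prob 0 tau]_z f y z) =
  (fun y => (Num.sqrt D)^-1 * expR (- (l / D * (y + 0) ^+ 2))).
  by apply/funext => y; rewrite normal_gauss// ?ltW// addr0.
have h := is_derive_gauss (l / D) 0 x.
have h' : is_derive x (1:R) (fun y => (Num.sqrt D)^-1 * expR (- (l / D * (y + 0) ^+ 2)))
   ((Num.sqrt D)^-1 * - (2 * (l / D) * ((x + 0) * expR (- (l / D * (x + 0) ^+ 2))))).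
  by apply: is_derive_eq; rewrite /GRing.scale/=; ring.
rewrite derive1E derive_val addr0 => {}h.
have ll0 : - (2 * l) != 0 by rewrite oppr_eq0 mulf_neq0// gt_eqF.
apply: (mulfI ll0); rewrite -h; ring.
Qed.

End gaussian_integrals.

(** * The path space with its cylinder sigma-algebra, and the Markov steps *)

Section paths.
Context {R : realType}.

(** The generators of [cylinder I]. Naming them turns the set of paths into a measurable type, so
    that functionals of a path are ordinary measurable functions. *)
Definition cylinder_generators (I : set R) : set (set (R -> R)) :=
  [set C | exists2 t, I t & exists2 A : set R, measurable A &
         C = [set f : R -> R | A (f t)]].

Local Notation path_space I := (g_sigma_algebraType (cylinder_generators I)).

Lemma measurable_eval (I : set R) (t : R) : I t ->
  measurable_fun [set: path_space I] (fun f : path_space I => f t).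
Proof.
move=> It _ A mA; rewrite setTI; apply: sub_sigma_algebra.
by exists t => //; exists A.
Qed.

Lemma cylinder_subset (I J : set R) : I `<=` J -> cylinder I `<=` cylinder J.
Proof.
move=> IJ; apply: smallest_sub; first exact: smallest_sigma_algebra.
move=> _ [t It [A mA ->]]; apply: sub_sigma_algebra.
by exists t; [exact: IJ|exists A].
Qed.

Lemma measurable_path_subset (I J : set R) d (T : measurableType d)
    (f : path_space I -> T) : I `<=` J ->
  measurable_fun [set: path_space I] f -> measurable_fun [set: path_space J] f.
Proof.
move=> IJ mf _ A mA; rewrite setTI; apply: (cylinder_subset IJ).
by have := mf measurableT _ mA; rewrite setTI.
Qed.

Lemma measurable_path {d} {Omega : measurableType d} (I : set R)
    (X : R -> Omega -> R) : (forall t, I t -> measurable_fun setT (X t)) ->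
  measurable_fun setT (fun w => (X ^~ w) : path_space I).
Proof.
move=> mX. refine (@measurability _ _ _ (path_space I) setT _ (cylinder_generators I) _ _) => //.
move=> _ [_ [t It [A mA ->]] <-]; rewrite setTI.
exact: (measurable_preimageT (mX t It) mA).
Qed.

End paths.

Local Notation path_space I := (g_sigma_algebraType (cylinder_generators I)).

Section markov.
Context {R : realType} {d} {Omega : measurableType d}.
Variables (P : probability Omega R) (B : R -> Omega -> R).
Hypothesis BM : brownian_motion P B.

(** Adaptedness is a factorization through the path space over [0, t], with boundedness built in.
    This matches the definition of Brownian motion, where independence of increments is stated for
    cylinder events. *)
Definition adapted (t : R) (th : Omega -> R) :=
  exists2 Th : path_space `[0, t] -> R, bounded_measurable Th &
    th = fun w => Th (B ^~ w).

Lemma brownian_measurable t : 0 <= t -> measurable_fun setT (B t).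
Proof. by case: BM => -[mB _] _ _ _ t0; apply: mB; rewrite /= in_itv/= t0. Qed.

Lemma brownian_path_measurable (t : R) :
  measurable_fun setT (fun w => (B ^~ w) : path_space `[0, t]).
Proof.
apply: measurable_path => s; rewrite /= in_itv/= => /andP[s0 _].
exact: brownian_measurable.
Qed.

Lemma adapted_bmeas t th : adapted t th -> bounded_measurable th.
Proof.
move=> [Th bTh ->]; apply: bmeas_comp bTh; exact: brownian_path_measurable.
Qed.

Lemma adapted_le s t th : s <= t -> adapted s th -> adapted t th.
Proof.
move=> st [Th [mTh bTh] ->]; exists Th => //; split => //.
apply: measurable_path_subset mTh => x /=; rewrite !in_itv/= => /andP[-> xs]/=.
exact: le_trans st.
Qed.

Lemma adaptedM t th th' : adapted t th -> adapted t th' ->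
  adapted t (fun w => th w * th' w).
Proof.
by move=> [Th bTh ->] [Th' bTh' ->]; exists (fun f => Th f * Th' f) => //; exact: bmeasM.
Qed.

Lemma adapted_event t C : cylinder `[0, t] C ->
  adapted t (\1_(path_event B C) : Omega -> R).
Proof. by move=> mC; exists (\1_C) => //; exact: bmeas_indic. Qed.

Lemma adapted_eval s t (f : R -> R) : 0 <= s <= t -> bounded_measurable f ->
  adapted t (fun w => f (B s w)).
Proof.
move=> st bf; exists (fun g => f (g s)) => //.
by apply: bmeas_comp bf; exact: measurable_eval.
Qed.

(** The path on [0, t] and the increment up to r are independent, so [E_indep] applies to
    [Th f * phi (f t, z)] on the path space; the inner integral is against the normal law of the
    increment. *)
Lemma markov_expectation (t r : R) th (phi : R * R -> R) : 0 <= t -> t < r ->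
  adapted t th -> bounded_measurable phi ->
  \int[P]_w (th w * phi (B t w, B r w - B t w)) =
  \int[P]_w (th w * \int[normal_prob 0 (Num.sqrt (r - t))]_z phi (B t w, z)).
Proof.
move=> t0 tr [Th bTh ->] bphi.
have r0 : 0 <= r by exact: le_trans (ltW tr).
have mG : measurable_fun setT (fun w => B r w - B t w).
  by apply: measurable_funB; exact: brownian_measurable.
have tt : `[0, t]%classic t by rewrite /= in_itv/= t0 lexx.
pose psi (z : path_space `[0, t] * R) := Th z.1 * phi (z.1 t, z.2).
have bpsi : bounded_measurable psi.
  apply: bmeasM; first exact: bmeas_comp bTh.
  apply: (bmeas_comp (h := fun z : path_space `[0, t] * R => (z.1 t, z.2)) _ bphi).
  apply/measurable_fun_pair => //.
  exact: (measurableT_comp (measurable_eval tt)).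
have := E_indep (phi := psi) (@brownian_path_measurable t) mG _ bpsi.
rewrite /psi/= => ->; last first.
  by move=> A C mA mC; case: BM => _ _ _ /(_ t r t0 tr); apply.
apply: eq_Rintegral => w _; rewrite EZ; last first.
  apply: (bmeas_comp (h := fun w' => (B t w, B r w' - B t w')) _ bphi).
  exact/measurable_fun_pair.
congr (_ * _).
refine (@E_law R _ _ P _ _ (normal_prob 0 (Num.sqrt (r - t))) _ (fun z => phi (B t w, z)) mG _ _).
- by move=> A mA; case: BM => _ _ /(_ t r t0 tr) + _; apply.
- exact: bmeas_section1.
Qed.

Lemma bmeas_odd_gauss (l : R) : 0 < l ->
  bounded_measurable (fun y : R => y * expR (- (l * y ^+ 2))).
Proof.
move=> l0; apply: (@bmeas_le _ _ _ (1 + l^-1)).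
  by apply: measurable_funM => //; apply: continuous_measurable_fun; exact: continuous_gauss.
by move=> y; rewrite normrM (ger0_norm (expR_ge0 _)); exact: norm_mul_gauss_le.
Qed.

Lemma bmeas_even_gauss (l : R) : 0 <= l ->
  bounded_measurable (fun y : R => expR (- (l * y ^+ 2))).
Proof.
move=> l0; apply: (@bmeas_le _ _ _ 1).
  by apply: continuous_measurable_fun; exact: continuous_gauss.
move=> y; rewrite (ger0_norm (expR_ge0 _)) -expR0 ler_expR oppr_le0.
by rewrite mulr_ge0// sqr_ge0.
Qed.

(** Functions y e^(-l y^2) are stable under the transition: going back from r to t costs a factor
    D^(-3/2) and changes the rate to l / D. The case t = r stands apart, since increments have a
    prescribed law for t < r only. *)
Lemma markov_gauss1 (t r l : R) th : 0 <= t -> t <= r -> 0 < l -> adapted t th ->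
  let D := 1 + 2 * l * (r - t) in
  \int[P]_w (th w * (B r w * expR (- (l * B r w ^+ 2)))) =
  D^-1 * (Num.sqrt D)^-1 * \int[P]_w (th w * (B t w * expR (- (l / D * B t w ^+ 2)))).
Proof.
move=> t0 tr l0 ath D; rewrite -EZ; last first.
  apply: bmeasM; first exact: adapted_bmeas ath.
  apply: (bmeas_comp (h := B t) (f := fun y => y * expR (- (l / D * y ^+ 2)))).
    exact: brownian_measurable.
  by apply: bmeas_odd_gauss; rewrite divr_gt0// /D; nra.
move: tr; rewrite le_eqVlt => /predU1P[tr|tr].
  rewrite /D tr subrr mulr0 addr0 invr1 sqrtr1 invr1 mulr1.
  by apply: eq_Rintegral => w _; rewrite mul1r mulr1.
pose phi (z : R * R) := (z.1 + z.2) * expR (- (l * (z.1 + z.2) ^+ 2)).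
have bphi : bounded_measurable phi.
  apply: (bmeas_comp (h := fun z : R * R => z.1 + z.2) _ (bmeas_odd_gauss l0)).
  exact: measurable_funD.
transitivity (\int[P]_w (th w * phi (B t w, B r w - B t w))).
  by apply: eq_Rintegral => w _; rewrite /phi/= addrC subrK.
rewrite markov_expectation//; apply: eq_Rintegral => w _.
have rt : 0 < r - t by rewrite subr_gt0.
rewrite /phi/= normal_gauss1 ?sqrtr_gt0//= sqr_sqrtr ?ltW// -/D.
ring.
Qed.

Lemma markov_gauss (t r l : R) th : 0 <= t -> t <= r -> 0 <= l -> adapted t th ->
  let D := 1 + 2 * l * (r - t) in
  \int[P]_w (th w * expR (- (l * B r w ^+ 2))) =
  (Num.sqrt D)^-1 * \int[P]_w (th w * expR (- (l / D * B t w ^+ 2))).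
Proof.
move=> t0 tr l0 ath D.
have D1 : 1 <= D by rewrite /D; nra.
rewrite -EZ; last first.
  apply: bmeasM; first exact: adapted_bmeas ath.
  apply: (bmeas_comp (h := B t) (f := fun y => expR (- (l / D * y ^+ 2)))).
    exact: brownian_measurable.
  by apply: bmeas_even_gauss; rewrite divr_ge0//; lra.
move: tr; rewrite le_eqVlt => /predU1P[tr|tr].
  rewrite /D tr subrr mulr0 addr0 sqrtr1 invr1.
  by apply: eq_Rintegral => w _; rewrite mul1r mulr1.
pose phi (z : R * R) := expR (- (l * (z.1 + z.2) ^+ 2)).
have bphi : bounded_measurable phi.
  apply: (bmeas_comp (h := fun z : R * R => z.1 + z.2) _ (bmeas_even_gauss l0)).
  exact: measurable_funD.
transitivity (\int[P]_w (th w * phi (B t w, B r w - B t w))).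
  by apply: eq_Rintegral => w _; rewrite /phi/= addrC subrK.
rewrite markov_expectation//; apply: eq_Rintegral => w _.
have rt : 0 < r - t by rewrite subr_gt0.
rewrite /phi/= normal_gauss ?sqrtr_gt0//= sqr_sqrtr ?ltW// -/D.
ring.
Qed.

End markov.

(** * Zeros of the Brownian path *)

Section zeros.
Context {R : realType}.

Lemma within_continuous_seq (I : set R) (f : R -> R) (u : nat -> R) (v : R) :
  {within I, continuous f} -> I v -> (forall n, I (u n)) ->
  u n @[n --> \oo] --> v -> f (u n) @[n --> \oo] --> f v.
Proof.
move=> /subspace_continuousP cf Iv Iu uv.
have uw : u n @[n --> \oo] --> within I (nbhs v).
  move=> A wA; have := uv _ wA; rewrite /= => -[N _ NA].
  by exists N => // n Nn; exact: (NA n Nn (Iu n)).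
exact: cvg_comp uw (cf v Iv).
Qed.

Lemma near_oo_cvg0 (u : nat -> R) (v : R) (C : R) :
  (forall n, `|u n - v| <= C / n.+1%:R) -> u n @[n --> \oo] --> v.
Proof.
move=> uv; apply/subr_cvg0; apply: norm_cvg0.
apply: (@squeeze_cvgr _ _ _ _ (fun=> 0) (fun n => C * n.+1%:R^-1)).
- by apply: nearW => n; rewrite normr_ge0 uv.
- exact: cvg_cst.
- by rewrite -[X in _ --> X](mulr0 C); apply: cvgMr; exact: cvg_harmonic.
Qed.

Definition grid (a b : R) (N i : nat) : R := a + (b - a) * (i%:R / N.+1%:R).

Lemma grid_itv a b N i : a <= b -> (i <= N.+1)%N -> a <= grid a b N i <= b.
Proof.
move=> ab iN; have h0 : 0 <= i%:R / N.+1%:R :> R by rewrite divr_ge0.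
have h1 : i%:R / N.+1%:R <= 1 :> R by rewrite ler_pdivrMr// mul1r ler_nat.
have ba : 0 <= b - a by rewrite subr_ge0.
rewrite /grid lerDl mulr_ge0//= -lerBrDl -[leRHS]mulr1.
exact: ler_wpM2l.
Qed.

Lemma grid_floor (a b z : R) (N : nat) : a < b -> a <= z <= b ->
  exists2 i, (i <= N.+1)%N & grid a b N i <= z < grid a b N i + (b - a) / N.+1%:R.
Proof.
move=> ab /andP[az zb]; pose x := (z - a) / (b - a).
have ba0 : 0 < b - a by rewrite subr_gt0.
have x0 : 0 <= x by rewrite divr_ge0 ?subr_ge0// ltW.
have x1 : x <= 1 by rewrite ler_pdivrMr// mul1r; lra.
have zE : z = a + (b - a) * x by rewrite /x; field; rewrite gt_eqF.
have N0 : 0 < N.+1%:R :> R by rewrite ltr0n.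
have xN : 0 <= x * N.+1%:R by rewrite mulr_ge0.
have /andP[h1 h2] := truncn_itv xN.
exists (Num.truncn (x * N.+1%:R)).
  rewrite -(@ler_nat R); apply: (le_trans h1).
  by rewrite -[leRHS]mul1r ler_wpM2r// ltW.
have e1 : (Num.truncn (x * N.+1%:R))%:R / N.+1%:R <= x by rewrite ler_pdivrMr.
have e2 : x < (Num.truncn (x * N.+1%:R))%:R / N.+1%:R + N.+1%:R^-1.
  by rewrite -[X in _ < _ + X]mul1r -mulrDl ltr_pdivlMr// natr1.
rewrite /grid {1 2}zE lerD2l ler_pM2l// e1/= -addrA ltrD2l -mulrDr ltr_pM2l//.
Qed.

(* Spelled out through countably many times, so that it lies in the cylinder
   sigma-algebra although it is not defined by finitely many coordinates. *)
Definition zero_event (a b : R) : set (R -> R) :=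
  \bigcap_n \bigcup_N \bigcup_(i in [set i | (i <= N.+1)%N])
    [set f : R -> R | `|f (grid a b N i)| < n.+1%:R^-1].

Lemma zero_event_cylinder (I : set R) (a b : R) : a <= b -> `[a, b] `<=` I ->
  cylinder I (zero_event a b).
Proof.
move=> ab abI.
apply: (@bigcapT_measurable _ (g_sigma_algebraType (cylinder_generators I))) => n.
apply: (@bigcupT_measurable _ (g_sigma_algebraType (cylinder_generators I))) => N.
apply: (@bigcup_measurable _ (g_sigma_algebraType (cylinder_generators I))) => i /= iN.
apply: sub_sigma_algebra; exists (grid a b N i).
  by apply: abI; rewrite /= in_itv/=; exact: grid_itv.
exists [set x : R | `|x| < n.+1%:R^-1] => //.
rewrite (_ : [set x : R | `|x| < n.+1%:R^-1] = (fun x : R => `|x|) @^-1` `]-oo, (n.+1%:R^-1)%R[%classic).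
  exact: measurable_preimageT.
by apply/seteqP; split => x; rewrite /= in_itv.
Qed.

(** If the grid values come arbitrarily close to 0, the minimum of |f| on the compact interval is 0.
    Conversely, the grid points just below a zero converge to it. *)
Lemma zero_eventP (a b : R) (f : R -> R) : a <= b ->
  {within `[a, b], continuous f} ->
  zero_event a b f <-> exists2 z, a <= z <= b & f z = 0.
Proof.
move=> ab cf; split=> [zf|[z azb fz0] n _].
  have cnf : {within `[a, b], continuous (fun x => `|f x|)}.
    by move=> x; apply: continuous_comp; [exact: cf|exact: norm_continuous].
  have [c cab cmin] := EVT_min ab cnf.
  exists c; first by move: cab; rewrite in_itv.
  apply/normr0_eq0/eqP; rewrite eq_le normr_ge0 andbT leNgt; apply/negP => fc0.
  have [n _ nle] := near_infty_natSinv_lt (PosNum fc0).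
  have [N _ [i /= iN]] := zf n Logic.I.
  apply/negP; rewrite -leNgt; apply: (le_trans (ltW (nle n (leqnn n)))) => /=.
  by apply: cmin; rewrite in_itv/=; exact: grid_itv.
move: ab; rewrite le_eqVlt => /predU1P[ab|ab].
  exists 0%N => //; exists 0%N => //=; rewrite /grid mul0r mulr0 addr0.
  have -> : a = z by apply/eqP; rewrite eq_le; move: azb; rewrite -ab.
  by rewrite fz0 normr0 invr_gt0.
have /choice[i iP] : forall N, exists i, (i <= N.+1)%N /\
    grid a b N i <= z < grid a b N i + (b - a) / N.+1%:R.
  by move=> N; have [i] := grid_floor N ab azb; exists i.
have : f (grid a b N (i N)) @[N --> \oo] --> f z.
  apply: (within_continuous_seq cf).
  - by rewrite /= in_itv.
  - by move=> N; rewrite /= in_itv/= grid_itv ?ltW//; case: (iP N).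
  - apply: (@near_oo_cvg0 _ _ (b - a)) => N; case: (iP N) => _ /andP[h1 h2].
    by rewrite distrC ger0_norm ?subr_ge0// lerBlDl ltW.
rewrite fz0 => /cvgr0_norm_lt/(_ n.+1%:R^-1); rewrite invr_gt0 ltr0n => /(_ isT).
by case=> N _ /(_ N (leqnn N)) h; exists N => //; exists (i N) => //=; case: (iP N).
Qed.

Lemma first_zero (a b : R) (f : R -> R) : {within `[a, b], continuous f} ->
  (exists2 z, a <= z <= b & f z = 0) ->
  exists T, [/\ a <= T <= b, f T = 0 & forall z, a <= z <= b -> f z = 0 -> T <= z].
Proof.
move=> cf [z0 z0ab fz0]; pose S := [set z | a <= z <= b /\ f z = 0].
have Sz0 : S z0 by [].
have lS : lbound S a by move=> z [/andP[]].
have hS : has_inf S by split; [exists z0|exists a].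
pose T := inf S.
have TS z : S z -> T <= z by apply: ge_inf; exists a.
have aT : a <= T by apply: lb_le_inf => //; exists z0.
have Tb : T <= b by apply: (le_trans (TS _ Sz0)); case/andP: z0ab.
have /choice[u uP] : forall n : nat, exists z, S z /\ z < T + n.+1%:R^-1.
  move=> n; have n0 : 0 < n.+1%:R^-1 :> R by rewrite invr_gt0.
  by have [e Se eT] := inf_adherent n0 hS; exists e.
have uT : u n @[n --> \oo] --> T.
  apply: (@near_oo_cvg0 _ _ 1) => n; have [Su uTn] := uP n.
  by rewrite ger0_norm ?subr_ge0 ?TS// mul1r lerBlDl ltW.
have fuT : f (u n) @[n --> \oo] --> f T.
  apply: (within_continuous_seq cf) => //; first by rewrite /= in_itv/= aT.
  by move=> n; have [[h _] _] := uP n; rewrite /= in_itv.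
exists T; split; [by rewrite aT| |by move=> z h fz; exact: TS].
apply: (cvg_unique _ fuT) => //.
rewrite (_ : (fun n => f (u n)) = fun=> 0); first exact: cvg_cst.
by apply/funext => n; have [[]] := uP n.
Qed.

Lemma last_zeroP (f : R -> R) : {within `[0, 1], continuous f} -> f 0 = 0 ->
  let g := sup [set t | 0 <= t <= 1 /\ f t = 0] in
  [/\ 0 <= g <= 1, f g = 0 & forall z, 0 <= z <= 1 -> f z = 0 -> z <= g].
Proof.
move=> cf f0 /=; set S := [set t | _]; set g := sup S.
have S0 : S 0 by split; rewrite ?lexx ?ler01.
have uS : ubound S 1 by move=> z [/andP[]].
have hS : has_sup S by split; [exists 0|exists 1].
have gS z : S z -> z <= g by apply: ub_le_sup; exists 1.
have g1 : g <= 1 by apply: ge_sup => //; exists 0.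
have g0 : 0 <= g by exact: gS.
have /choice[u uP] : forall n : nat, exists z, S z /\ g - n.+1%:R^-1 < z.
  move=> n; have n0 : 0 < n.+1%:R^-1 :> R by rewrite invr_gt0.
  by have [e Se eT] := sup_adherent n0 hS; exists e.
have uT : u n @[n --> \oo] --> g.
  apply: (@near_oo_cvg0 _ _ 1) => n; have [Su uTn] := uP n.
  by rewrite ler0_norm ?subr_le0 ?gS// mul1r opprB lerBlDl ltW// -ltrBlDr.
have fuT : f (u n) @[n --> \oo] --> f g.
  apply: (within_continuous_seq cf) => //; first by rewrite /= in_itv/= g0.
  by move=> n; have [[h _] _] := uP n; rewrite /= in_itv.
split; [by rewrite g0| |by move=> z h fz; exact: gS].
apply: (cvg_unique _ fuT) => //.
rewrite (_ : (fun n => f (u n)) = fun=> 0); first exact: cvg_cst.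
by apply/funext => n; have [[]] := uP n.
Qed.

End zeros.

(** * Conditional means of an odd functional of the path *)

Section killed.
Context {R : realType} {d} {Omega : measurableType d}.
Variables (P : probability Omega R) (B : R -> Omega -> R).
Hypothesis BM : brownian_motion P B.

Lemma bmeas_adapted t th : adapted B t th -> bounded_measurable th.
Proof. exact: (adapted_bmeas BM). Qed.

Lemma adaptedB t th th' : adapted B t th -> adapted B t th' ->
  adapted B t (fun w => th w - th' w).
Proof.
by move=> [Th bTh ->] [Th' bTh' ->]; exists (fun f => Th f - Th' f) => //; exact: bmeasB.
Qed.

Lemma adapted_gauss s t l : 0 <= s <= t -> 0 <= l ->
  adapted B t (fun w => expR (- (l * B s w ^+ 2))).
Proof.
move=> st l0; apply: (@adapted_eval _ _ _ B _ _ (fun x => expR (- (l * x ^+ 2)))) => //.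
exact: bmeas_even_gauss.
Qed.

Lemma mul_inv_sqrt_le1 (D : R) : 1 <= D -> 0 <= D^-1 * (Num.sqrt D)^-1 <= 1.
Proof.
move=> D1; have D0 : 0 < D by exact: lt_le_trans D1.
have s1 : 1 <= Num.sqrt D by rewrite -(sqrtr1 R) ler_wsqrtr.
have s0 : 0 < Num.sqrt D by exact: lt_le_trans s1.
have i0 : 0 <= D^-1 by rewrite invr_ge0 ltW.
have j0 : 0 <= (Num.sqrt D)^-1 by rewrite invr_ge0 ltW.
by rewrite mulr_ge0//= mulr_ile1// invf_le1.
Qed.

Let odd_functional (q l m : R) (w : Omega) : R :=
  expR (- (l * B q w ^+ 2)) * (B 1 w * expR (- (m * B 1 w ^+ 2))).

Lemma odd_functional_bmeas q l m : 0 <= q -> 0 <= l -> 1 <= m ->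
  bounded_measurable (odd_functional q l m).
Proof.
move=> q0 l0 m1; apply: bmeasM.
  apply: (bmeas_comp (h := B q) (f := fun x => expR (- (l * x ^+ 2)))).
    exact: (brownian_measurable BM).
  exact: bmeas_even_gauss.
apply: (bmeas_comp (h := B 1) (f := fun x => x * expR (- (m * x ^+ 2)))).
  by apply: (brownian_measurable BM).
by apply: bmeas_odd_gauss; lra.
Qed.

Lemma odd_functional_le1 q l m w : 0 <= l -> 1 <= m -> `|odd_functional q l m w| <= 1.
Proof.
move=> l0 m1; rewrite normrM ger0_norm ?expR_ge0// mulr_ile1 ?expR_ge0//.
  by rewrite -expR0 ler_expR oppr_le0 mulr_ge0// sqr_ge0.
by rewrite normrM (ger0_norm (expR_ge0 _)) norm_mul_gauss_le1.
Qed.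

(** Conditioning back to time t leaves a factor in [0, 1], the value B(t) and Gaussian weights, so
    the mean is small when B(t) is. If q <= t, the weight at q belongs to the past. Otherwise one
    conditions at q, merges the two Gaussian weights into one of rate l + m / D1, and then
    conditions at t. *)
Lemma odd_functional_small t q l m th : 0 <= t <= 1 -> 0 <= q <= 1 -> 0 <= l ->
  1 <= m -> adapted B t th -> bounded_measurable (fun w => `|th w| * `|B t w|) ->
  `|\int[P]_w (th w * odd_functional q l m w)| <= \int[P]_w (`|th w| * `|B t w|).
Proof.
move=> /andP[t0 t1] /andP[q0 q1] l0 m1 ath bth.
have m0 : 0 < m by lra.
have bodd s c : 0 <= s -> 0 < c ->
    bounded_measurable (fun w => B s w * expR (- (c * B s w ^+ 2))).
  move=> s0 c0.
  apply: (bmeas_comp (h := B s) (f := fun y => y * expR (- (c * y ^+ 2)))).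
    exact: (brownian_measurable BM).
  exact: bmeas_odd_gauss.
have bound (K c : R) (th' : Omega -> R) : 0 <= K <= 1 -> 0 < c ->
    bounded_measurable th' -> (forall w, `|th' w| <= `|th w|) ->
    `|K * \int[P]_w (th' w * (B t w * expR (- (c * B t w ^+ 2))))| <=
    \int[P]_w (`|th w| * `|B t w|).
  move=> /andP[K0 K1] c0 bth' th'th.
  have b1 : bounded_measurable (fun w => th' w * (B t w * expR (- (c * B t w ^+ 2)))).
    by apply: bmeasM => //; exact: bodd.
  rewrite normrM (ger0_norm K0).
  apply: (@le_trans _ _ `|\int[P]_w (th' w * (B t w * expR (- (c * B t w ^+ 2))))|).
    by rewrite -[leRHS]mul1r ler_wpM2r.
  apply: (le_trans (Enorm _ b1)); apply: Ele => //; first exact: bmeas_norm.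
  move=> w; rewrite !normrM ler_pM// -[leRHS]mulr1 ler_pM//.
  by rewrite (ger0_norm (expR_ge0 _)) -expR0 ler_expR oppr_le0 mulr_ge0 ?sqr_ge0// ltW.
have [qt|tq] := leP q t.
  pose th' w := th w * expR (- (l * B q w ^+ 2)).
  have ath' : adapted B t th' by apply: adaptedM => //; apply: adapted_gauss; rewrite ?q0.
  under eq_Rintegral do rewrite mulrA.
  rewrite (markov_gauss1 BM t0 t1 m0 ath').
  apply: bound.
  - by apply: mul_inv_sqrt_le1; nra.
  - by rewrite divr_gt0//; nra.
  - exact: bmeas_adapted ath'.
  - move=> w; rewrite normrM -[leRHS]mulr1 ler_pM// ger0_norm ?expR_ge0//.
    by rewrite -expR0 ler_expR oppr_le0 mulr_ge0// sqr_ge0.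
pose th' w := th w * expR (- (l * B q w ^+ 2)).
have ath' : adapted B q th'.
  apply: adaptedM; first exact: adapted_le (ltW tq) ath.
  by apply: adapted_gauss; rewrite ?q0/=.
under eq_Rintegral do rewrite mulrA.
rewrite (markov_gauss1 BM q0 q1 m0 ath').
set D1 := 1 + 2 * m * (1 - q).
have D11 : 1 <= D1 by rewrite /D1; nra.
have l'0 : 0 < l + m / D1 by rewrite ltr_wpDl// divr_gt0//; lra.
rewrite (_ : \int[P]_w _ =
    \int[P]_w (th w * (B q w * expR (- ((l + m / D1) * B q w ^+ 2))))); last first.
  apply: eq_Rintegral => w _; rewrite /th'.
  rewrite (_ : expR (- ((l + m / D1) * B q w ^+ 2)) =
    expR (- (l * B q w ^+ 2)) * expR (- (m / D1 * B q w ^+ 2))); first by ring.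
  by rewrite -expRD; congr expR; ring.
rewrite (markov_gauss1 BM t0 (ltW tq) l'0 ath) mulrA.
apply: bound => //.
- have /andP[a0 a1] := mul_inv_sqrt_le1 D11.
  set D2 := 1 + _.
  have D21 : 1 <= D2.
    by rewrite /D2 lerDl mulr_ge0 ?subr_ge0 ?ltW// mulr_gt0.
  have /andP[b0 b1] := mul_inv_sqrt_le1 D21.
  by rewrite mulr_ge0//= mulr_ile1.
- by rewrite divr_gt0// ltr_wpDr// mulr_ge0 ?subr_ge0 ?ltW// mulr_gt0.
- exact: bmeas_adapted ath.
Qed.

(** Where |B(t)| <= 1 the preceding bound applies; elsewhere the functional itself has modulus at
    most 1. Truncation at 1 keeps the right-hand side within bounded functions. *)
Lemma odd_functional_bound t q l m th : 0 <= t <= 1 -> 0 <= q <= 1 -> 0 <= l ->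
  1 <= m -> adapted B t th ->
  `|\int[P]_w (th w * odd_functional q l m w)| <=
  \int[P]_w (`|th w| * Num.min 1 `|B t w|).
Proof.
move=> t01 q01 l0 m1 ath; have /andP[t0 t1] := t01; have /andP[q0 q1] := q01.
pose chi x : R := \1_(`[-1, 1]%classic : set R) x.
have bchi : bounded_measurable chi by exact: bmeas_indic.
have achi : adapted B t (fun w => chi (B t w)).
  by apply: (@adapted_eval _ _ _ B _ _ (chi)); rewrite ?t0/=.
have bchi' : bounded_measurable (fun x => 1 - chi x).
  by apply: bmeasB => //; exact: bmeas_cst.
have achi' : adapted B t (fun w => 1 - chi (B t w)).
  by apply: (@adapted_eval _ _ _ B _ _ (fun x => 1 - chi x)); rewrite ?t0/=.
have chi01 x : chi x = 0 /\ 1 < `|x| \/ chi x = 1 /\ `|x| <= 1.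
  rewrite /chi indicE mem_setE in_itv/= -ler_norml.
  by case: (leP `|x| 1) => h; [right|left].
pose th1 w := th w * chi (B t w); pose th2 w := th w * (1 - chi (B t w)).
have ath1 : adapted B t th1 by exact: adaptedM.
have ath2 : adapted B t th2 by exact: adaptedM.
have bG := odd_functional_bmeas q0 l0 m1.
have b1 : bounded_measurable (fun w => th1 w * odd_functional q l m w).
  by apply: bmeasM => //; exact: bmeas_adapted ath1.
have b2 : bounded_measurable (fun w => th2 w * odd_functional q l m w).
  by apply: bmeasM => //; exact: bmeas_adapted ath2.
have mBt : measurable_fun setT (B t) by exact: (brownian_measurable BM).
have b3 : bounded_measurable (fun w => `|th1 w| * `|B t w|).
  have [mth1 _] := bmeas_adapted ath1; have [_ [M thM]] := bmeas_adapted ath.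
  apply: (@bmeas_le _ _ _ M).
    by apply: measurable_funM; exact: measurableT_comp.
  move=> w; rewrite normrM !normr_id /th1 normrM -mulrA -[leRHS]mulr1 ler_pM//.
  by have [[-> h]|[-> h]] := chi01 (B t w); rewrite ?normr0 ?mul0r// normr1 mul1r.
have b4 : bounded_measurable (fun w => `|th2 w|) by apply: bmeas_norm; exact: bmeas_adapted ath2.
rewrite (_ : \int[P]_w _ = \int[P]_w (th1 w * odd_functional q l m w) +
    \int[P]_w (th2 w * odd_functional q l m w)); last first.
  by rewrite -ED//; apply: eq_Rintegral => w _; rewrite /th1 /th2; ring.
apply: (le_trans (ler_normD _ _)).
rewrite [leRHS](_ : _ = \int[P]_w (`|th1 w| * `|B t w|) + \int[P]_w `|th2 w|); last first.
  rewrite -ED//; apply: eq_Rintegral => w _; rewrite /th1 /th2 !normrM.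
  have [[-> h]|[-> h]] := chi01 (B t w).
    by rewrite subr0 normr0 normr1 mulr0 mul0r add0r (min_idPl (ltW h)).
  by rewrite subrr normr0 normr1 mulr1 mulr0 addr0 (min_idPr h).
apply: lerD; first exact: odd_functional_small.
apply: (le_trans (Enorm _ b2)); apply: Ele => //; first exact: bmeas_norm.
move=> w; rewrite normrM -[leRHS]mulr1 ler_pM//.
exact: odd_functional_le1.
Qed.

End killed.

(** * The reflection principle *)

Section reflection.
Context {R : realType} {d} {Omega : measurableType d}.
Variables (P : probability Omega R) (B : R -> Omega -> R).
Hypothesis BM : brownian_motion P B.

Lemma brownian_continuous a b w : 0 <= a -> {within `[a, b], continuous (B ^~ w)}.
Proof.
move=> a0; case: BM => -[_ cB] _ _ _; apply: continuous_subspaceW (cB w) => x /=.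
by rewrite !in_itv/= andbT => /andP[/(le_trans a0)].
Qed.

Lemma brownian_zero_eventP a b w : 0 <= a <= b ->
  path_event B (zero_event a b) w <-> exists2 z, a <= z <= b & B z w = 0.
Proof.
move=> /andP[a0 ab].
exact: (@zero_eventP _ a b (B ^~ w) ab (@brownian_continuous a b w a0)).
Qed.

Lemma adapted_zero_event a b t : 0 <= a <= b -> b <= t ->
  adapted B t (\1_(path_event B (zero_event a b)) : Omega -> R).
Proof.
move=> /andP[a0 ab] bt; apply: adapted_event; apply: zero_event_cylinder => //.
by move=> x; rewrite /= !in_itv/= => /andP[/(le_trans a0)-> /le_trans]; exact.
Qed.

(** The increments of the indicators of k <= j single out j = k, and nothing is left if k > N. In
    use, k is the index of the first grid point at or after the first zero. *)
Lemma sum_first_index (x : nat -> R) (k N : nat) :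
  (k <= 0)%N%:R * x 0 + \sum_(j < N) ((k <= j.+1)%N%:R - (k <= j)%N%:R) * x j.+1 =
  (k <= N)%N%:R * x k.
Proof.
elim: N => [|N IH].
  by rewrite big_ord0 addr0 leqn0; case: eqP => [->//|_]; rewrite !mul0r.
rewrite big_ord_recr/= addrA IH; case: (ltngtP k N.+1) => [kN|kN|->].
- by rewrite -ltnS kN subrr mul0r addr0.
- by rewrite leqNgt (ltn_trans _ kN)//= subrr mul0r mul0r addr0.
- by rewrite ltnn/= mul0r add0r subr0.
Qed.

Lemma grid0 (a b : R) N : grid a b N 0 = a.
Proof. by rewrite /grid mul0r mulr0 addr0. Qed.

Lemma gridN (a b : R) N : grid a b N N.+1 = b.
Proof. by rewrite /grid divff ?pnatr_eq0// mulr1 addrC subrK. Qed.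

Lemma grid_le (a b : R) N i j : a <= b -> (i <= j)%N -> grid a b N i <= grid a b N j.
Proof.
by move=> ab ij; rewrite lerD2l ler_wpM2l ?subr_ge0// ler_wpM2r ?invr_ge0// ler_nat.
Qed.

Lemma gridS (a b : R) N i : grid a b N i.+1 = grid a b N i + (b - a) / N.+1%:R.
Proof. by rewrite /grid -natr1; ring. Qed.

Let A (s : R) (n j : nat) : set Omega := path_event B (zero_event s (grid s 1 n j)).

(* The value at the first grid point after the first zero in [s, 1], truncated
   at 1; it is 0 if there is no such zero. *)
Let overshoot (s : R) (n : nat) (w : Omega) : R :=
  \1_(A s n 0) w * Num.min 1 `|B (grid s 1 n 0) w| +
  \sum_(j < n.+1) (\1_(A s n j.+1) w - \1_(A s n j) w) *
     Num.min 1 `|B (grid s 1 n j.+1) w|.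

(** The events [A s n j] grow with j, so along a path their indicators have the form k <= j, where k
    is the least index whose grid point is not before the first zero T. That point exceeds T by at
    most one cell, of length at most 1/(n+1). *)
Lemma overshoot_cases s n w : 0 <= s < 1 -> overshoot s n w = 0 \/
  exists T k, [/\ s <= T <= 1, B T w = 0,
    (forall z, s <= z <= 1 -> B z w = 0 -> T <= z),
    (k <= n.+1)%N && (T <= grid s 1 n k <= T + n.+1%:R^-1) &
    overshoot s n w = Num.min 1 `|B (grid s 1 n k) w|].
Proof.
move=> /andP[s0 s1].
have key k : (forall j, (j <= n.+1)%N -> (\1_(A s n j) w : R) = (k <= j)%N%:R) ->
    overshoot s n w = (k <= n.+1)%N%:R * Num.min 1 `|B (grid s 1 n k) w|.
  move=> h; rewrite -(sum_first_index (fun j => Num.min 1 `|B (grid s 1 n j) w|)).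
  rewrite /overshoot h//; congr (_ + _).
  by apply: eq_bigr => j _; rewrite !h// ltnW// ltnS ltn_ord.
have git j : (j <= n.+1)%N -> 0 <= s <= grid s 1 n j.
  by move=> jn; rewrite s0/=; have /andP[] := grid_itv (ltW s1) jn.
have [zs|nozs] := pselect (exists2 z, s <= z <= 1 & B z w = 0); last first.
  (* The index n.+2 lies beyond the grid and encodes the absence of zeros. *)
  left; rewrite (key n.+2) ?ltnn ?mul0r// => j jn.
  rewrite [RHS](_ : _ = 0); last by rewrite leqNgt ltnS (leq_trans jn).
  rewrite indicE memNset// => /(brownian_zero_eventP w (git j jn))[z zj Bz].
  apply: nozs; exists z => //; have /andP[-> /= zj'] := zj.
  by apply: (le_trans zj'); have /andP[] := grid_itv (ltW s1) jn.
right; have [T [T01 BT Tmin]] := first_zero (brownian_continuous s0) zs.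
have ex : exists j, T <= grid s 1 n j by exists n.+1; rewrite gridN; case/andP: T01.
case: (ex_minnP ex) => k Tk kmin.
have kn : (k <= n.+1)%N by apply: kmin; rewrite gridN; case/andP: T01.
exists T, k; split => //.
- rewrite kn Tk/=; case: k Tk kmin {kn} => [|k] Tk kmin.
    rewrite grid0; have /andP[sT _] := T01; rewrite (le_trans sT)// lerDl invr_ge0//.
  rewrite gridS lerD//.
    by rewrite leNgt; apply/negP => /ltW /kmin; rewrite ltnn.
  by rewrite -[leRHS]mul1r ler_wpM2r ?invr_ge0//; lra.
- rewrite (key k) ?kn ?mul1r// => j jn; rewrite indicE; congr (_%:R); congr nat_of_bool.
  apply/idP/idP => [/set_mem/(brownian_zero_eventP w (git j jn))[z /andP[sz zj] Bz]|kj].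
    apply: kmin; apply: (le_trans _ zj); apply: Tmin => //; rewrite sz/=.
    by apply: (le_trans zj); have /andP[] := grid_itv (ltW s1) jn.
  apply/mem_set/(brownian_zero_eventP w (git j jn)); exists T => //.
  have /andP[-> _] := T01; exact: le_trans Tk (grid_le n (ltW s1) kj).
Qed.

Lemma overshoot_itv01 s n w : 0 <= s < 1 -> 0 <= overshoot s n w <= 1.
Proof.
move=> s01; have [->|[T [k [_ _ _ _ ->]]]] := overshoot_cases n w s01.
  by rewrite lexx ler01.
by rewrite le_min ler01 normr_ge0 ge_min lexx.
Qed.

(** The first zero T does not depend on n, the grid points following it converge to it, and the path
    is continuous with value 0 there. *)
Lemma overshoot_cvg0 s w : 0 <= s < 1 -> overshoot s n w @[n --> \oo] --> 0.
Proof.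
move=> s01; have /andP[s0 s1] := s01.
have [[n0 n0P]|no] := pselect (exists n, overshoot s n w <> 0); last first.
  rewrite (_ : overshoot s ^~ w = fun=> 0); first exact: cvg_cst.
  by apply/funext => n; apply: contrapT => h; apply: no; exists n.
have [//|[T [k0 [T01 BT Tmin _ _]]]] := overshoot_cases n0 w s01.
(* When the overshoot is 0 the time T itself serves as [tau n]; otherwise the grid point after T
   does. *)
have /choice[tau tauP] : forall n, exists t, [/\ s <= t <= 1, `|t - T| <= 1 / n.+1%:R &
    overshoot s n w <= `|B t w|].
  move=> n; have [->|[T' [k [T'01 BT' Tmin' /and3P[kn h1 h2] ->]]]] := overshoot_cases n w s01.
    by exists T; split => //; rewrite subrr normr0 divr_ge0.
  have TT' : T' = T by apply/eqP; rewrite eq_le Tmin'//= Tmin.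
  exists (grid s 1 n k); split; first exact: grid_itv (ltW s1) kn.
  - by rewrite -TT' ger0_norm ?subr_ge0// mul1r lerBlDl.
  - by rewrite ge_min lexx orbT.
have tauT : tau n @[n --> \oo] --> T.
  by apply: (@near_oo_cvg0 _ _ _ 1) => n; have [_ h _] := tauP n.
have BtT : B (tau n) w @[n --> \oo] --> B T w.
  apply: (within_continuous_seq (@brownian_continuous s 1 w s0)) => //.
  by move=> n; rewrite /= in_itv/=; have [] := tauP n.
apply: (@squeeze_cvgr _ _ _ _ (fun=> 0) (fun n => `|B (tau n) w|)).
- apply: nearW => n; have [_ _ ->] := tauP n; rewrite andbT.
  by have /andP[] := overshoot_itv01 n w s01.
- exact: cvg_cst.
- by rewrite -(normr0 R) -BT; exact: cvg_norm.
Qed.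

(** A discrete substitute for the strong Markov property at the first zero in [s, 1]. The event is
    split according to the cell of that zero; each piece is adapted at the right end of its cell,
    where [odd_functional_bound] applies. The contributions add up to at most M times the mean
    overshoot, which tends to 0 with the mesh. *)
Lemma zero_event_odd_expectation s q l m th : 0 <= s < 1 -> 0 <= q <= 1 ->
  0 <= l -> 1 <= m -> adapted B s th ->
  \int[P]_w (th w * \1_(path_event B (zero_event s 1)) w *
    (expR (- (l * B q w ^+ 2)) * (B 1 w * expR (- (m * B 1 w ^+ 2))))) = 0.
Proof.
move=> s01 q01 l0 m1 ath; have /andP[s0 s1] := s01; have /andP[q0 q1] := q01.
pose G w := expR (- (l * B q w ^+ 2)) * (B 1 w * expR (- (m * B 1 w ^+ 2))).
have bG : bounded_measurable G := odd_functional_bmeas BM q0 l0 m1.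
have [_ [M thM]] := bmeas_adapted BM ath.
have M0 : 0 <= M by exact: le_trans (normr_ge0 _) (thM point).
have git n j : (j <= n.+1)%N -> s <= grid s 1 n j <= 1 by exact: grid_itv (ltW s1).
have aA n j : (j <= n.+1)%N -> adapted B (grid s 1 n j) (\1_(A s n j) : Omega -> R).
  by move=> /git/andP[sg _]; apply: adapted_zero_event; rewrite ?s0.
have bA n j : (j <= n.+1)%N -> bounded_measurable (\1_(A s n j) : Omega -> R).
  by move=> jn; exact: (bmeas_adapted BM (aA n j jn)).
have bB t : 0 <= t -> bounded_measurable (fun w => Num.min 1 `|B t w|).
  move=> t0; apply: (@bmeas_le _ _ _ 1).
    apply: measurable_minr => //; apply: measurableT_comp => //.
    exact: (brownian_measurable BM).
  by move=> w; rewrite ger0_norm ?ge_min ?lexx// le_min ler01 normr_ge0.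
have Ale n j w : (j < n.+1)%N -> (\1_(A s n j) w : R) <= \1_(A s n j.+1) w.
  move=> jn; rewrite !indicE ler_nat; case: (boolP (w \in A s n j)) => // wA.
  have h j' : (j' <= n.+1)%N -> 0 <= s <= grid s 1 n j'.
    by move=> /git/andP[-> _]; rewrite s0.
  rewrite mem_set//; apply/(brownian_zero_eventP w (h j.+1 jn)).
  have [z /andP[sz zj] Bz] := (brownian_zero_eventP w (h j (ltnW jn))).1 (set_mem wA).
  by exists z => //; rewrite sz (le_trans zj)// grid_le// ltW.
have step n : `|\int[P]_w (th w * \1_(A s n n.+1) w * G w)| <=
    M * \int[P]_w overshoot s n w.
  have bov0 : bounded_measurable
      (fun w => \1_(A s n 0) w * Num.min 1 `|B (grid s 1 n 0) w|).
    by apply: bmeasM; [exact: bA|apply: bB; rewrite grid0].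
  have bovS (j : 'I_n.+1) : bounded_measurable (fun w =>
      (\1_(A s n j.+1) w - \1_(A s n j) w) * Num.min 1 `|B (grid s 1 n j.+1) w|).
    apply: bmeasM; first by apply: bmeasB; [exact: (bA n j.+1 (ltn_ord j))|exact: (bA n j (ltnW (ltn_ord j)))].
    by apply: bB; apply: (le_trans s0); have /andP[] := git n j.+1 (ltn_ord j).
  rewrite ED//; last exact: bmeas_sum.
  rewrite Esum// mulrDr mulr_sumr.
  have bth := bmeas_adapted BM ath.
  have b0 : bounded_measurable (fun w => th w * \1_(A s n 0) w * G w).
    by apply: bmeasM => //; apply: bmeasM => //; exact: bA.
  have bS (j : 'I_n.+1) : bounded_measurable
      (fun w => th w * (\1_(A s n j.+1) w - \1_(A s n j) w) * G w).
    apply: bmeasM => //; apply: bmeasM => //.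
    by apply: bmeasB; [exact: (bA n j.+1 (ltn_ord j))|exact: (bA n j (ltnW (ltn_ord j)))].
  rewrite (_ : \int[P]_w _ = \int[P]_w (th w * \1_(A s n 0) w * G w) +
      \sum_(j < n.+1) \int[P]_w (th w * (\1_(A s n j.+1) w - \1_(A s n j) w) * G w));
    last first.
    rewrite -Esum// -ED//; last exact: bmeas_sum.
    apply: eq_Rintegral => w _.
    rewrite -mulr_suml -mulr_sumr -mulrDl -mulrDr; congr (_ * _ * _).
    rewrite -(big_mkord xpredT (fun j => \1_(A s n j.+1) w - \1_(A s n j) w)).
    by rewrite telescope_sumr// addrC subrK.
  apply: (le_trans (ler_normD _ _)); apply: lerD; last first.
    apply: (le_trans (ler_norm_sum _ _ _)); apply: ler_sum => j _.
    have jn := ltn_ord j; have /andP[sg g1] := git n j.+1 jn.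
    have ath' : adapted B (grid s 1 n j.+1)
        (fun w => th w * (\1_(A s n j.+1) w - \1_(A s n j) w)).
      apply: adaptedM; first exact: adapted_le ath.
      apply: adaptedB; first exact: aA.
      by apply: adapted_le (aA n j (ltnW jn)); rewrite grid_le// ltW.
    apply: (le_trans (odd_functional_bound BM _ q01 l0 m1 ath')).
      by rewrite (le_trans s0).
    rewrite -EZ//; apply: Ele.
    - apply: bmeasM; first by apply: bmeas_norm; exact: (bmeas_adapted BM ath').
      by apply: bB; exact: le_trans sg.
    - by apply: bmeasM => //; exact: bmeas_cst.
    - move=> w; rewrite mulrA ler_wpM2r ?le_min ?ler01 ?normr_ge0// normrM.
      by rewrite ler_pM// ger0_norm// subr_ge0 Ale.
  have ath' : adapted B s (fun w => th w * \1_(A s n 0) w).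
    by apply: adaptedM => //; have := aA n 0 isT; rewrite grid0.
  apply: (le_trans (odd_functional_bound BM _ q01 l0 m1 ath')); first by rewrite s0 ltW.
  rewrite -EZ//; apply: Ele.
  - apply: bmeasM; first by apply: bmeas_norm; exact: (bmeas_adapted BM ath').
    exact: bB.
  - by apply: bmeasM => //; exact: bmeas_cst.
  - move=> w; rewrite grid0 mulrA ler_wpM2r ?le_min ?ler01 ?normr_ge0// normrM.
    by rewrite ler_pM// ger0_norm.
apply/normr0_eq0/eqP; rewrite eq_le normr_ge0 andbT.
have cv : M * \int[P]_w overshoot s n w @[n --> \oo] --> M * \int[P]_w (0 : R).
  apply: cvgMr; apply: (E_dct (M := 1)).
  - move=> n; apply: measurable_funD.
      by have [] : bounded_measurable (fun w => \1_(A s n 0) w * Num.min 1 `|B (grid s 1 n 0) w|)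
        by apply: bmeasM; [exact: bA|apply: bB; rewrite grid0].
    apply: measurable_sum => j.
    apply: measurable_funM; first apply: measurable_funB.
    + by have [] := bA n j.+1 (ltn_ord j).
    + by have [] := bA n j (ltnW (ltn_ord j)).
    + have /andP[sg _] := git n j.+1 (ltn_ord j).
      by have [] := bB _ (le_trans s0 sg).
  - by move=> n w; have /andP[h0 h1] := overshoot_itv01 n w s01; rewrite ger0_norm.
  - by move=> w; exact: overshoot_cvg0.
rewrite Ecst mulr0 in cv.
apply: (cvgr_to_ge cv); apply: nearW => n.
by have := step n; rewrite /A gridN.
Qed.

End reflection.

(** * The Laplace transform of the meander *)

Section meander_step.
Context {R : realType} {d} {Omega : measurableType d}.
Variables (P : probability Omega R) (B : R -> Omega -> R).
Hypothesis BM : brownian_motion P B.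

(** The sign function, written with indicators so that bounded measurability is immediate. *)
Definition sign_indic (x : R) : R :=
  \1_(`]0, +oo[%classic : set R) x - \1_(`]-oo, 0[%classic : set R) x.

Lemma sign_indicE x : sign_indic x = Num.sg x.
Proof.
rewrite /sign_indic !indicE !mem_setE !in_itv/= andbT.
have [x0|x0|->] := ltrgtP x 0; last by rewrite sgr0 subrr.
- by rewrite ltr0_sg// sub0r.
- by rewrite gtr0_sg// subr0.
Qed.

Lemma bmeas_sign_indic : bounded_measurable sign_indic.
Proof. by apply: bmeasB; exact: bmeas_indic. Qed.

(* The two-step Gaussian transition with weights exp(-l x^2) after time u and
   exp(-m y^2) after time 1 turns y into y times this constant, times
   exp(-(gauss_rate u l m) y^2). *)
Definition gauss_den1 (u m : R) : R := 1 + 2 * m * (1 - u).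
Definition gauss_den2 (u l m : R) : R := 1 + 2 * (l + m / gauss_den1 u m) * u.
Definition gauss_rate (u l m : R) : R := (l + m / gauss_den1 u m) / gauss_den2 u l m.
Definition gauss_mass (u l m : R) : R :=
  (gauss_den1 u m)^-1 * (Num.sqrt (gauss_den1 u m))^-1 *
  ((gauss_den2 u l m)^-1 * (Num.sqrt (gauss_den2 u l m))^-1).

Lemma gauss_den1_ge1 u m : 0 <= u <= 1 -> 0 <= m -> 1 <= gauss_den1 u m.
Proof. by move=> /andP[u0 u1] m0; rewrite lerDl !mulr_ge0// subr_ge0. Qed.

Lemma gauss_den2_ge1 u l m : 0 <= u <= 1 -> 0 <= l -> 0 <= m -> 1 <= gauss_den2 u l m.
Proof.
move=> u01 l0 m0; have D1 := gauss_den1_ge1 u01 m0; have /andP[u0 _] := u01.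
by rewrite lerDl !mulr_ge0// addr_ge0// divr_ge0//; lra.
Qed.

Lemma gauss_mass_gt0 u l m : 0 <= u <= 1 -> 0 <= l -> 0 <= m -> 0 < gauss_mass u l m.
Proof.
move=> u01 l0 m0; have D1 := gauss_den1_ge1 u01 m0.
have D2 := gauss_den2_ge1 u01 l0 m0.
by rewrite !mulr_gt0// invr_gt0 ?sqrtr_gt0; lra.
Qed.

(** Both m / (1 + 2 m (1 - u)) and x / (1 + 2 x u) increase in m and x. The sign matters because
    exp(-c y^2) with c the difference of the two rates is then bounded by 1. *)
Lemma gauss_rate_ge u l m : 0 <= u <= 1 -> 0 <= l -> 1 <= m ->
  gauss_rate u 0 1 <= gauss_rate u l m.
Proof.
move=> u01 l0 m1; have /andP[u0 u1] := u01.
have D1 : 1 <= gauss_den1 u m by apply: gauss_den1_ge1 => //; lra.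
have D1' : 1 <= gauss_den1 u 1 by apply: gauss_den1_ge1 => //; lra.
have D2 : 1 <= gauss_den2 u l m by apply: gauss_den2_ge1 => //; lra.
have D2' : 1 <= gauss_den2 u 0 1 by apply: gauss_den2_ge1 => //; lra.
rewrite /gauss_rate; move: D2 D2'; rewrite /gauss_den2.
have y0 : 0 < 1 / gauss_den1 u 1 by rewrite divr_gt0//; lra.
have yx : 0 + 1 / gauss_den1 u 1 <= l + m / gauss_den1 u m.
  rewrite lerD// ler_pdivrMr; last lra.
  rewrite mulrAC ler_pdivlMr; last lra.
  by rewrite mul1r /gauss_den1; nra.
rewrite add0r in yx *; set x := l + _ in yx *; set y := 1 / _ in yx y0 *.
move=> dx dy; rewrite ler_pdivrMr; last lra.
by rewrite mulrAC ler_pdivlMr; [nra|lra].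
Qed.

Lemma no_zero_sign (s : R) (w : Omega) : 0 <= s <= 1 ->
  ~ path_event B (zero_event s 1) w ->
  `|B 1 w| = sign_indic (B s w) * B 1 w.
Proof.
move=> /andP[s0 s1] nz; rewrite sign_indicE.
have nz' : forall z, s <= z <= 1 -> B z w != 0.
  move=> z sz; apply/eqP => Bz; apply: nz; apply/(brownian_zero_eventP BM).
    by rewrite s0.
  by exists z.
have Bs : B s w != 0 by apply: nz'; rewrite lexx.
have B1 : B 1 w != 0 by apply: nz'; rewrite lexx andbT.
suff -> : Num.sg (B s w) = Num.sg (B 1 w) by rewrite normrEsg.
have noIVT : ~ (Num.min (B s w) (B 1 w) <= 0 <= Num.max (B s w) (B 1 w)).
  move=> h; have [c] := IVT s1 (brownian_continuous BM s0) h.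
  by rewrite in_itv/= => /nz' /eqP.
have [Bs0|Bs0|/eqP] := ltrgtP (B s w) 0; last by rewrite (negbTE Bs).
  have [B10|B10|/eqP] := ltrgtP (B 1 w) 0; last by rewrite (negbTE B1).
    by rewrite !ltr0_sg.
  by exfalso; apply: noIVT; rewrite ge_min (ltW Bs0) le_max (ltW B10) orbT.
have [B10|B10|/eqP] := ltrgtP (B 1 w) 0; last by rewrite (negbTE B1).
  by exfalso; apply: noIVT; rewrite ge_min (ltW B10) orbT le_max (ltW Bs0).
by rewrite !gtr0_sg.
Qed.

(** The functional of the meander with a deterministic time s in place of the last zero. *)
Definition scaled_functional (u l m s : R) (w : Omega) : R :=
  `|B 1 w| / Num.sqrt (1 - s) *
  expR (- (l / (1 - s) * B (s + u * (1 - s)) w ^+ 2)) *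
  expR (- (m / (1 - s) * B 1 w ^+ 2)).

Lemma meander_step u l m s th : 0 <= u <= 1 -> 0 <= l -> 1 <= m -> 0 <= s < 1 ->
  adapted B s th ->
  \int[P]_w (th w * (1 - \1_(path_event B (zero_event s 1)) w) *
     scaled_functional u l m s w) =
  gauss_mass u l m * \int[P]_w (th w * (`|B s w| / Num.sqrt (1 - s) *
     expR (- (gauss_rate u l m / (1 - s) * B s w ^+ 2)))).
Proof.
move=> u01 l0 m1 s01 ath; have /andP[u0 u1] := u01; have /andP[s0 s1] := s01.
set q := s + u * (1 - s); have v0 : 0 < 1 - s by rewrite subr_gt0.
have q01 : 0 <= q <= 1 by rewrite /q; apply/andP; split; nra.
have /andP[q0 q1] := q01; have sq : s <= q by rewrite lerDl mulr_ge0// ltW.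
set v := 1 - s in v0 *; set Z := path_event _ _.
have v1 : v <= 1 by rewrite /v; lra.
have lv0 : 0 <= l / v by rewrite divr_ge0// ltW.
have mv1 : 1 <= m / v by rewrite ler_pdivlMr// mul1r; lra.
have mv0 : 0 < m / v by lra.
pose G w := expR (- (l / v * B q w ^+ 2)) * (B 1 w * expR (- (m / v * B 1 w ^+ 2))).
pose th' w := th w * sign_indic (B s w).
have ath' : adapted B s th'.
  apply: adaptedM => //; apply: (@adapted_eval _ _ _ B _ _ sign_indic).
    by rewrite s0/=.
  exact: bmeas_sign_indic.
have bth' := bmeas_adapted BM ath'.
have bG : bounded_measurable G := odd_functional_bmeas BM q0 lv0 mv1.
have bZ : bounded_measurable (\1_Z : Omega -> R).
  apply: (bmeas_adapted BM (t := 1)); apply: adapted_zero_event => //.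
  by rewrite s0 ltW.
transitivity ((Num.sqrt v)^-1 * \int[P]_w (th' w * G w)).
  (* The subtracted 0 becomes the vanishing expectation over paths with a zero in [s, 1]. *)
  rewrite -[X in _ * X]subr0.
  rewrite -(zero_event_odd_expectation BM s01 q01 lv0 mv1 ath') -EB//; last 2 first.
  - by apply: bmeasM.
  - by apply: bmeasM => //; exact: bmeasM.
  rewrite -EZ; last by apply: bmeasB; [exact: bmeasM|apply: bmeasM => //; exact: bmeasM].
  apply: eq_Rintegral => w _; rewrite -/(G w) -/Z /scaled_functional -/q -/v indicE.
  case: (boolP (w \in Z)) => /= wZ; first by rewrite subrr mulr0 mul0r mulr1 subrr mulr0.
  rewrite subr0 mulr1 mulr0 mul0r subr0 (@no_zero_sign s w) ?s0 ?ltW//; last first.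
    by move=> /mem_set; rewrite (negbTE wZ).
  by rewrite /th' /G; ring.
(* Rates carry a factor 1 / (1 - s) and durations a factor 1 - s, so s cancels from the
   denominators: Brownian scaling. *)
have D1E : 1 + 2 * (m / v) * (1 - q) = gauss_den1 u m.
  by rewrite /gauss_den1 /q /v; field; rewrite gt_eqF.
have D1 : 1 <= gauss_den1 u m by apply: gauss_den1_ge1 => //; lra.
have D2 : 1 <= gauss_den2 u l m by apply: gauss_den2_ge1 => //; lra.
pose x := l + m / gauss_den1 u m.
have x0 : 0 < x by rewrite ltr_wpDl// divr_gt0//; lra.
have xv0 : 0 < x / v by rewrite divr_gt0.
have D2E : 1 + 2 * (x / v) * (q - s) = gauss_den2 u l m.
  by rewrite /gauss_den2 -/x /q /v; field; rewrite gt_eqF.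
have ath2 : adapted B q (fun w => th' w * expR (- (l / v * B q w ^+ 2))).
  apply: adaptedM; first exact: adapted_le ath'.
  by apply: adapted_gauss; rewrite ?q0/=.
rewrite (_ : \int[P]_w (th' w * G w) = gauss_mass u l m *
    \int[P]_w (th' w * (B s w * expR (- (gauss_rate u l m / v * B s w ^+ 2))))); last first.
  rewrite /G; under eq_Rintegral do rewrite mulrA.
  rewrite (markov_gauss1 BM q0 q1 mv0 ath2) D1E.
  rewrite (_ : \int[P]_w _ = \int[P]_w (th' w * (B q w * expR (- (x / v * B q w ^+ 2)))));
    last first.
    apply: eq_Rintegral => w _.
    rewrite (_ : expR (- (x / v * B q w ^+ 2)) = expR (- (l / v * B q w ^+ 2)) *
      expR (- (m / v / gauss_den1 u m * B q w ^+ 2))); first by ring.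
    by rewrite -expRD; congr expR; rewrite /x; field; rewrite !gt_eqF//; lra.
  have cE : x / v / gauss_den2 u l m = gauss_rate u l m / v.
    by rewrite /gauss_rate -/x mulrAC.
  by rewrite (markov_gauss1 BM s0 sq xv0 ath') D2E cE mulrA.
have c0 : 0 < gauss_rate u l m / v.
  by rewrite divr_gt0// /gauss_rate divr_gt0//; lra.
have bodd : bounded_measurable
   (fun w => B s w * expR (- (gauss_rate u l m / v * B s w ^+ 2))).
  apply: (bmeas_comp (h := B s) (f := fun y =>
    y * expR (- (gauss_rate u l m / v * y ^+ 2)))).
    exact: (brownian_measurable BM).
  exact: bmeas_odd_gauss.
rewrite mulrCA; congr (_ * _); rewrite -EZ; last exact: bmeasM.
apply: eq_Rintegral => w _; rewrite /th' sign_indicE [in RHS]normrEsg; ring.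
Qed.

(** Once divided by [gauss_mass], the result of [meander_step] depends on (l, m) through
    [gauss_rate] only. The triple (u, l, m) can thus be exchanged for (u, 0, 1) at the cost of a
    Gaussian weight in B(s), which the past of s absorbs. *)
Lemma meander_ratio u l m s th : 0 <= u <= 1 -> 0 <= l -> 1 <= m -> 0 <= s < 1 ->
  adapted B s th ->
  (gauss_mass u l m)^-1 *
  \int[P]_w (th w * (1 - \1_(path_event B (zero_event s 1)) w) *
     scaled_functional u l m s w) =
  (gauss_mass u 0 1)^-1 *
  \int[P]_w (th w * expR (- ((gauss_rate u l m - gauss_rate u 0 1) / (1 - s) * B s w ^+ 2)) *
     (1 - \1_(path_event B (zero_event s 1)) w) * scaled_functional u 0 1 s w).
Proof.
move=> u01 l0 m1 s01 ath; have /andP[s0 s1] := s01.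
have ath' : adapted B s (fun w => th w *
    expR (- ((gauss_rate u l m - gauss_rate u 0 1) / (1 - s) * B s w ^+ 2))).
  apply: adaptedM => //; apply: adapted_gauss; first by rewrite s0/=.
  by rewrite divr_ge0 ?subr_ge0 ?gauss_rate_ge// ltW.
rewrite (meander_step u01 l0 m1 s01 ath).
rewrite (meander_step u01 (lexx 0) (lexx 1) s01 ath').
have m0 : 0 <= m by lra.
rewrite (mulKf (lt0r_neq0 (gauss_mass_gt0 u01 l0 m0))).
rewrite (mulKf (lt0r_neq0 (gauss_mass_gt0 u01 (lexx 0) ler01))).
apply: eq_Rintegral => w _.
rewrite (_ : expR (- (gauss_rate u l m / (1 - s) * B s w ^+ 2)) =
  expR (- ((gauss_rate u l m - gauss_rate u 0 1) / (1 - s) * B s w ^+ 2)) *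
  expR (- (gauss_rate u 0 1 / (1 - s) * B s w ^+ 2))); first by ring.
rewrite -expRD; congr expR; ring.
Qed.

End meander_step.

Lemma interp_itv01 {R : realType} (s u : R) : 0 <= s <= 1 -> 0 <= u <= 1 ->
  0 <= s + u * (1 - s) <= 1.
Proof. by move=> /andP[s0 s1] /andP[u0 u1]; apply/andP; split; nra. Qed.

Section meander_law.
Context {R : realType} {d} {Omega : measurableType d}.
Variables (P : probability Omega R) (B : R -> Omega -> R).
Hypothesis BM : brownian_motion P B.

Lemma last_zero_spec w :
  [/\ 0 <= last_zero B w <= 1, B (last_zero B w) w = 0 &
      forall z, 0 <= z <= 1 -> B z w = 0 -> z <= last_zero B w].
Proof.
apply: (@last_zeroP _ (B ^~ w)); first exact: (brownian_continuous BM).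
by case: BM => _ + _ _; apply.
Qed.

(* Only the term whose grid cell contains the last zero survives; it evaluates
   H at the right end point of that cell. *)
Definition last_zero_sum (H : R -> Omega -> R) (n : nat) (w : Omega) : R :=
  \sum_(j < n)
    \1_(path_event B (zero_event (grid 0 1 n j) (grid 0 1 n j.+1))) w *
    (1 - \1_(path_event B (zero_event (grid 0 1 n j.+1) 1)) w) *
    H (grid 0 1 n j.+1) w.

Lemma grid01 N j : grid 0 1 N j = j%:R / N.+1%:R :> R.
Proof. by rewrite /grid add0r subr0 mul1r. Qed.

(** [last_zero_sum] leaves out the last of the n.+1 cells, so all its evaluation times stay below 1
    and 1 - s is positive. *)
Lemma grid01_itv N j : (j < N)%N -> 0 <= grid (0 : R) 1 N j.+1 < 1.
Proof.
move=> jN; have N0 : 0 < N.+1%:R :> R by rewrite ltr0n.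
by rewrite grid01 divr_ge0//= ltr_pdivrMr// mul1r ltr_nat ltnS.
Qed.

(** Cells are half-open: a last zero at the right end point counts for the next cell, because the
    second factor forbids zeros on the closed interval from that point to 1. *)
Lemma last_zero_cell n j w : (j < n)%N ->
  \1_(path_event B (zero_event (grid 0 1 n j) (grid 0 1 n j.+1))) w *
  (1 - \1_(path_event B (zero_event (grid 0 1 n j.+1) 1)) w) =
  (j == Num.truncn (last_zero B w * n.+1%:R))%:R :> R.
Proof.
move=> jn; have [/andP[g0 g1] Bg gmax] := last_zero_spec w.
set g := last_zero B w in g0 g1 Bg gmax *.
have n0 : 0 < n.+1%:R :> R by rewrite ltr0n.
have /andP[t0 t1] := @grid_itv R 0 1 n j ler01 (ltnW (leq_trans jn (leqnSn n))).
have /andP[t0' t1'] := @grid_itv R 0 1 n j.+1 ler01 (leq_trans jn (leqnSn n)).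
have tt' : grid 0 1 n j <= grid 0 1 n j.+1 :> R by apply: grid_le.
have gn0 : 0 <= g * n.+1%:R by rewrite mulr_ge0.
have cellE : (j == Num.truncn (g * n.+1%:R)) = (grid 0 1 n j <= g < grid 0 1 n j.+1).
  rewrite !grid01 ler_pdivrMr// ltr_pdivlMr//.
  apply/eqP/idP => [->|/truncn_def ->//]; exact: truncn_itv.
have Z1 := brownian_zero_eventP BM w (a := grid 0 1 n j) (b := grid 0 1 n j.+1).
have Z2 := brownian_zero_eventP BM w (a := grid 0 1 n j.+1) (b := 1).
rewrite t0 tt' in Z1; rewrite t0' t1' in Z2; move/(_ isT) in Z1; move/(_ isT) in Z2.
rewrite cellE !indicE; case: (boolP (grid 0 1 n j <= g < grid 0 1 n j.+1)) => [/andP[jg gj]|ng].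
  rewrite mem_set; last by apply/Z1; exists g => //; rewrite jg ltW.
  rewrite memNset ?subr0 ?mul1r// => /Z2[z /andP[jz z1] Bz].
  have := gmax z; rewrite z1 (le_trans t0' jz) => /(_ isT Bz).
  by rewrite leNgt (lt_le_trans gj jz).
case: (boolP (w \in path_event B (zero_event (grid 0 1 n j) _))) => [/set_mem/Z1[z /andP[jz zj] Bz]|_];
  last by rewrite mul0r.
rewrite mem_set ?subrr ?mulr0//; apply/Z2; exists g => //; rewrite g1 andbT.
rewrite leNgt; apply/negP => gj; move/negP: ng; apply; rewrite gj andbT.
apply: (le_trans jz); apply: gmax => //; rewrite (le_trans zj t1') andbT.
by apply: le_trans jz; rewrite grid01 divr_ge0.
Qed.

Lemma last_zero_sumE H n w : last_zero_sum H n w =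
  let k := Num.truncn (last_zero B w * n.+1%:R) in
  if (k < n)%N then H (grid 0 1 n k.+1) w else 0.
Proof.
set k := Num.truncn _; rewrite /= /last_zero_sum.
under eq_bigr => j _ do rewrite last_zero_cell// -/k.
case: ltnP => kn.
  rewrite (bigD1 (Ordinal kn))//= eqxx mul1r big1 ?addr0// => i ik.
  by rewrite (_ : (_ == k) = false) ?mul0r//; apply: contraNF ik => /eqP ik; apply/eqP/val_inj.
rewrite big1// => i _; rewrite (_ : (_ == k) = false) ?mul0r//.
by apply/negbTE; rewrite neq_ltn (leq_trans (ltn_ord i) kn).
Qed.

Lemma last_zero_sum_degenerate H n w : last_zero B w = 1 -> last_zero_sum H n w = 0.
Proof.
by move=> g1; rewrite last_zero_sumE g1 mul1r natrK/= ltnNge leqnSn.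
Qed.

Lemma last_zero_sum_cvg (H : R -> Omega -> R) (w : Omega) (L : R) : last_zero B w < 1 ->
  (forall tau : nat -> R, (forall n, last_zero B w < tau n < 1) ->
     tau n @[n --> \oo] --> last_zero B w -> H (tau n) w @[n --> \oo] --> L) ->
  last_zero_sum H n w @[n --> \oo] --> L.
Proof.
have [/andP[g0 _] Bg gmax] := last_zero_spec w.
set g := last_zero B w in g0 Bg gmax *.
move=> g1 HL; have v0 : 0 < 1 - g by rewrite subr_gt0.
(* The cell of g differs from the omitted one as soon as g (n + 1) < n, that is n > g / (1 - g). *)
pose N := (Num.truncn (g / (1 - g))).+1.
rewrite -(cvg_shiftn N).
have gN n : g * (n + N).+1%:R < (n + N)%:R.
  have gv0 : 0 <= g / (1 - g) by rewrite divr_ge0// ltW.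
  have /andP[_ h] := truncn_itv gv0; rewrite -/N ltr_pdivrMr// in h.
  have h2 : N%:R <= (n + N)%:R :> R by rewrite ler_nat leq_addl.
  rewrite -natr1; have := ler_wpM2r (ltW v0) h2; nra.
pose k n := Num.truncn (g * (n + N).+1%:R).
have gn0 n : 0 <= g * (n + N).+1%:R by rewrite mulr_ge0.
have kn n : (k n < n + N)%N.
  by rewrite -(ltr_nat R); apply: le_lt_trans (gN n); have /andP[] := truncn_itv (gn0 n).
rewrite (_ : (fun n => _) = fun n => H (grid 0 1 (n + N) (k n).+1) w); last first.
  by apply/funext => n; rewrite last_zero_sumE -/g /= -/(k n) kn.
have n0 n : 0 < (n + N).+1%:R :> R by rewrite ltr0n.
apply: HL => [n|].
  rewrite grid01 ltr_pdivlMr// ltr_pdivrMr// mul1r ltr_nat ltnS kn andbT.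
  by have /andP[] := truncn_itv (gn0 n).
apply: (@near_oo_cvg0 _ _ _ 1) => n.
have /andP[h1 h2] := truncn_itv (gn0 n); rewrite -/(k n) in h1 h2.
rewrite grid01 ger0_norm; last by rewrite subr_ge0 ler_pdivlMr// ltW.
apply: (@le_trans _ _ (1 / (n + N).+1%:R)); last first.
  by rewrite !mul1r lef_pV2 ?posrE ?ltr0n// ler_nat ltnS leq_addr.
by rewrite lerBlDr ler_pdivrMr// mulrDl divfK ?gt_eqF// -natr1 addrC lerD2l.
Qed.

Lemma last_zero_path_cvg (u : R) (w : Omega) (tau : nat -> R) : 0 <= u <= 1 ->
  last_zero B w < 1 -> (forall n, last_zero B w < tau n < 1) ->
  tau n @[n --> \oo] --> last_zero B w ->
  B (tau n + u * (1 - tau n)) w @[n --> \oo] -->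
  B (last_zero B w + u * (1 - last_zero B w)) w.
Proof.
move=> u01 g1 taug tauc; have [g01 _ _] := last_zero_spec w.
apply: (within_continuous_seq (brownian_continuous BM (lexx 0))).
- by rewrite /= in_itv/=; exact: interp_itv01.
- move=> n; have /andP[h1 h2] := taug n; have /andP[g0 _] := g01.
  by rewrite /= in_itv/= interp_itv01// (le_trans g0) ltW.
- apply: cvgD => //; apply: cvgMr; apply: cvgB => //; exact: cvg_cst.
Qed.

Lemma last_zero_sqrt_cvg (w : Omega) (tau : nat -> R) :
  tau n @[n --> \oo] --> last_zero B w ->
  Num.sqrt (1 - tau n) @[n --> \oo] --> Num.sqrt (1 - last_zero B w).
Proof.
move=> tauc; apply: continuous_cvg; first exact: sqrt_continuous.
apply: cvgB => //; exact: cvg_cst.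
Qed.

Lemma measurable_last_zero_sum H n :
  (forall s, 0 <= s < 1 -> measurable_fun setT (H s)) ->
  measurable_fun setT (last_zero_sum H n).
Proof.
move=> mH; apply: measurable_sum => j; have jn := ltn_ord j.
have /andP[t0 t1] := @grid_itv R 0 1 n j ler01 (ltnW (leq_trans jn (leqnSn n))).
have /andP[t0' t1'] := @grid_itv R 0 1 n j.+1 ler01 (leq_trans jn (leqnSn n)).
have tt' : grid 0 1 n j <= grid 0 1 n j.+1 :> R by apply: grid_le.
apply: measurable_funM; first apply: measurable_funM.
- suff : bounded_measurable (\1_(path_event B (zero_event (grid 0 1 n j)
    (grid 0 1 n j.+1))) : Omega -> R) by case.
  by apply: (bmeas_adapted BM (t := 1)); apply: adapted_zero_event => //; rewrite t0.
- apply: measurable_funB => //.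
  suff : bounded_measurable (\1_(path_event B (zero_event 
    (grid 0 1 n j.+1) 1)) : Omega -> R) by case.
  by apply: (bmeas_adapted BM (t := 1)); apply: adapted_zero_event => //; rewrite t0'.
- by apply: mH; rewrite t0'/= grid01 ltr_pdivrMr// mul1r ltr_nat ltnS.
Qed.

(** The random last zero enters both the time and the scale. The approximations use fixed times
    only, and so yield measurability of the meander in the limit. If the last zero is 1, both sides
    are 0 because the inverse of 0 is 0. *)
Lemma meander_process_cvg u w : 0 <= u <= 1 ->
  last_zero_sum (fun s w => `|B (s + u * (1 - s)) w| / Num.sqrt (1 - s)) n w
    @[n --> \oo] --> meander_process B u w.
Proof.
move=> u01; have [/andP[g0 g1] _ _] := last_zero_spec w.
move: g1; rewrite le_eqVlt => /predU1P[g1|g1].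
  rewrite /meander_process g1 subrr sqrtr0 invr0 mulr0.
  rewrite (_ : (fun n => _) = fun=> 0); first exact: cvg_cst.
  by apply/funext => n; rewrite last_zero_sum_degenerate.
apply: last_zero_sum_cvg => // tau taug tauc; rewrite /meander_process.
apply: cvgM; first by apply: cvg_norm; exact: last_zero_path_cvg.
apply: cvgV; last exact: last_zero_sqrt_cvg.
by rewrite gt_eqF// sqrtr_gt0 subr_gt0.
Qed.

Lemma measurable_meander_process u : 0 <= u <= 1 ->
  measurable_fun setT (meander_process B u).
Proof.
move=> u01; have /andP[u0 u1] := u01.
apply: (@measurable_fun_cvg _ _ _ setT (fun n => last_zero_sum
   (fun s w => `|B (s + u * (1 - s)) w| / Num.sqrt (1 - s)) n)).
  move=> n; apply: measurable_last_zero_sum => s /andP[s0 s1].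
  apply: measurable_funM => //; apply: measurableT_comp => //.
  apply: (brownian_measurable BM).
  have s01 : 0 <= s <= 1 by rewrite s0 ltW.
  by have /andP[] := interp_itv01 s01 u01.
by move=> w _; exact: meander_process_cvg.
Qed.

Lemma measurable_scaled_functional u l m s : 0 <= u <= 1 -> 0 <= s < 1 ->
  measurable_fun setT (scaled_functional B u l m s).
Proof.
move=> u01 /andP[s0 s1].
have mB t : 0 <= t -> measurable_fun setT (B t) by exact: (brownian_measurable BM).
have mexp t c : 0 <= t -> measurable_fun setT (fun w => expR (- (c * B t w ^+ 2))).
  move=> t0; apply: measurableT_comp => //; apply: measurableT_comp => //.
  apply: measurable_funM => //; apply: measurable_funX; exact: mB.
apply: measurable_funM; first apply: measurable_funM.
- by apply: measurable_funM => //; apply: measurableT_comp => //; exact: mB.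
- have s01 : 0 <= s <= 1 by rewrite s0 ltW.
  by apply: mexp; have /andP[] := interp_itv01 s01 u01.
- exact: mexp.
Qed.

Lemma scaled_functional_le1 u l m s w : 0 <= l -> 1 <= m -> s < 1 ->
  0 <= scaled_functional B u l m s w <= 1.
Proof.
move=> l0 m1 s1; have v0 : 0 < 1 - s by rewrite subr_gt0.
have sv0 : 0 < Num.sqrt (1 - s) by rewrite sqrtr_gt0.
have E1 : expR (- (l / (1 - s) * B (s + u * (1 - s)) w ^+ 2)) <= 1.
  by rewrite -[leRHS]expR0 ler_expR oppr_le0 mulr_ge0 ?sqr_ge0// divr_ge0// ltW.
have E2 : `|B 1 w| / Num.sqrt (1 - s) * expR (- (m / (1 - s) * B 1 w ^+ 2)) <= 1.
  have := norm_mul_gauss_le1 (`|B 1 w| / Num.sqrt (1 - s)) m1.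
  rewrite normrM normr_id (ger0_norm (_ : 0 <= (Num.sqrt (1 - s))^-1)); last first.
    by rewrite invr_ge0 ltW.
  rewrite exprMn exprVn (sqr_sqrtr (ltW v0)) real_normK ?num_real//.
  by rewrite (mulrA m) (mulrAC m).
have n0 : 0 <= `|B 1 w| / Num.sqrt (1 - s) by rewrite divr_ge0// ltW.
rewrite /scaled_functional !mulr_ge0 ?expR_ge0//=.
by rewrite mulrAC -[leRHS]mulr1 ler_pM ?expR_ge0// mulr_ge0 ?expR_ge0.
Qed.

Lemma scaled_functional_cvg u l m w (tau : nat -> R) : 0 <= u <= 1 ->
  last_zero B w < 1 -> (forall n, last_zero B w < tau n < 1) ->
  tau n @[n --> \oo] --> last_zero B w ->
  scaled_functional B u l m (tau n) w @[n --> \oo] -->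
  meander_process B 1 w *
    (expR (- (l * meander_process B u w ^+ 2)) *
     expR (- (m * meander_process B 1 w ^+ 2))).
Proof.
move=> u01 g1 taug tauc; have v0 : 0 < 1 - last_zero B w by rewrite subr_gt0.
have m1E : meander_process B 1 w = `|B 1 w| / Num.sqrt (1 - last_zero B w).
  by rewrite /meander_process mul1r addrC subrK.
have sqE c x : c * (`|x| / Num.sqrt (1 - last_zero B w)) ^+ 2 =
    c / (1 - last_zero B w) * x ^+ 2.
  rewrite exprMn exprVn (sqr_sqrtr (ltW v0)) real_normK ?num_real//.
  by rewrite mulrA mulrAC.
rewrite m1E /meander_process !sqE mulrA.
have vc : 1 - tau n @[n --> \oo] --> 1 - last_zero B w.
  by apply: cvgB => //; exact: cvg_cst.
have vVc : (1 - tau n)^-1 @[n --> \oo] --> (1 - last_zero B w)^-1.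
  by apply: cvgV => //; rewrite gt_eqF.
have expc (c : R) (x : nat -> R) (y : R) : x n @[n --> \oo] --> y ->
    expR (- (c / (1 - tau n) * x n ^+ 2)) @[n --> \oo] -->
    expR (- (c / (1 - last_zero B w) * y ^+ 2)).
  move=> xy; apply: continuous_cvg; first exact: continuous_expR.
  by apply: cvgN; apply: cvgM; [apply: cvgMr|rewrite expr2; under eq_fun do rewrite expr2; apply: cvgM].
apply: cvgM; first apply: cvgM.
- apply: cvgM; first exact: cvg_cst.
  apply: cvgV; last exact: last_zero_sqrt_cvg.
  by rewrite gt_eqF// sqrtr_gt0.
- by apply: expc; exact: last_zero_path_cvg.
- by apply: expc; exact: cvg_cst.
Qed.

(** The identity [meander_ratio] is summed over the cells and both sides pass to the limit,
    dominated by 1. The events of the decomposition vanish from the limit, as does the correcting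
    weight. *)
Lemma meander_laplace_ratio u l m : 0 <= u <= 1 -> 0 <= l -> 1 <= m ->
  (gauss_mass u l m)^-1 *
  \int[P]_w (meander_process B 1 w *
    (expR (- (l * meander_process B u w ^+ 2)) *
     expR (- (m * meander_process B 1 w ^+ 2)))) =
  (gauss_mass u 0 1)^-1 *
  \int[P]_w (meander_process B 1 w *
    (expR (- (0 * meander_process B u w ^+ 2)) *
     expR (- (1 * meander_process B 1 w ^+ 2)))).
Proof.
move=> u01 l0 m1.
pose dc := gauss_rate u l m - gauss_rate u 0 1.
have dc0 : 0 <= dc by rewrite subr_ge0 gauss_rate_ge.
pose psi s w := expR (- (dc / (1 - s) * B s w ^+ 2)).
have psi01 s w : s < 1 -> 0 <= psi s w <= 1.
  move=> s1; rewrite expR_ge0/= -[leRHS]expR0 ler_expR oppr_le0 mulr_ge0 ?sqr_ge0//.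
  by rewrite divr_ge0// subr_ge0 ltW.
have mpsi s : 0 <= s < 1 -> measurable_fun setT (psi s).
  move=> /andP[s0 _]; apply: measurableT_comp => //; apply: measurableT_comp => //.
  by apply: measurable_funM => //; apply: measurable_funX; exact: (brownian_measurable BM).
have sum_le1 (H : R -> Omega -> R) n w : (forall s, 0 <= s < 1 -> 0 <= H s w <= 1) ->
    `|last_zero_sum H n w| <= 1.
  move=> H01; rewrite last_zero_sumE /=; case: ifPn => kn; last by rewrite normr0.
  have k01 := grid01_itv kn.
  by have /andP[h0 h1] := H01 _ k01; rewrite ger0_norm.
have gridj n (j : 'I_n) := grid01_itv (ltn_ord j).
have meanderc (H : R -> Omega -> R) : (forall s, 0 <= s < 1 -> measurable_fun setT (H s)) ->
    (forall s w, 0 <= s < 1 -> 0 <= H s w <= 1) ->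
    forall L : Omega -> R, (forall w, last_zero_sum H n w @[n --> \oo] --> L w) ->
    \int[P]_w last_zero_sum H n w @[n --> \oo] --> \int[P]_w L w.
  move=> mH H01 L HL; apply: (E_dct (M := 1)) => //.
  - by move=> n; exact: measurable_last_zero_sum.
  - by move=> n w; apply: sum_le1 => s; exact: H01.
have Hl : forall s, 0 <= s < 1 -> measurable_fun setT (scaled_functional B u l m s).
  by move=> s; exact: measurable_scaled_functional.
have H0 : forall s, 0 <= s < 1 ->
    measurable_fun setT (fun w => psi s w * scaled_functional B u 0 1 s w).
  by move=> s s01; apply: measurable_funM; [exact: mpsi|exact: measurable_scaled_functional].
have Hl01 (s : R) w : 0 <= s < 1 -> 0 <= scaled_functional B u l m s w <= 1.
  by move=> /andP[_ s1]; exact: scaled_functional_le1.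
have H001 (s : R) w : 0 <= s < 1 -> 0 <= psi s w * scaled_functional B u 0 1 s w <= 1.
  move=> /andP[_ s1]; have /andP[p0 p1] := psi01 s w s1.
  have /andP[q0 q1] := @scaled_functional_le1 u 0 1 s w (lexx 0) (lexx 1) s1.
  by rewrite mulr_ge0//= mulr_ile1.
have degenerate w (H : R -> Omega -> R) : last_zero B w = 1 ->
    last_zero_sum H n w @[n --> \oo] --> (0 : R).
  move=> g1; rewrite (_ : (fun n => _) = fun=> 0); first exact: cvg_cst.
  by apply/funext => n; exact: last_zero_sum_degenerate.
have meander_degenerate w v : last_zero B w = 1 -> meander_process B v w = 0.
  by move=> g1; rewrite /meander_process g1 subrr sqrtr0 invr0 mulr0.
have cl := meanderc _ Hl Hl01 (fun w => meander_process B 1 w *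
    (expR (- (l * meander_process B u w ^+ 2)) *
     expR (- (m * meander_process B 1 w ^+ 2)))).
have c0 := meanderc _ H0 H001 (fun w => meander_process B 1 w *
    (expR (- (0 * meander_process B u w ^+ 2)) *
     expR (- (1 * meander_process B 1 w ^+ 2)))).
have clw w : last_zero_sum (scaled_functional B u l m) n w @[n --> \oo] -->
    meander_process B 1 w * (expR (- (l * meander_process B u w ^+ 2)) *
     expR (- (m * meander_process B 1 w ^+ 2))).
  have [/andP[_ +] _ _] := last_zero_spec w.
  rewrite le_eqVlt => /predU1P[g1|g1].
    by rewrite !meander_degenerate// mul0r; exact: degenerate.
  by apply: last_zero_sum_cvg => // tau taug tauc; exact: scaled_functional_cvg.
have e1 : (gauss_mass u l m)^-1 *
    \int[P]_w last_zero_sum (scaled_functional B u l m) n w @[n --> \oo] -->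
  (gauss_mass u l m)^-1 *
  \int[P]_w (meander_process B 1 w * (expR (- (l * meander_process B u w ^+ 2)) *
     expR (- (m * meander_process B 1 w ^+ 2)))).
  by have := cl clw => c1; apply: cvgMr c1.
apply: (cvg_unique _ e1); first exact: norm_hausdorff.
rewrite (_ : (fun n => _) = (fun n => (gauss_mass u 0 1)^-1 *
  \int[P]_w last_zero_sum (fun s w => psi s w * scaled_functional B u 0 1 s w) n w));
  last first.
  apply/funext => n; rewrite /last_zero_sum.
  have bZ (j : 'I_n) : adapted B (grid 0 1 n j.+1)
     (\1_(path_event B (zero_event (grid 0 1 n j) (grid 0 1 n j.+1))) : Omega -> R).
    have jn := ltn_ord j.
    have /andP[t0 t1] := @grid_itv R 0 1 n j ler01 (ltnW (leq_trans jn (leqnSn n))).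
    by apply: adapted_zero_event => //; rewrite t0/= grid_le.
  have bN (j : 'I_n) : bounded_measurable
     (\1_(path_event B (zero_event (grid 0 1 n j.+1) 1)) : Omega -> R).
    have /andP[t0 t1] := gridj n j.
    apply: (bmeas_adapted BM (t := 1)); apply: adapted_zero_event => //.
    by rewrite t0 ltW.
  have b1 (j : 'I_n) (H : R -> Omega -> R) :
     (forall s, 0 <= s < 1 -> measurable_fun setT (H s)) ->
     (forall s w, 0 <= s < 1 -> 0 <= H s w <= 1) ->
     bounded_measurable (fun w =>
      \1_(path_event B (zero_event (grid 0 1 n j) (grid 0 1 n j.+1))) w *
      (1 - \1_(path_event B (zero_event (grid 0 1 n j.+1) 1)) w) *
      H (grid 0 1 n j.+1) w).
    move=> mH H01; apply: bmeasM; first apply: bmeasM.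
    - exact: (bmeas_adapted BM (bZ j)).
    - by apply: bmeasB => //; exact: bmeas_cst.
    - apply: (@bmeas_le _ _ _ 1); first exact: (mH _ (gridj n j)).
      by move=> w; have /andP[h0 h1] := H01 _ w (gridj n j); rewrite ger0_norm.
  rewrite !Esum; [|by move=> j; exact: (b1 j _ H0 H001)|by move=> j; exact: (b1 j _ Hl Hl01)].
  rewrite !mulr_sumr; apply: eq_bigr => j _.
  rewrite (meander_ratio BM u01 l0 m1 (gridj n j) (bZ j)); congr (_ * _).
  by apply: eq_Rintegral => w _; rewrite /psi /dc; ring.
have c0w w : last_zero_sum (fun s w => psi s w * scaled_functional B u 0 1 s w) n w
    @[n --> \oo] --> meander_process B 1 w *
    (expR (- (0 * meander_process B u w ^+ 2)) *
     expR (- (1 * meander_process B 1 w ^+ 2))).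
  have [/andP[_ +] _ _] := last_zero_spec w.
  rewrite le_eqVlt => /predU1P[g1|g1].
    by rewrite !meander_degenerate// mul0r; exact: degenerate.
  have [_ Bg _] := last_zero_spec w.
  apply: last_zero_sum_cvg => // tau taug tauc.
  (* The correcting weight tends to 1 because B vanishes at its last zero; here the remaining
     dependence on the rate is lost. *)
  rewrite -[X in _ --> X]mul1r; apply: cvgM; last exact: scaled_functional_cvg.
  rewrite (_ : 1 = expR (- (dc / (1 - last_zero B w) * B (last_zero B w) w ^+ 2)));
    last by rewrite Bg expr0n mulr0 oppr0 expR0.
  apply: continuous_cvg; first exact: continuous_expR.
  have Bc : B (tau n) w @[n --> \oo] --> B (last_zero B w) w.
    have := @last_zero_path_cvg 0 w tau; rewrite lexx ler01 => /(_ isT g1 taug tauc).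
    by under eq_fun do rewrite mul0r addr0; rewrite mul0r addr0.
  have vVc : (1 - tau n)^-1 @[n --> \oo] --> (1 - last_zero B w)^-1.
    apply: cvgV; first by rewrite gt_eqF// subr_gt0.
    by apply: cvgB => //; exact: cvg_cst.
  by apply: cvgN; apply: cvgM; [apply: cvgMr|rewrite expr2; under eq_fun do rewrite expr2; apply: cvgM].
have := c0 c0w => c1; apply: cvgMr c1.
Qed.

End meander_law.

(** * The Laplace transform of the Bessel process *)

Section three_dimensional.
Context {R : realType}.

(** This is D^(-3/2), where D is the determinant of I + 2 S diag(l, m) and S is the covariance
    matrix of (B(u), B(1)). Each of the three coordinates contributes D^(-1/2). *)
Definition bessel_laplace (u l m : R) : R :=
  let D := 1 + 2 * m + 2 * u * l + 4 * u * (1 - u) * l * m in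
  D^-1 * (Num.sqrt D)^-1.

Lemma gauss_den_mul (u l m : R) : 0 <= u <= 1 -> 0 <= m ->
  gauss_den1 u m * gauss_den2 u l m =
  1 + 2 * m + 2 * u * l + 4 * u * (1 - u) * l * m.
Proof.
move=> u01 m0; have D1 := gauss_den1_ge1 u01 m0.
have n0 : gauss_den1 u m != 0 by rewrite gt_eqF//; lra.
have e : gauss_den1 u m * (m / gauss_den1 u m) = m by rewrite mulrC divfK.
rewrite /gauss_den2 (_ : _ * _ = gauss_den1 u m + 2 * u *
  (l * gauss_den1 u m + gauss_den1 u m * (m / gauss_den1 u m))); last by ring.
rewrite e /gauss_den1; ring.
Qed.

Lemma gauss_massE (u l m : R) : 0 <= u <= 1 -> 0 <= l -> 0 <= m ->
  gauss_mass u l m = bessel_laplace u l m.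
Proof.
move=> u01 l0 m0; have D1 := gauss_den1_ge1 u01 m0.
have D2 := gauss_den2_ge1 u01 l0 m0.
rewrite /gauss_mass /bessel_laplace -gauss_den_mul//.
rewrite sqrtrM; last lra.
by rewrite !invfM mulrACA.
Qed.

(** At l = 0 and m = 1 neither the expectation nor [bessel_laplace] depends on u. The constant is
    therefore the same for all u, which later permits mixing over a random time. *)
Lemma meander_laplace {d} {Omega : measurableType d} (P : probability Omega R)
    (B : R -> Omega -> R) u l m : brownian_motion P B ->
  0 <= u <= 1 -> 0 <= l -> 1 <= m ->
  \int[P]_w (meander_process B 1 w *
    (expR (- (l * meander_process B u w ^+ 2)) *
     expR (- (m * meander_process B 1 w ^+ 2)))) =
  (bessel_laplace 0 0 1)^-1 *
  \int[P]_w (meander_process B 1 w * expR (- (meander_process B 1 w ^+ 2))) *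
  bessel_laplace u l m.
Proof.
move=> BM u01 l0 m1; have m0 : 0 <= m by lra.
have := meander_laplace_ratio BM u01 l0 m1.
rewrite (gauss_massE u01 l0 m0) (gauss_massE u01 (lexx 0) ler01).
have -> : bessel_laplace u 0 1 = bessel_laplace 0 0 1.
  by rewrite /bessel_laplace; congr (_ ^-1 * (Num.sqrt _)^-1); ring.
have g0 : bessel_laplace u l m != 0 by rewrite -gauss_massE// gt_eqF// gauss_mass_gt0.
rewrite [X in _ = _ * X -> _](_ : _ =
  \int[P]_w (meander_process B 1 w * expR (- (meander_process B 1 w ^+ 2)))); last first.
  by apply: eq_Rintegral => w _; rewrite mul0r oppr0 expR0 !mul1r.
by move=> <-; rewrite mulrC mulVKf.
Qed.

Lemma ge0_integral_pushforward_weighted {d d'} {T : measurableType d}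
    {T' : measurableType d'} (P : probability T R) (rho : T -> R) (G : T -> T')
    (phi : T' -> R) (brho : bounded_measurable rho) (rho0 : forall w, 0 <= rho w)
    (mG : measurable_fun setT G) :
  bounded_measurable phi -> (forall x, 0 <= phi x) ->
  (\int[P]_w (rho w * phi (G w)))%:E =
  (\int[pushforward (weighted P brho rho0) G]_y (phi y)%:E)%E.
Proof.
move=> bphi phi0.
have bphiG : bounded_measurable (fun w => phi (G w)) by exact: bmeas_comp bphi.
have mphi : measurable_fun setT (EFin \o phi) by apply/measurable_EFinP; case: bphi.
have mphiG : measurable_fun setT (EFin \o (fun w => phi (G w))).
  by apply/measurable_EFinP; case: bphiG.
rewrite EFinE; last exact: bmeasM.
rewrite ge0_integral_pushforward ?preimage_setT//; last by move=> y _; rewrite lee_fin.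
rewrite (@ge0_integral_density _ _ _ P (weighted P brho rho0) rho)//.
- by apply: eq_integral => w _ /=; rewrite mulrC EFinM.
- by case: brho.
- by move=> w; rewrite lee_fin.
Qed.

Lemma weighted_preimageE {d d'} {T : measurableType d}
    {T' : measurableType d'} (P : probability T R) (rho : T -> R) (G : T -> T')
    (brho : bounded_measurable rho) (rho0 : forall w, 0 <= rho w) (C : set T') :
  measurable_fun setT G -> measurable C ->
  weighted P brho rho0 (G @^-1` C) = (\int[P]_w (rho w * \1_C (G w)))%:E.
Proof.
move=> mG mC; rewrite EFinE; last first.
  by apply: bmeasM => //; apply: (bmeas_comp mG); exact: bmeas_indic.
rewrite /weighted integral_mkcond; apply: eq_integral => w _.
rewrite patchE indicE (_ : (w \in G @^-1` C) = (G w \in C))//.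
by case: ifP => _; rewrite ?mulr1 ?mulr0.
Qed.

(** Equality on indicators identifies the images of the two weighted measures under G1 and G2, and
    [phi] is integrated against this common image. *)
Lemma E_weight_eq {d1 d2 d'} {T1 : measurableType d1} {T2 : measurableType d2}
    {T' : measurableType d'} (P1 : probability T1 R) (P2 : probability T2 R)
    (rho1 : T1 -> R) (rho2 : T2 -> R) (G1 : T1 -> T') (G2 : T2 -> T')
    (phi : T' -> R) :
  bounded_measurable rho1 -> bounded_measurable rho2 ->
  (forall w, 0 <= rho1 w) -> (forall w, 0 <= rho2 w) ->
  measurable_fun setT G1 -> measurable_fun setT G2 ->
  (forall C, measurable C -> \int[P1]_w (rho1 w * \1_C (G1 w)) =
                            \int[P2]_w (rho2 w * \1_C (G2 w))) ->
  bounded_measurable phi -> (forall x, 0 <= phi x) ->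
  \int[P1]_w (rho1 w * phi (G1 w)) = \int[P2]_w (rho2 w * phi (G2 w)).
Proof.
move=> b1 b2 p1 p2 mG1 mG2 e bphi phi0; apply: EFin_inj.
rewrite (ge0_integral_pushforward_weighted P1 b1 p1 mG1)//.
rewrite (ge0_integral_pushforward_weighted P2 b2 p2 mG2)//.
apply: eq_measure_integral => A mA _.
transitivity (weighted P1 b1 p1 (G1 @^-1` A)) => //.
transitivity (weighted P2 b2 p2 (G2 @^-1` A)) => //.
by rewrite !weighted_preimageE// e.
Qed.

(** Extends a product rule from events of one factor to its nonnegative bounded functions,
    everything else being kept in the weight. *)
Lemma E_weight_indep {d d'} {T : measurableType d} {T' : measurableType d'}
    (P : probability T R) (rho : T -> R) (G : T -> T') (c : R) (phi : T' -> R) :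
  bounded_measurable rho -> (forall w, 0 <= rho w) -> measurable_fun setT G -> 0 <= c ->
  (forall C, measurable C -> \int[P]_w (rho w * \1_C (G w)) = c * \int[P]_w \1_C (G w)) ->
  bounded_measurable phi -> (forall x, 0 <= phi x) ->
  \int[P]_w (rho w * phi (G w)) = c * \int[P]_w phi (G w).
Proof.
move=> brho rho0 mG c0 rhoG bphi phi0.
rewrite (@E_weight_eq _ _ _ _ _ _ P P rho (fun=> c) G G phi)//.
- by rewrite EZ//; exact: bmeas_comp bphi.
- exact: bmeas_cst.
- move=> C mC; rewrite rhoG// EZ//.
  by apply: (bmeas_comp mG); exact: bmeas_indic.
Qed.

Section mutual.
Context {d} {Omega : measurableType d} (P : probability Omega R).
Variable (W : 'I_3 -> R -> Omega -> R).
Hypothesis BMW : brownian_motion_vec P W.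

Local Notation halfline := (`[(0 : R), +oo[%classic).

Let i0 : 'I_3 := @Ordinal 3 0 isT.
Let i1 : 'I_3 := @Ordinal 3 1 isT.
Let i2 : 'I_3 := @Ordinal 3 2 isT.

Lemma ord3E (i : 'I_3) : [\/ i = i0, i = i1 | i = i2].
Proof.
case: i => -[|[|[|//]]] h; [constructor 1|constructor 2|constructor 3]; exact: val_inj.
Qed.

Lemma mutual_events (A0 A1 A2 : set (R -> R)) :
  cylinder halfline A0 -> cylinder halfline A1 -> cylinder halfline A2 ->
  P (path_event (W i0) A0 `&` path_event (W i1) A1 `&` path_event (W i2) A2) =
  (P (path_event (W i0) A0) * P (path_event (W i1) A1) * P (path_event (W i2) A2))%E.
Proof.
move=> c0 c1 c2; case: BMW => _ /(_ (fun i => if i == i0 then A0 else if i == i1 then A1 else A2)).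
have h i : cylinder halfline (if i == i0 then A0 else if i == i1 then A1 else A2).
  by case: (ord3E i) => ->.
move=> /(_ h); rewrite !big_ord_recl big_ord0 mule1 /= muleA => e.
have l0 : (ord0 : 'I_3) = i0 by exact: val_inj.
have l1 : lift ord0 ord0 = i1 :> 'I_3 by exact: val_inj.
have l2 : lift ord0 (lift ord0 ord0) = i2 :> 'I_3 by exact: val_inj.
rewrite l2 l1 l0 in e; rewrite -e; congr (P _); apply/seteqP; split => w /=.
  by move=> [[h0 h1] h2] i _; case: (ord3E i) => ->.
by move=> hw; split; [split|]; [exact: (hw i0 Logic.I)|exact: (hw i1 Logic.I)|exact: (hw i2 Logic.I)].
Qed.

(** Independence is given for events. Indicators are replaced by functions one coordinate at a time,
    the third in [s2], the second in [s1] and the first at the end, while the other factors form the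
    weight of [E_weight_indep]. *)
Lemma mutual_expectation (f0 f1 f2 : path_space halfline -> R) :
  bounded_measurable f0 -> bounded_measurable f1 -> bounded_measurable f2 ->
  (forall x, 0 <= f0 x) -> (forall x, 0 <= f1 x) -> (forall x, 0 <= f2 x) ->
  \int[P]_w (f0 (W i0 ^~ w) * f1 (W i1 ^~ w) * f2 (W i2 ^~ w)) =
  \int[P]_w f0 (W i0 ^~ w) * \int[P]_w f1 (W i1 ^~ w) * \int[P]_w f2 (W i2 ^~ w).
Proof.
move=> b0 b1 b2 p0 p1 p2.
have mW i : measurable_fun setT (fun w => (W i ^~ w) : path_space halfline).
  apply: measurable_path => t; rewrite /= in_itv/= andbT => t0.
  by apply: (brownian_measurable (P := P)) => //; case: BMW.
have bW i (f : path_space halfline -> R) : bounded_measurable f ->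
    bounded_measurable (fun w => f (W i ^~ w)) by move=> bf; apply: bmeas_comp bf.
have bind (A : set (path_space halfline)) : measurable A ->
  bounded_measurable (\1_A : path_space halfline -> R) by exact: bmeas_indic.
have E1 i (A : set (path_space halfline)) : measurable A ->
   \int[P]_w \1_A (W i ^~ w) = fine (P (path_event (W i) A)) :> R.
  move=> mA; rewrite -Eindic//; exact: (measurable_preimageT (mW i) mA).
have ind0 (A : set (path_space halfline)) x : 0 <= \1_A x :> R by rewrite indicE.
have Ege0 (f : Omega -> R) : (forall w, 0 <= f w) -> 0 <= \int[P]_w f w.
  by move=> fge0; apply: Rintegral_ge0 => w _; exact: fge0.
have s2 (A0 A1 : set (path_space halfline)) : measurable A0 -> measurable A1 ->
  \int[P]_w (\1_A0 (W i0 ^~ w) * \1_A1 (W i1 ^~ w) * f2 (W i2 ^~ w)) =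
  \int[P]_w \1_A0 (W i0 ^~ w) * \int[P]_w \1_A1 (W i1 ^~ w) * \int[P]_w f2 (W i2 ^~ w).
  move=> m0 m1; apply: (@E_weight_indep _ _ _ (path_space halfline) P
    (fun w => \1_A0 (W i0 ^~ w) * \1_A1 (W i1 ^~ w)) (fun w => W i2 ^~ w)) => //.
  - by apply: bmeasM; apply: bW; exact: bind.
  - by apply: mulr_ge0; apply: Ege0 => w; exact: ind0.
  - move=> C mC.
    have mpe i (A : set (path_space halfline)) : measurable A ->
        measurable (path_event (W i) A) by move=> mA; exact: (measurable_preimageT (mW i) mA).
    have fpe i (A : set (path_space halfline)) : measurable A ->
        P (path_event (W i) A) \is a fin_num by move=> mA; exact: fin_num_measure (mpe i A mA).
    rewrite (E1 i0 _ m0) (E1 i1 _ m1) (E1 i2 _ mC).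
    rewrite -(fineM (fpe i0 _ m0) (fpe i1 _ m1)).
    rewrite -(fineM (fin_numM (fpe i0 _ m0) (fpe i1 _ m1)) (fpe i2 _ mC)).
    rewrite -mutual_events// -Eindic; last first.
      by apply: measurableI; [apply: measurableI|]; exact: mpe.
    by apply: eq_Rintegral => w _; rewrite !indicE !in_setI -!mulnb !natrM.
have s1 (A0 : set (path_space halfline)) : measurable A0 ->
  \int[P]_w (\1_A0 (W i0 ^~ w) * f2 (W i2 ^~ w) * f1 (W i1 ^~ w)) =
  \int[P]_w \1_A0 (W i0 ^~ w) * \int[P]_w f2 (W i2 ^~ w) * \int[P]_w f1 (W i1 ^~ w).
  move=> m0; apply: (@E_weight_indep _ _ _ (path_space halfline) P
    (fun w => \1_A0 (W i0 ^~ w) * f2 (W i2 ^~ w)) (fun w => W i1 ^~ w)) => //.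
  - by apply: bmeasM; [apply: bW; exact: bind|exact: bW].
  - by move=> w; exact: mulr_ge0.
  - by apply: mulr_ge0; apply: Ege0 => w; [exact: ind0|exact: p2].
  - move=> C mC; rewrite mulrAC -s2//; apply: eq_Rintegral => w _; ring.
rewrite (_ : \int[P]_w _ = \int[P]_w (f1 (W i1 ^~ w) * f2 (W i2 ^~ w) * f0 (W i0 ^~ w)));
  last by apply: eq_Rintegral => w _; ring.
rewrite (@E_weight_indep _ _ _ (path_space halfline) P
    (fun w => f1 (W i1 ^~ w) * f2 (W i2 ^~ w)) (fun w => W i0 ^~ w)
    (\int[P]_w f1 (W i1 ^~ w) * \int[P]_w f2 (W i2 ^~ w)))//.
- ring.
- by apply: bmeasM; exact: bW.
- by move=> w; exact: mulr_ge0.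
- by apply: mulr_ge0; apply: Ege0 => w; [exact: p1|exact: p2].
- move=> C mC; rewrite mulrC mulrA -[RHS]mulrA mulrA -[RHS]mulrA.
  rewrite (mulrC (\int[P]_w f1 _)) mulrA -s1//; apply: eq_Rintegral => w _; ring.
Qed.

End mutual.

End three_dimensional.

Section brownian_laplace.
Context {R : realType} {d} {Omega : measurableType d}.
Variables (P : probability Omega R).

Local Notation halfline := (`[(0 : R), +oo[%classic).

Lemma brownian_laplace (B : R -> Omega -> R) u l m : brownian_motion P B ->
  0 <= u <= 1 -> 0 <= l -> 0 <= m ->
  \int[P]_w (expR (- (l * B u w ^+ 2)) * expR (- (m * B 1 w ^+ 2))) =
  (Num.sqrt (1 + 2 * m + 2 * u * l + 4 * u * (1 - u) * l * m))^-1.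
Proof.
move=> BM u01 l0 m0; have /andP[u0 u1] := u01.
have ath : adapted B u (fun w => expR (- (l * B u w ^+ 2))).
  by apply: adapted_gauss => //; rewrite u0 lexx.
have D11 := gauss_den1_ge1 u01 m0.
have x0 : 0 <= l + m / gauss_den1 u m by rewrite addr_ge0// divr_ge0//; lra.
rewrite (markov_gauss BM u0 u1 m0 ath) -/(gauss_den1 u m).
rewrite (_ : \int[P]_w _ = \int[P]_w (1 *
  expR (- ((l + m / gauss_den1 u m) * B u w ^+ 2)))); last first.
  by apply: eq_Rintegral => w _; rewrite -expRD mul1r; congr expR; ring.
have ath1 : adapted B 0 (fun=> 1 : R) by exists (fun=> 1) => //; exact: bmeas_cst.
rewrite (markov_gauss BM (lexx 0) u0 x0 ath1) subr0 -/(gauss_den2 u l m).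
rewrite (_ : \int[P]_w _ = \int[P]_w (1 : R)); last first.
  apply: eq_Rintegral => w _; case: BM => _ -> _ _.
  by rewrite expr0n mulr0 oppr0 expR0 mulr1.
rewrite Ecst mulr1 -gauss_den_mul// sqrtrM ?invfM//; lra.
Qed.

(** The value s = 0 must be covered because the bridge has variance u (1 - u), which vanishes at u =
    0 and u = 1. *)
Lemma brownian_shift_laplace (B : R -> Omega -> R) x s l : brownian_motion P B ->
  0 <= s -> 0 <= l ->
  \int[P]_w expR (- (l * (x + s * B 1 w) ^+ 2)) =
  (Num.sqrt (1 + 2 * l * s ^+ 2))^-1 * expR (- (l / (1 + 2 * l * s ^+ 2) * x ^+ 2)).
Proof.
move=> BM; rewrite le_eqVlt => /predU1P[<-|s0] l0.
  rewrite expr0n !mulr0 addr0 sqrtr1 invr1 mulr1 mul1r.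
  by under eq_Rintegral do rewrite mul0r addr0; rewrite Ecst.
have lawB1 A : measurable A -> P (B 1 @^-1` A) = normal_prob 0 1 A.
  move=> mA; case: BM => _ B0 /(_ 0 1 (lexx 0) ltr01 A mA) + _.
  rewrite subr0 sqrtr1 => <-; congr (P _); apply/funext => w /=.
  by rewrite B0 subr0.
have mB1 : measurable_fun setT (B 1) by exact: (brownian_measurable BM).
have ls0 : 0 <= l * s ^+ 2 by rewrite mulr_ge0// sqr_ge0.
have e (z : R) : expR (- (l * (x + s * z) ^+ 2)) = expR (- (l * s ^+ 2 * (x / s + z) ^+ 2)).
  by congr expR; field; rewrite gt_eqF.
under eq_Rintegral do rewrite e.
rewrite (@E_law R _ _ P _ _ (normal_prob 0 1) (B 1)
  (fun z => expR (- (l * s ^+ 2 * (x / s + z) ^+ 2))))//; last exact: bmeas_gauss_shift.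
rewrite normal_gauss// expr1n mulr1 mulrA; congr (_ * expR (- _)).
by field; rewrite !gt_eqF//; nra.
Qed.

Section vector.
Variable (W : 'I_3 -> R -> Omega -> R).
Hypothesis BMW : brownian_motion_vec P W.

Let i0 : 'I_3 := @Ordinal 3 0 isT.
Let i1 : 'I_3 := @Ordinal 3 1 isT.
Let i2 : 'I_3 := @Ordinal 3 2 isT.

Lemma sum3E (F : 'I_3 -> R) : \sum_(i < 3) F i = F i0 + F i1 + F i2.
Proof.
rewrite !big_ord_recl big_ord0 addr0 addrA.
by congr (_ + _ + _); congr F; exact: val_inj.
Qed.

Lemma bmeas_path_gauss l (t x s : R) : 0 <= t -> 0 <= l ->
  bounded_measurable (fun f : path_space halfline => expR (- (l * (x + s * f t) ^+ 2))).
Proof.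
move=> t0 l0; apply: (@bmeas_le _ _ _ 1).
  apply: measurableT_comp => //; apply: measurableT_comp => //.
  apply: measurable_funM => //; apply: measurable_funX; apply: measurable_funD => //.
  apply: measurable_funM => //; apply: measurable_eval.
  by rewrite /= in_itv/= t0.
move=> f; rewrite (ger0_norm (expR_ge0 _)) -expR0 ler_expR oppr_le0.
by rewrite mulr_ge0// sqr_ge0.
Qed.

Lemma bessel_laplaceE u l m : 0 <= u <= 1 -> 0 <= l -> 0 <= m ->
  \int[P]_w (expR (- (l * euclidean_norm_process W u w ^+ 2)) *
             expR (- (m * euclidean_norm_process W 1 w ^+ 2))) = bessel_laplace u l m.
Proof.
move=> u01 l0 m0; have /andP[u0 u1] := u01.
pose f (p : path_space halfline) :=
  expR (- (l * (0 + 1 * p u) ^+ 2)) * expR (- (m * (0 + 1 * p 1) ^+ 2)).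
have bf : bounded_measurable f by apply: bmeasM; exact: bmeas_path_gauss.
have f0 p : 0 <= f p by rewrite mulr_ge0 ?expR_ge0.
have fE i : \int[P]_w f (W i ^~ w) =
    (Num.sqrt (1 + 2 * m + 2 * u * l + 4 * u * (1 - u) * l * m))^-1.
  rewrite -(brownian_laplace (BMW.1 i) u01 l0 m0).
  by apply: eq_Rintegral => w _; rewrite /f !mul1r !add0r.
transitivity (\int[P]_w (f (W i0 ^~ w) * f (W i1 ^~ w) * f (W i2 ^~ w))).
  apply: eq_Rintegral => w _; rewrite /f /euclidean_norm_process.
  rewrite !sqr_sqrtr; try by apply: sumr_ge0 => i _; exact: sqr_ge0.
  rewrite !sum3E -!expRD; congr expR; ring.
rewrite mutual_expectation// !fE /bessel_laplace.
set D := 1 + _ + _ + _.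
have D0 : 0 < D.
  rewrite /D -gauss_den_mul// mulr_gt0//.
    by apply: lt_le_trans (gauss_den1_ge1 u01 m0).
  by apply: lt_le_trans (gauss_den2_ge1 u01 l0 m0).
by rewrite -invfM -expr2 sqr_sqrtr// ltW.
Qed.

(** Transform of the squared norm of a Gaussian vector with variance s^2 in each coordinate and mean
    at distance x from the origin. By rotation invariance the mean can be placed on the first
    axis. *)
Lemma shifted_norm_laplace x s l : 0 <= s -> 0 <= l ->
  \int[P]_w expR (- (l * ((x + s * W i0 1 w) ^+ 2 + (s * W i1 1 w) ^+ 2 +
     (s * W i2 1 w) ^+ 2))) =
  (1 + 2 * l * s ^+ 2)^-1 * (Num.sqrt (1 + 2 * l * s ^+ 2))^-1 *
    expR (- (l / (1 + 2 * l * s ^+ 2) * x ^+ 2)).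
Proof.
move=> s0 l0.
pose f x (p : path_space halfline) := expR (- (l * (x + s * p 1) ^+ 2)).
have bf y : bounded_measurable (f y) by exact: bmeas_path_gauss.
have f0 y p : 0 <= f y p by exact: expR_ge0.
transitivity (\int[P]_w (f x (W i0 ^~ w) * f 0 (W i1 ^~ w) * f 0 (W i2 ^~ w))).
  by apply: eq_Rintegral => w _; rewrite /f -!expRD; congr expR; ring.
rewrite mutual_expectation// /f.
rewrite (brownian_shift_laplace x (BMW.1 i0) s0 l0) !(brownian_shift_laplace 0 (BMW.1 _) s0 l0).
rewrite expr0n !mulr0 oppr0 expR0 mulr1.
set D := 1 + _; have D0 : 0 < D by rewrite ltr_pwDl// !mulr_ge0// sqr_ge0.
rewrite -mulrA -[X in _ * X = _]invfM -expr2 sqr_sqrtr ?ltW// mulrAC; congr (_ * _).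
by rewrite mulrC.
Qed.

End vector.

End brownian_laplace.

(** * Transfer of path laws and evaluation at an independent random time *)

Section law_transfer.
Context {R : realType} {d d'} {Omega : measurableType d} {Omega' : measurableType d'}.
Variables (P : probability Omega R) (P' : probability Omega' R).

Lemma process_law_expectation (I : set R) (X : R -> Omega -> R) (X' : R -> Omega' -> R)
    (phi : path_space I -> R) :
  (forall t, I t -> measurable_fun setT (X t)) ->
  (forall t, I t -> measurable_fun setT (X' t)) ->
  same_process_law I P X P' X' -> bounded_measurable phi ->
  \int[P]_w phi (X ^~ w) = \int[P']_w phi (X' ^~ w).
Proof.
move=> mX mX' law bphi.
have mF : measurable_fun setT (fun w => (X ^~ w) : path_space I) by exact: measurable_path.
have mF' : measurable_fun setT (fun w => (X' ^~ w) : path_space I) by exact: measurable_path.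
pose Q := distribution P' (mfun_Sub (mem_set mF')).
rewrite (@E_law R _ _ P _ _ Q (fun w => X ^~ w) phi mF) //.
by rewrite (@E_law R _ _ P' _ _ Q (fun w => X' ^~ w) phi mF').
Qed.

End law_transfer.

Section random_time.
Context {R : realType} {d} {Omega : measurableType d}.
Variables (P : probability Omega R).

Lemma E_fubini2 {d1 d2} {T1 : measurableType d1} {T2 : measurableType d2}
    (P1 : probability T1 R) (P2 : probability T2 R) (f : T1 * T2 -> R) :
  bounded_measurable f ->
  \int[(P1 \x P2)%E]_z f z = \int[P2]_y \int[P1]_x f (x, y).
Proof.
move=> bf.
have bG : bounded_measurable (fun y => \int[P1]_x f (x, y)).
  apply: (bmeas_E1 P2 P1 (f := fun z => f (z.2, z.1))).
  by apply: (bmeas_comp (h := fun z : T2 * T1 => (z.2, z.1)) _ bf);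
    apply/measurable_fun_pair.
apply: EFin_inj; rewrite !EFinE//.
rewrite -(integral21_prod_meas1 (f := EFin \o f)); last exact: bmeas_integrable.
by apply: eq_integral => x _; rewrite /fubini_G EFinE//; exact: bmeas_section2.
Qed.

Variables (I : set R) (X : R -> Omega -> R) (U : {RV P >-> R}).
Hypotheses (I01 : `[0, 1] `<=` I) (cX : continuous_process I X).
Hypothesis (U01 : forall w, 0 <= U w <= 1).

(* The path evaluated at the left end point of the grid cell containing x. *)
Let step_eval (n : nat) (f : R -> R) (x : R) : R :=
  \sum_(k < n.+2) \1_(`[grid 0 1 n k, grid 0 1 n k.+1[%classic : set R) x * f (grid 0 1 n k).

Lemma step_evalE n f x : 0 <= x <= 1 ->
  exists2 t, 0 <= t <= 1 /\ `|t - x| <= 1 / n.+1%:R & step_eval n f x = f t.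
Proof.
move=> /andP[x0 x1]; have n0 : 0 < n.+1%:R :> R by rewrite ltr0n.
have xn0 : 0 <= x * n.+1%:R by rewrite mulr_ge0.
have /andP[h1 h2] := truncn_itv xn0.
set k := Num.truncn _ in h1 h2.
(* The point x = 1 falls in the cell of index n.+1, which starts at 1; hence n.+2 terms in
   [step_eval]. *)
have kn : (k < n.+2)%N.
  rewrite ltnS -(ler_nat R); apply: (le_trans h1).
  by rewrite -[leRHS]mul1r ler_wpM2r// ltW.
have g1 : grid 0 1 n k <= x by rewrite grid01 ler_pdivrMr.
have g2 : x < grid 0 1 n k.+1 by rewrite grid01 ltr_pdivlMr.
exists (grid 0 1 n k); first split.
- apply/andP; split; first by rewrite grid01 divr_ge0.
  exact: le_trans x1.
- rewrite ler0_norm ?subr_le0// opprB lerBlDl ltW//.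
  by move: g2; rewrite gridS subr0.
rewrite /step_eval (bigD1 (Ordinal kn))//= big1 ?addr0.
  by rewrite indicE mem_set ?mul1r//= in_itv/= g1 g2.
move=> j jk; rewrite indicE memNset ?mul0r//= in_itv/= !grid01.
rewrite ler_pdivrMr// ltr_pdivlMr// => /truncn_def kj.
by move/eqP: jk; apply; apply: val_inj; rewrite /= -kj.
Qed.

Lemma step_eval_cvg x w : 0 <= x <= 1 ->
  step_eval n (X ^~ w) x @[n --> \oo] --> X x w.
Proof.
move=> x01; have [_ /(_ w) cw] := cX.
have /choice[t tP] : forall n, exists t, [/\ 0 <= t <= 1, `|t - x| <= 1 / n.+1%:R &
    step_eval n (X ^~ w) x = X t w].
  by move=> n; have [t [t01 tx] e] := step_evalE n (X ^~ w) x01; exists t.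
rewrite (_ : (fun n => _) = fun n => X (t n) w); last first.
  by apply/funext => n; have [] := tP n.
apply: (within_continuous_seq cw).
- by apply: I01; rewrite /= in_itv.
- by move=> n; apply: I01; rewrite /= in_itv/=; have [] := tP n.
- by apply: (@near_oo_cvg0 _ _ _ 1) => n; have [_ h _] := tP n.
Qed.

Lemma measurable_step_eval n {d'} {T : measurableType d'} (F : T -> path_space I)
    (G : T -> R) : measurable_fun setT F -> measurable_fun setT G ->
  measurable_fun setT (fun z => step_eval n (F z) (G z)).
Proof.
move=> mF mG; apply: measurable_sum => k; apply: measurable_funM.
  by apply: (measurableT_comp (measurable_indic _) mG).
apply: (measurableT_comp (f := fun f : path_space I => f (grid 0 1 n k)) _ mF).
have [kn|kn] := leqP k n.+1.
  by apply: measurable_eval; apply: I01; rewrite /= in_itv/=; exact: grid_itv.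
by have := ltn_ord k; rewrite ltnNge kn.
Qed.

Lemma measurable_random_time : measurable_fun setT (at_random_time X U).
Proof.
have mF : measurable_fun setT (fun w => (X ^~ w) : path_space I).
  by apply: measurable_path; case: cX.
apply: (@measurable_fun_cvg _ _ _ setT (fun n w => step_eval n (X ^~ w) (U w))).
  by move=> n; apply: measurable_step_eval.
by move=> w _; exact: step_eval_cvg.
Qed.

(** Evaluation (f, x) -> f(x) need not be measurable for the product of the cylinder sigma-algebra
    with the Borel sets, so independence cannot be applied to it directly. It is applied to the step
    evaluations, which are measurable; continuity of the paths and of [phi] in its first variable
    gives the limit. *)
Lemma random_time_expectation (phi : R * R -> R) :
  process_indep_rv P I X U -> bounded_measurable phi ->
  (forall y, continuous (fun x => phi (x, y))) ->
  \int[P]_w phi (at_random_time X U w, X 1 w) =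
  \int[P]_w' \int[P]_w phi (X (U w') w, X 1 w).
Proof.
move=> XU bphi cphi; have [mphi [M phiM]] := bphi.
have mF : measurable_fun setT (fun w => (X ^~ w) : path_space I).
  by apply: measurable_path; case: cX.
have I1 : I 1 by apply: I01; rewrite /= in_itv/= ler01 lexx.
have mX1 : measurable_fun setT (X 1) by case: cX => mX _; exact: mX.
pose psi n (z : path_space I * R) := phi (step_eval n z.1 z.2, z.1 1).
have bpsi n : bounded_measurable (psi n).
  apply: (bmeas_comp (h := fun z : path_space I * R => (step_eval n z.1 z.2, z.1 1)) _ bphi).
  apply/measurable_fun_pair; first exact: measurable_step_eval.
  by apply: (measurableT_comp (f := fun f : path_space I => f 1)) => //; exact: measurable_eval.
have EQ n : \int[P]_w psi n (X ^~ w, U w) =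
    \int[(P \x P)%E]_z psi n (X ^~ z.1, U z.2).
  rewrite (E_fubini1 P P (f := fun z => psi n (X ^~ z.1, U z.2))); last first.
    apply: (bmeas_comp (h := fun z : Omega * Omega => (X ^~ z.1 : path_space I, U z.2)) _ (bpsi n)).
    apply/measurable_fun_pair; first exact: (measurableT_comp mF).
    exact: measurableT_comp.
  by apply: (E_indep mF (measurable_funP U) XU).
have mlim : measurable_fun setT (fun z : Omega * Omega => X (U z.2) z.1).
  apply: (@measurable_fun_cvg _ _ _ setT (fun n z => step_eval n (X ^~ z.1) (U z.2))).
    move=> n; apply: (@measurable_step_eval n _ _ (fun z : Omega * Omega => X ^~ z.1) (fun z => U z.2)).
      exact: (measurableT_comp mF).
    exact: measurableT_comp.
  by move=> z _; exact: step_eval_cvg.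
have blim : bounded_measurable (fun z : Omega * Omega => phi (X (U z.2) z.1, X 1 z.1)).
  apply: (bmeas_comp (h := fun z : Omega * Omega => (X (U z.2) z.1, X 1 z.1)) _ bphi).
  by apply/measurable_fun_pair => //; exact: (measurableT_comp mX1).
have cvgphi (x : nat -> R) (x0 y : R) : x n @[n --> \oo] --> x0 ->
    phi (x n, y) @[n --> \oo] --> phi (x0, y).
  by move=> xx0; apply: (cvg_comp _ _ xx0 (cphi y x0)).
have L1 : \int[P]_w psi n (X ^~ w, U w) @[n --> \oo] -->
    \int[P]_w phi (at_random_time X U w, X 1 w).
  apply: (E_dct (M := M)) => //.
  - move=> n; have [mpsi _] := bpsi n.
    apply: (measurableT_comp (f := psi n)) => //; apply/measurable_fun_pair => //.
  - by move=> n w; exact: phiM.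
  - move=> w; exact: (cvgphi (fun n => step_eval n (X ^~ w) (U w)) _ (X 1 w)
      (@step_eval_cvg (U w) w (U01 w))).
have L2 : \int[(P \x P)%E]_z psi n (X ^~ z.1, U z.2) @[n --> \oo] -->
    \int[(P \x P)%E]_z phi (X (U z.2) z.1, X 1 z.1).
  apply: (E_dct (M := M)) => //.
  - move=> n; have [mpsi _] := bpsi n.
    apply: (measurableT_comp (f := psi n)) => //; apply/measurable_fun_pair.
      exact: (measurableT_comp mF).
    exact: measurableT_comp.
  - by move=> n z; exact: phiM.
  - move=> z; exact: (cvgphi (fun n => step_eval n (X ^~ z.1) (U z.2)) _ (X 1 z.1)
      (@step_eval_cvg (U z.2) z.1 (U01 z.2))).
rewrite -(E_fubini2 P P blim).
apply: (cvg_unique _ L1); first exact: norm_hausdorff.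
by rewrite (_ : (fun n => _) = (fun n => \int[(P \x P)%E]_z psi n (X ^~ z.1, U z.2)));
  last by apply/funext => n; rewrite EQ.
Qed.

End random_time.

(** * Conditional laws from Laplace transforms *)

Section law_kernel.
Context {R : realType} {d} {T : measurableType d}.
Variables (Q : probability T R) (Yf : R * T -> R).
Hypothesis mYf : measurable_fun setT Yf.

(** Measurability of [Yf] is an argument so that the measure and kernel structures can be attached
    to the term. *)
Definition law_kernel of measurable_fun setT Yf :=
  fun (r : R) (C : set R) => Q ((fun z => Yf (r, z)) @^-1` C).

Local Notation ker := (law_kernel mYf).

Let measurable_section r : measurable_fun setT (fun z => Yf (r, z)).
Proof. exact: (measurableT_comp mYf (pair1_measurable r)). Qed.

Let ker0 r : ker r set0 = 0%E.
Proof. by rewrite /law_kernel preimage_set0 measure0. Qed.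

Let ker_ge0 r C : (0 <= ker r C)%E.
Proof. exact: measure_ge0. Qed.

Let ker_sigma_additive r : semi_sigma_additive (ker r).
Proof.
exact: (@measure_semi_sigma_additive _ _ _
  (measure_function_pushforward__canonical__measure_function_Measure Q (measurable_section r))).
Qed.

HB.instance Definition _ r := isMeasure.Build _ _ _ (ker r) (ker0 r) (ker_ge0 r)
  (@ker_sigma_additive r).

Definition law_kernel_measure of measurable_fun setT Yf :=
  fun r : R => [the {measure set R -> \bar R} of ker r].

Local Notation kerm := (law_kernel_measure mYf).

Let kerm_measurable C : measurable C -> measurable_fun setT (kerm ^~ C).
Proof.
move=> mC.
rewrite (_ : kerm ^~ C = Q \o xsection (Yf @^-1` C)); last first.
  by apply/funext => r /=; congr (Q _); apply/seteqP; split => z;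
    rewrite /xsection/= inE.
by apply: measurable_fun_xsection; exact: measurable_preimageT.
Qed.

HB.instance Definition _ := isKernel.Build _ _ _ _ _ kerm kerm_measurable.

Let kerm_prob r : kerm r setT = 1%E.
Proof. by rewrite /law_kernel_measure/= /law_kernel preimage_setT probability_setT. Qed.

HB.instance Definition _ := Kernel_isProbability.Build _ _ _ _ _ kerm kerm_prob.

Lemma exists_law_kernel : exists k : R.-pker R ~> R, forall r C,
  k r C = Q ((fun z => Yf (r, z)) @^-1` C).
Proof. by exists [the R.-pker R ~> R of kerm]. Qed.

End law_kernel.

Section conditional.
Context {R : realType}.

Lemma laplace_unique_E {d d'} {T : measurableType d} {T' : measurableType d'}
  (P : probability T R) (X Y rho : T -> R)
  (P' : probability T' R) (X' Y' rho' : T' -> R) (A B : set R) :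
  measurable_fun setT X -> measurable_fun setT Y -> bounded_measurable rho ->
  (forall w, 0 <= rho w) ->
  measurable_fun setT X' -> measurable_fun setT Y' -> bounded_measurable rho' ->
  (forall w, 0 <= rho' w) ->
  (forall i j : nat,
  \int[P]_w (rho w * (expR (- X w ^+ 2) ^+ i * expR (- Y w ^+ 2) ^+ j)) =
  \int[P']_w (rho' w * (expR (- X' w ^+ 2) ^+ i * expR (- Y' w ^+ 2) ^+ j))) ->
  measurable A -> measurable B ->
  \int[P]_w (rho w * (\1_A `|X w| * \1_B `|Y w|)) =
  \int[P']_w (rho' w * (\1_A `|X' w| * \1_B `|Y' w|)).
Proof.
move=> mX mY br r0 mX' mY' br' r0' lap mA mB; apply: EFin_inj.
rewrite -(weighted_quadrantE P br r0 mX mY mA mB).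
rewrite -(weighted_quadrantE P' br' r0' mX' mY' mA mB).
exact: laplace_unique.
Qed.

Section from_laplace.
Context {d dT} {Omega : measurableType d} {T : measurableType dT}.
Variables (P : probability Omega R) (Y Z : Omega -> R).
Variables (Q : probability T R) (Yf : R * T -> R) (h : R -> R).
Hypotheses (mY : measurable_fun setT Y) (mZ : measurable_fun setT Z)
  (mYf : measurable_fun setT Yf) (Yf0 : forall z, 0 <= Yf z)
  (bh : bounded_measurable h) (h0 : forall x, 0 <= h x)
  (Y0 : {ae P, forall w, 0 <= Y w}) (Z0 : {ae P, forall w, 0 <= Z w})
  (hZ : {ae P, forall w, 0 < h (Z w)}).
Hypothesis lap : forall i j : nat,
  \int[P]_w (h (Z w) * (expR (- Y w ^+ 2) ^+ i * expR (- Z w ^+ 2) ^+ j)) =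
  \int[P]_w (h (Z w) * expR (- Z w ^+ 2) ^+ j *
    \int[Q]_z expR (- Yf (Z w, z) ^+ 2) ^+ i).

Let kr (B : set R) (r : R) := \int[Q]_z (\1_B (Yf (r, z)) : R).

Let bind (B : set R) : measurable B -> bounded_measurable (\1_B : R -> R).
Proof. by move=> mB; exact: bmeas_indic. Qed.

Let bkr B : measurable B -> bounded_measurable (kr B).
Proof.
move=> mB; apply: (bmeas_E1 (normal_prob 0 1) Q (f := fun z => \1_B (Yf z))).
by apply: (bmeas_comp mYf); exact: bind.
Qed.

Let kr01 B r : measurable B -> 0 <= kr B r <= 1.
Proof.
move=> mB.
have b : bounded_measurable (fun z => \1_B (Yf (r, z)) : R).
  apply: (bmeas_comp (h := fun z => Yf (r, z))); last exact: bind.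
  exact: (measurableT_comp mYf (pair1_measurable r)).
rewrite Rintegral_ge0/=; last by move=> z _; rewrite indicE.
rewrite -[leRHS](Ecst Q 1); apply: Ele => //; first exact: bmeas_cst.
Qed.

(** Under the weight h(Z), the pair (Y, Z) and the pair (Yf(Z, .), Z) on the product space have
    equal Gaussian transforms, hence equal laws. Almost sure nonnegativity removes the absolute
    values. *)
Let weighted_step A B : measurable A -> measurable B ->
  \int[P]_w (h (Z w) * \1_B (Y w) * \1_A (Z w)) =
  \int[P]_w (h (Z w) * kr B (Z w) * \1_A (Z w)).
Proof.
move=> mA mB.
have bhZ : bounded_measurable (fun w => h (Z w)) by exact: bmeas_comp bh.
have mYZ : measurable_fun setT (fun z : Omega * T => Yf (Z z.1, z.2)).
  apply: (measurableT_comp mYf); apply/measurable_fun_pair => //.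
  exact: (measurableT_comp mZ).
have mZ1 : measurable_fun setT (fun z : Omega * T => Z z.1).
  exact: (measurableT_comp mZ).
have mnY : measurable_fun setT (fun w => `|Y w|) by exact: measurableT_comp.
have mnZ : measurable_fun setT (fun w => `|Z w|) by exact: measurableT_comp.
have mnZ1 : measurable_fun setT (fun z : Omega * T => `|Z z.1|).
  exact: measurableT_comp.
have bYZ i j : bounded_measurable (fun z : Omega * T => h (Z z.1) *
    (expR (- Yf (Z z.1, z.2) ^+ 2) ^+ i * expR (- Z z.1 ^+ 2) ^+ j)).
  apply: bmeasM; first exact: (bmeas_comp mZ1 bh).
  by apply: bmeasM; [exact: (bmeas_gauss i mYZ)|exact: (bmeas_gauss j mZ1)].
have lap' i j : \int[P]_w (h (Z w) * (expR (- Y w ^+ 2) ^+ i * expR (- Z w ^+ 2) ^+ j)) =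
    \int[(P \x Q)%E]_z (h (Z z.1) *
    (expR (- Yf (Z z.1, z.2) ^+ 2) ^+ i * expR (- Z z.1 ^+ 2) ^+ j)).
  rewrite (E_fubini1 P Q (bYZ i j)) lap; apply: eq_Rintegral => w _ /=.
  rewrite -EZ.
    by apply: eq_Rintegral => z _; ring.
  apply: bmeas_gauss; exact: (measurableT_comp mYf (pair1_measurable (Z w))).
have bhZ1 : bounded_measurable (fun z : Omega * T => h (Z z.1)).
  exact: (bmeas_comp mZ1 bh).
have e := laplace_unique_E mY mZ bhZ (fun w => h0 (Z w)) mYZ mZ1 bhZ1
  (fun z => h0 (Z z.1)) lap' mB mA.
have bA : bounded_measurable (\1_A : R -> R) by exact: bind.
have bB : bounded_measurable (\1_B : R -> R) by exact: bind.
have m (f g : R -> R) : bounded_measurable f -> bounded_measurable g ->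
    measurable_fun setT (fun w => h (Z w) * f (Y w) * g (Z w)).
  move=> bf bg; suff [] : bounded_measurable (fun w => h (Z w) * f (Y w) * g (Z w)) by [].
  by apply: bmeasM; [apply: bmeasM => //; exact: bmeas_comp bf|exact: bmeas_comp bg].
transitivity (\int[P]_w (h (Z w) * (\1_B `|Y w| * \1_A `|Z w|))).
  apply: Eae.
  - exact: m.
  - suff [] : bounded_measurable (fun w => h (Z w) * (\1_B `|Y w| * \1_A `|Z w|)) by [].
    by apply: bmeasM => //; apply: bmeasM; [exact: (bmeas_comp mnY)|exact: (bmeas_comp mnZ)].
  - by apply: filterS2 Y0 Z0 => w Yw Zw; rewrite !ger0_norm// mulrA.
have bYf : bounded_measurable (fun z : Omega * T =>
    h (Z z.1) * (\1_B `|Yf (Z z.1, z.2)| * \1_A `|Z z.1|)).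
  apply: bmeasM => //; apply: bmeasM; last exact: (bmeas_comp mnZ1).
  apply: (bmeas_comp (h := fun z : Omega * T => `|Yf (Z z.1, z.2)|) _ bB).
  exact: (measurableT_comp _ mYZ).
rewrite e (E_fubini1 P Q bYf).
apply: Eae.
- have [] // := bmeas_E1 P Q bYf.
- suff [] : bounded_measurable (fun w => h (Z w) * kr B (Z w) * \1_A (Z w)) by [].
  apply: bmeasM; last exact: (bmeas_comp mZ).
  by apply: bmeasM => //; apply: (bmeas_comp mZ); exact: bkr.
- apply: filterS Z0 => w Zw.
  rewrite (_ : _ * kr B (Z w) * _ = (h (Z w) * \1_A (Z w)) * kr B (Z w)); last by ring.
  rewrite /kr -EZ.
    by apply: eq_Rintegral => z _; rewrite /= !ger0_norm//; ring.
  apply: (bmeas_comp (h := fun z => Yf (Z w, z)) _ bB).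
  exact: (measurableT_comp mYf (pair1_measurable (Z w))).
Qed.

(** The weight h(Z) is almost surely positive but may have no positive lower bound, so 1/h is
    approached by the bounded functions [c n] of h. The product h c_n(h) lies in [0, 1] and tends to
    1 where h > 0. *)
Let unweighted_step A B : measurable A -> measurable B ->
  \int[P]_w (\1_B (Y w) * \1_A (Z w)) = \int[P]_w (kr B (Z w) * \1_A (Z w)).
Proof.
move=> mA mB.
have bhZ : bounded_measurable (fun w => h (Z w)) by exact: bmeas_comp bh.
have bA : bounded_measurable (\1_A : R -> R) by exact: bind.
have bBY : bounded_measurable (fun w => \1_B (Y w) : R).
  by apply: (bmeas_comp mY); exact: bind.
have bAZ : bounded_measurable (fun w => \1_A (Z w) : R) by exact: (bmeas_comp mZ).
have bkZ : bounded_measurable (fun w => kr B (Z w)).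
  by apply: (bmeas_comp mZ); exact: bkr.
have ind01 (C : set R) x : 0 <= (\1_C x : R) <= 1.
  by rewrite indicE ler0n lern1 leq_b1.
pose c (n : nat) (y : R) := n.+1%:R / (1 + n.+1%:R * `|y|).
have den n (y : R) : 1 <= 1 + n.+1%:R * `|y| by rewrite lerDl mulr_ge0.
have den0 n (y : R) : 0 < 1 + n.+1%:R * `|y| by exact: lt_le_trans (den n y).
have mc n : measurable_fun setT (c n).
  apply: continuous_measurable_fun => y; apply: cvgM; first exact: cvg_cst.
  apply: cvgV; first by rewrite gt_eqF.
  by apply: cvgD; [exact: cvg_cst|apply: cvgMr; exact: norm_continuous].
pose g (n : nat) x : R := c n (h x) * \1_A x.
have c0 n y : 0 <= c n y by rewrite divr_ge0// ltW.
have cn n y : c n y <= n.+1%:R by rewrite ler_pdivrMr// -[leLHS]mulr1 ler_wpM2l.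
have g0 n x : 0 <= g n x by have /andP[i0 _] := ind01 A x; rewrite mulr_ge0.
have mg n : measurable_fun setT (g n).
  apply: measurable_funM; last by case: bA.
  by apply: (measurableT_comp (mc n)); case: bh.
have bg n : bounded_measurable (g n).
  apply: (@bmeas_le _ _ _ n.+1%:R) => // x; rewrite ger0_norm// /g -[leRHS]mulr1.
  by have /andP[i0 i1] := ind01 A x; rewrite ler_pM.
have hc01 n x : 0 <= h x * c n (h x) <= 1.
  rewrite mulr_ge0//= /c mulrA ler_pdivrMr// mul1r (ger0_norm (h0 x)) mulrC.
  by rewrite lerDr.
have hg01 n x : 0 <= h x * g n x <= 1.
  have /andP[i0 i1] := ind01 A x; have /andP[j0 j1] := hc01 n x.
  by rewrite /g mulrA mulr_ge0//= mulr_ile1.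
have hgc x : 0 < h x -> h x * g n x @[n --> \oo] --> (\1_A x : R).
  move=> hx; rewrite -[X in _ --> X]mul1r /g.
  under eq_fun do rewrite mulrA.
  apply: cvgMl; apply: (@near_oo_cvg0 _ _ _ (h x)^-1) => n.
  have nh : 0 < n.+1%:R * h x by rewrite mulr_gt0.
  have d0 : 0 < 1 + n.+1%:R * h x by rewrite addr_gt0.
  have -> : h x * c n (h x) - 1 = - (1 + n.+1%:R * h x)^-1.
    rewrite /c (ger0_norm (h0 x)) mulrA -[X in _ - X](divff (lt0r_neq0 d0)) -mulrBl.
    by rewrite -[RHS]mulN1r; congr (_ * _); ring.
  rewrite normrN ger0_norm ?invr_ge0 ?(ltW d0)// -invfM lef_pV2 ?posrE//.
    by rewrite mulrC lerDr.
  by rewrite mulr_gt0.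
have step n : \int[P]_w (h (Z w) * \1_B (Y w) * g n (Z w)) =
    \int[P]_w (h (Z w) * kr B (Z w) * g n (Z w)).
  apply: E_weight_eq => //.
  - exact: bmeasM.
  - exact: bmeasM.
  - by move=> w; have /andP[i0 _] := ind01 B (Y w); rewrite mulr_ge0.
  - by move=> w; have /andP[i0 _] := kr01 (Z w) mB; rewrite mulr_ge0.
  - by move=> C mC; exact: weighted_step.
have lim (f : Omega -> R) : bounded_measurable f -> (forall w, 0 <= f w <= 1) ->
    \int[P]_w (h (Z w) * f w * g n (Z w)) @[n --> \oo] -->
    \int[P]_w (f w * \1_A (Z w)).
  move=> bf f01.
  pose L w := f w * (if 0 < h (Z w) then \1_A (Z w) else 0 : R).
  have Fc w : h (Z w) * f w * g n (Z w) @[n --> \oo] --> L w.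
    rewrite (_ : (fun n => _) = fun n => f w * (h (Z w) * g n (Z w))); last first.
      by apply/funext => n; ring.
    apply: cvgMr; case: ifPn => [|]; first exact: hgc.
    rewrite -leNgt => hx; have hx0 : h (Z w) = 0 by apply/eqP; rewrite eq_le hx h0.
    rewrite (_ : (fun n => _) = fun=> 0); first exact: cvg_cst.
    by apply/funext => n; rewrite hx0 mul0r.
  have mF n : measurable_fun setT (fun w => h (Z w) * f w * g n (Z w)).
    suff [] : bounded_measurable (fun w => h (Z w) * f w * g n (Z w)) by [].
    by apply: bmeasM; [exact: bmeasM|exact: (bmeas_comp mZ)].
  have -> : \int[P]_w (f w * \1_A (Z w)) = \int[P]_w L w.
    apply: Eae.
    - by have [] : bounded_measurable (fun w => f w * \1_A (Z w)) by exact: bmeasM.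
    - by apply: (measurable_fun_cvg mF) => w _; exact: Fc.
    - by apply: filterS hZ => w hw; rewrite /L hw.
  apply: (E_dct (M := 1)) => // n w.
  have /andP[f0 f1] := f01 w; have /andP[k0 k1] := hg01 n (Z w).
  rewrite (_ : h (Z w) * f w * g n (Z w) = f w * (h (Z w) * g n (Z w))); last by ring.
  by rewrite ger0_norm ?mulr_ge0// mulr_ile1.
have c1 := lim _ bBY (fun w => ind01 B (Y w)).
have c2 := lim _ bkZ (fun w => kr01 (Z w) mB).
apply: (cvg_unique _ c1); first exact: norm_hausdorff.
by rewrite (_ : (fun n => _) = (fun n => \int[P]_w (h (Z w) * kr B (Z w) * g n (Z w))));
  last by apply/funext => n; exact: step.
Qed.

Lemma conditional_law_from_laplace (k : R.-pker R ~> R) :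
  (forall r C, k r C = Q ((fun z => Yf (r, z)) @^-1` C)) ->
  conditional_law P Y Z k.
Proof.
move=> kE; split => // A B mA mB.
have mZA : measurable (Z @^-1` A) by exact: measurable_preimageT.
have mYB : measurable (Y @^-1` B) by exact: measurable_preimageT.
have mE : measurable (Z @^-1` A `&` Y @^-1` B) by exact: measurableI.
have mYr r : measurable ((fun z => Yf (r, z)) @^-1` B).
  apply: measurable_preimageT => //.
  exact: (measurableT_comp mYf (pair1_measurable r)).
have krE r : (kr B r)%:E = k r B.
  rewrite kE /kr EFinE; last exact: (bmeas_indic (mYr r)).
  by rewrite (integral_indic Q measurableT (mYr r)) setIT.
have e := congr1 EFin (unweighted_step mA mB).
have bAZ : bounded_measurable (fun w => \1_A (Z w) : R) by exact: (bmeas_indic mZA).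
rewrite !EFinE in e; last 2 first.
- by apply: bmeasM => //; apply: (bmeas_comp mZ); exact: bkr.
- by apply: bmeasM => //; exact: (bmeas_indic mYB).
transitivity (\int[P]_w (\1_B (Y w) * \1_A (Z w))%:E)%E.
  transitivity (\int[P]_w (\1_(Z @^-1` A `&` Y @^-1` B) w)%:E)%E.
    by rewrite integral_indic// setIT.
  apply: eq_integral => w _; rewrite !indicE in_setI -natrM mulnb andbC.
  by [].
rewrite e [RHS]integral_mkcond; apply: eq_integral => w _.
rewrite patchE -krE indicE (_ : (w \in Z @^-1` A) = (Z w \in A))//.
by case: ifP => _; rewrite ?mulr1 ?mulr0.
Qed.

End from_laplace.

End conditional.

(** * Densities *)

Section density_from_laplace.
Context {R : realType} {d} {Omega : measurableType d}.
Variables (P : probability Omega R) (Y : Omega -> R) (g : R -> R) (M : R).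
Hypotheses (mY : measurable_fun setT Y) (Y0 : {ae P, forall w, 0 <= Y w})
  (mg : measurable_fun setT g) (g0 : forall y, 0 <= g y) (gM : forall y, g y <= M)
  (gneg : forall y, y < 0 -> g y = 0).
Hypothesis lap : forall n : nat,
  (\int[P]_w expR (- Y w ^+ 2) ^+ n.+1)%:E =
  (\int[lebesgue_measure]_y (g y * expR (- y ^+ 2) ^+ n.+1)%:E)%E.

Local Notation base := (normal_prob (0:R) 1).
Let pdf : R -> R := normal_pdf 0 1.

Let pdfE y : pdf y = (Num.sqrt (2 * pi))^-1 * expR (- (y ^+ 2 / 2)).
Proof.
rewrite /pdf normal_pdfE ?oner_neq0// /normal_peak /normal_fun subr0 expr1n mul1r.
by rewrite mulr_natl mulNr.
Qed.

(* g(y) e^(-y^2) relative to the standard normal density. *)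
Let weight (y : R) : R := Num.sqrt (2 * pi) * g y * expR (- (y ^+ 2 / 2)).

Let weightE y : weight y * pdf y = g y * expR (- y ^+ 2).
Proof.
have s0 : Num.sqrt (2 * pi) != 0 :> R by rewrite gt_eqF// sqrtr_gt0 mulr_gt0// pi_gt0.
rewrite pdfE /weight (_ : - y ^+ 2 = - (y ^+ 2 / 2) + - (y ^+ 2 / 2)); last by field.
by rewrite expRD; move: s0 (expR _) => + e; move: (Num.sqrt _) => s s0; field.
Qed.

Let bweight : bounded_measurable weight.
Proof.
have M0 : 0 <= M := le_trans (g0 0) (gM 0).
apply: (@bmeas_le _ _ _ (Num.sqrt (2 * pi) * M)).
  apply: measurable_funM; first by apply: measurable_funM.
  apply: measurableT_comp => //; apply: measurableT_comp => //.
  by apply: measurable_funM => //; apply: measurable_funX.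
move=> y; rewrite ger0_norm ?mulr_ge0 ?sqrtr_ge0 ?expR_ge0//.
rewrite /weight -[leRHS]mulr1 ler_pM ?mulr_ge0 ?sqrtr_ge0 ?expR_ge0//.
  by rewrite ler_wpM2l ?sqrtr_ge0.
by rewrite -expR0 ler_expR oppr_le0 divr_ge0// sqr_ge0.
Qed.

Let weight0 y : 0 <= weight y.
Proof. by rewrite !mulr_ge0 ?sqrtr_ge0 ?expR_ge0. Qed.

Let mpdf : measurable_fun setT pdf. Proof. exact: measurable_normal_pdf. Qed.
Let pdf0 y : 0 <= pdf y. Proof. exact: normal_pdf_ge0. Qed.

Let base_integral (f : R -> \bar R) : measurable_fun setT f -> (forall y, (0 <= f y)%E) ->
  (\int[base]_y f y = \int[lebesgue_measure]_y (f y * (pdf y)%:E))%E.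
Proof.
by move=> mf f0; apply: (@ge0_integral_density _ _ _ lebesgue_measure base pdf).
Qed.

(** The uniqueness result compares probabilities with bounded weights, so g(y) e^(-y^2) dy is
    written as a weight on the standard normal law. The factor e^(-y^2) uses up one power, which is
    why the transforms are given for exponents n.+1. *)
Let weighted_law A : measurable A ->
  \int[P]_w (expR (- Y w ^+ 2) * \1_A (Y w)) = \int[base]_y (weight y * \1_A y).
Proof.
move=> mA.
have bA : bounded_measurable (\1_A : R -> R) by exact: bmeas_indic.
have bgY : bounded_measurable (fun w => expR (- Y w ^+ 2)).
  by have := bmeas_gauss 1 mY; under eq_fun do rewrite expr1.
have mnY : measurable_fun setT (fun w => `|Y w|) by exact: measurableT_comp.
have mn : measurable_fun setT (fun y : R => `|y|) by exact: measurableT_comp.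
have e := @laplace_unique_E R _ _ _ _ P Y Y (fun w => expR (- Y w ^+ 2)) base id id weight
  A setT mY mY bgY (fun w => expR_ge0 _) (@measurable_id _ _ _) (@measurable_id _ _ _)
  bweight weight0 _ mA measurableT.
transitivity (\int[P]_w (expR (- Y w ^+ 2) * (\1_A `|Y w| * \1_setT `|Y w|))).
  apply: Eae.
  - by have [] : bounded_measurable (fun w => expR (- Y w ^+ 2) * \1_A (Y w))
      by apply: bmeasM => //; exact: (bmeas_comp mY).
  - suff [] : bounded_measurable
        (fun w => expR (- Y w ^+ 2) * (\1_A `|Y w| * \1_setT `|Y w|)) by [].
    by apply: bmeasM => //; apply: bmeasM; apply: (bmeas_comp mnY) => //; exact: bmeas_indic.
  - by apply: filterS Y0 => w Yw; rewrite ger0_norm// indicT mulr1.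
rewrite {}e.
  apply: eq_Rintegral => y _; rewrite indicT mulr1.
  have [y0|y0] := leP 0 y; first by rewrite ger0_norm.
  by rewrite /weight gneg// mulr0 !mul0r.
move=> i j; apply: EFin_inj.
have -> : \int[P]_w (expR (- Y w ^+ 2) * (expR (- Y w ^+ 2) ^+ i * expR (- Y w ^+ 2) ^+ j))
    = \int[P]_w expR (- Y w ^+ 2) ^+ (i + j).+1.
  by apply: eq_Rintegral => w _; rewrite -exprD -exprS.
rewrite lap EFinE; last first.
  by apply: bmeasM => //; apply: bmeasM; exact: (bmeas_gauss _ (@measurable_id _ _ _)).
rewrite base_integral.
- apply: eq_integral => y _; rewrite -EFinM; congr EFin.
  by rewrite mulrAC weightE -mulrA -exprD -exprS.
- apply/measurable_EFinP; apply: measurable_funM; first by case: bweight.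
  by apply: measurable_funM; apply: measurable_funX; exact: measurable_gauss.
- by move=> y; rewrite lee_fin mulr_ge0// mulr_ge0// exprn_ge0// expR_ge0.
Qed.

(** The weight e^(-y^2) is undone by integrating e^(y^2) over A against both weighted laws. This
    integrand is unbounded, so the computation uses integrals of nonnegative functions. *)
Lemma density_from_laplace A : measurable A ->
  P (Y @^-1` A) = (\int[lebesgue_measure]_(y in A) (g y)%:E)%E.
Proof.
move=> mA.
have bgY : bounded_measurable (fun w => expR (- Y w ^+ 2)).
  by have := bmeas_gauss 1 mY; under eq_fun do rewrite expr1.
have pgY w : 0 <= expR (- Y w ^+ 2) by exact: expR_ge0.
pose m1 := pushforward (weighted P bgY pgY) Y.
have mid : measurable_fun setT (id : measurableTypeR R -> R) by exact: measurable_id.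
pose m2 := pushforward (weighted base bweight weight0) (id : measurableTypeR R -> R).
have mYA : measurable (Y @^-1` A) by exact: measurable_preimageT.
pose F y : \bar R := (expR (y ^+ 2) * \1_A y)%:E.
have mF : measurable_fun setT F.
  apply/measurable_EFinP; apply: measurable_funM; last exact: measurable_indic.
  by apply: measurableT_comp => //; exact: measurable_funX.
have F0 y : (0 <= F y)%E by rewrite lee_fin mulr_ge0 ?expR_ge0// indicE.
have FE y : expR (y ^+ 2) * \1_A y * expR (- y ^+ 2) = \1_A y :> R.
  by rewrite mulrAC -expRD subrr expR0 mul1r.
have i1 : (\int[m1]_y F y = P (Y @^-1` A))%E.
  rewrite ge0_integral_pushforward ?preimage_setT//.
  rewrite (@ge0_integral_density _ _ _ P (weighted P bgY pgY) (fun w => expR (- Y w ^+ 2)))//=.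
  - have <- : (\int[P]_w (\1_(Y @^-1` A) w)%:E = P (Y @^-1` A))%E.
      by rewrite integral_indic// setIT.
    by apply: eq_integral => w _; rewrite /F -EFinM FE.
  - by have [] := bgY.
  - exact: measurableT_comp.
have i2 : (\int[m2]_y F y = \int[lebesgue_measure]_(y in A) (g y)%:E)%E.
  rewrite ge0_integral_pushforward ?preimage_setT//.
  rewrite (@ge0_integral_density _ _ _ base (weighted base bweight weight0) weight)//;
    last by case: bweight.
  rewrite base_integral.
  - rewrite [RHS]integral_mkcond; apply: eq_integral => y _.
    rewrite -!EFinM -mulrA weightE (mulrCA _ (g y)) FE patchE indicE.
    by case: ifP => _; rewrite ?mulr1 ?mulr0.
  - apply: emeasurable_funM => //; apply/measurable_EFinP; by case: bweight.
  - by move=> y; rewrite mule_ge0// lee_fin.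
rewrite -i1 -i2; apply: eq_measure_integral => C mC _.
transitivity (weighted P bgY pgY (Y @^-1` C)) => //.
transitivity (weighted base bweight weight0 (id @^-1` C)) => //.
by rewrite !weighted_preimageE// weighted_law.
Qed.

End density_from_laplace.

(** * Gaussian integrals on the half-line and the two densities *)

Section triangle.
Context {R : realType}.
Local Notation mu := (@lebesgue_measure R).

(** Both sides integrate a(y) b(z) over the wedge 0 <= y <= z. It plays the role of integration by
    parts in the density computations. *)
Lemma triangle_tonelli (a b : R -> R) :
  measurable_fun setT a -> measurable_fun setT b ->
  (forall x, 0 <= x -> 0 <= a x) -> (forall x, 0 <= x -> 0 <= b x) ->
  (\int[mu]_(y in `[(0%R:R), +oo[) ((a y)%:E * \int[mu]_(z in `[(y:R), +oo[) (b z)%:E) =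
   \int[mu]_(z in `[(0%R:R), +oo[) ((b z)%:E * \int[mu]_(y in `[(0%R:R), z]) (a y)%:E))%E.
Proof.
move=> ma mb a0 b0.
pose D : set (R * R) := [set z | 0 <= z.1 /\ z.1 <= z.2].
have mD : measurable D.
  rewrite (_ : D = fst @^-1` `[(0:R), +oo[ `&` (fun z => z.2 - z.1) @^-1` `[(0:R), +oo[).
    apply: measurableI; apply: measurable_preimageT => //.
    exact: measurable_funB.
  by apply/seteqP; split => z; rewrite /D /= !in_itv/= !andbT subr_ge0.
pose F (z : R * R) : \bar R := (a z.1 * b z.2 * \1_D z)%:E.
have mF : measurable_fun setT F.
  apply/measurable_EFinP; apply: measurable_funM; last exact: measurable_indic.
  by apply: measurable_funM; exact: measurableT_comp.
have F0 z : (0 <= F z)%E.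
  rewrite /F indicE; case: (boolP (z \in D)) => zD; last by rewrite mulr0.
  move/set_mem : zD => [z1 z12]; rewrite mulr1 lee_fin mulr_ge0 ?a0 ?b0//.
  exact: le_trans z12.
have := fubini_tonelli (m1 := mu) (m2 := mu) F mF F0.
rewrite [X in X = _ -> _](_ : _ = (\int[mu]_(y in `[(0%R:R), +oo[) ((a y)%:E * \int[mu]_(z in `[(y:R), +oo[) (b z)%:E))%E);
  last first.
  rewrite [RHS]integral_mkcond; apply: eq_integral => y _; rewrite patchE mem_setE in_itv/= andbT.
  case: ifPn => [y0|y0]; last first.
    rewrite integral0_eq// => z _; rewrite /F indicE memNset ?mulr0//= => -[].
    by rewrite (negbTE y0).
  rewrite -ge0_integralZl//.
  - rewrite [RHS]integral_mkcond; apply: eq_integral => z _.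
    rewrite patchE mem_setE in_itv/= andbT /F indicE.
    case: ifPn => yz; first by rewrite mem_set ?mulr1 ?EFinM.
    by rewrite memNset ?mulr0//= => -[_]; rewrite (negbTE yz).
  - exact/measurable_EFinP/measurable_funTS.
  - by move=> z; rewrite /= in_itv/= andbT => yz; rewrite lee_fin b0// (le_trans y0).
  - by rewrite lee_fin a0.
move=> ->; rewrite [RHS]integral_mkcond; apply: eq_integral => z _.
rewrite patchE mem_setE in_itv/= andbT.
case: ifPn => [z0|z0]; last first.
  rewrite integral0_eq// => y _; rewrite /F indicE memNset ?mulr0//= => -[y0 yz].
  by move/negP : z0; apply; exact: le_trans yz.
rewrite -ge0_integralZl//.
- rewrite [RHS]integral_mkcond; apply: eq_integral => y _.
  rewrite patchE mem_setE in_itv/= /F indicE.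
  case: ifPn => [/andP[y0 yz]|yz].
    by rewrite mem_set// mulr1 mulrC EFinM.
  by rewrite memNset ?mulr0//= => -[y0 yz']; move: yz; rewrite y0 yz'.
- exact/measurable_EFinP/measurable_funTS.
- by move=> y; rewrite /= in_itv/= => /andP[y0 _]; rewrite lee_fin a0.
- by rewrite lee_fin b0.
Qed.

End triangle.

Section half_gaussian.
Context {R : realType}.
Local Notation mu := (@lebesgue_measure R).
Implicit Types l y z : R.

Lemma measurable_gauss_rate l : measurable_fun setT (fun z : R => expR (- (l * z ^+ 2))).
Proof. by apply: continuous_measurable_fun; exact: continuous_gauss. Qed.

Lemma gauss_rate_cvg0 l : 0 < l -> expR (- (l * z ^+ 2)) @[z --> +oo] --> (0 : R).
Proof.
move=> l0; apply: (@cvg_comp _ _ _ (fun z => l * z ^+ 2) (fun x => expR (- x)) _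
  (pinfty_nbhs R)); last exact: cvgr_expR.
by apply: gt0_cvgMry => //; exact: cvgr_expr2.
Qed.

Lemma integral_half_gauss l : 0 < l ->
  (\int[mu]_(z in `[(0%R : R), +oo[) (expR (- (l * z ^+ 2)))%:E =
   (2^-1 * Num.sqrt (pi / l))%:E)%E.
Proof.
move=> l0; have pi0 := pi_gt0 R.
pose s := Num.sqrt (2 * l)^-1.
have s2 : s ^+ 2 = (2 * l)^-1 by rewrite sqr_sqrtr// invr_ge0 mulr_ge0// ltW.
have s0 : s != 0 by rewrite gt_eqF// sqrtr_gt0 invr_gt0 mulr_gt0.
have pdfE z : normal_pdf 0 s z = (Num.sqrt (pi / l))^-1 * expR (- (l * z ^+ 2)).
  rewrite normal_pdfE// /normal_peak /normal_fun subr0 s2 !mulr2n.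
  by congr ((Num.sqrt _)^-1 * expR _); field; rewrite gt_eqF.
have q0 : 0 < Num.sqrt (pi / l) by rewrite sqrtr_gt0 divr_gt0.
have h : (\int[mu]_z (expR (- (l * z ^+ 2)))%:E = (Num.sqrt (pi / l))%:E)%E.
  transitivity (\int[mu]_z ((Num.sqrt (pi / l))%:E * (normal_pdf 0 s z)%:E))%E.
    by apply: eq_integral => z _; rewrite pdfE -EFinM mulVKf// gt_eqF.
  rewrite ge0_integralZl_EFin//.
  - by rewrite integral_normal_pdf mule1.
  - by move=> z _; rewrite lee_fin normal_pdf_ge0.
  - by apply/measurable_EFinP; exact: measurable_normal_pdf.
have := ge0_symfun_integralT (f := fun z => expR (- (l * z ^+ 2))) (fun z => expR_ge0 _)
  (@continuous_gauss R l) (fun z => congr1 (fun x => expR (- (l * x))) (esym (sqrrN z))).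
rewrite h (_ : [set x | _] = `[(0:R), +oo[%classic); last first.
  by apply/seteqP; split => x /=; rewrite in_itv/= andbT.
move=> e; rewrite EFinM e muleA -EFinM mulVf// mul1e//.
Qed.

Lemma is_derive_gauss0 l z :
  is_derive z (1 : R) (fun z => expR (- (l * z ^+ 2))) (- (2 * l * (z * expR (- (l * z ^+ 2))))).
Proof.
have := is_derive_gauss l 0 z; rewrite addr0.
by rewrite (_ : (fun x => _) = (fun z => expR (- (l * z ^+ 2))))//;
  apply/funext => x; rewrite addr0.
Qed.

Lemma integral_tail_gauss1 l y : 0 < l -> 0 <= y ->
  (\int[mu]_(z in `[y, +oo[) (z * expR (- (l * z ^+ 2)))%:E =
   ((2 * l)^-1 * expR (- (l * y ^+ 2)))%:E)%E.
Proof.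
move=> l0 y0.
pose F z : R := - (2 * l)^-1 * expR (- (l * z ^+ 2)).
have dF z : is_derive z (1 : R) F (z * expR (- (l * z ^+ 2))).
  have h := is_derive_gauss0 l z; rewrite /F.
  by apply: is_derive_eq; rewrite /GRing.scale/=; field; rewrite gt_eqF.
have cF : continuous F.
  by move=> z; apply: differentiable_continuous; apply/derivable1_diffP; apply: ex_derive.
have cf : continuous (fun z => z * expR (- (l * z ^+ 2))).
  by move=> z; apply: cvgM; [exact: cvg_id|exact: continuous_gauss].
rewrite (@ge0_continuous_FTC2y _ _ F y 0).
- by rewrite /F sub0e -EFinN mulNr opprK.
- by move=> z yz; rewrite mulr_ge0 ?expR_ge0// (le_trans y0).
- exact: continuous_subspaceT.
- rewrite -[X in _ --> X](mulr0 (- (2 * l)^-1)); apply: cvgMr; exact: gauss_rate_cvg0.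
- by move=> z _; apply: ex_derive.
- exact: cvg_at_right_filter (cF y).
- by move=> z _; rewrite derive1E derive_val.
Qed.

Lemma integral_head_gauss1 l z : 0 < l -> 0 <= z ->
  (\int[mu]_(y in `[(0%R : R), z]) (2 * y * expR (- (l * y ^+ 2)))%:E =
   ((1 - expR (- (l * z ^+ 2))) / l)%:E)%E.
Proof.
move=> l0; rewrite le_eqVlt => /predU1P[<-|z0].
  by rewrite set_itv1 integral_set1 expr0n mulr0 oppr0 expR0 subrr mul0r.
pose F z : R := - l^-1 * expR (- (l * z ^+ 2)).
have dF y : is_derive y (1 : R) F (2 * y * expR (- (l * y ^+ 2))).
  have h := is_derive_gauss0 l y; rewrite /F.
  by apply: is_derive_eq; rewrite /GRing.scale/=; field; rewrite gt_eqF.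
have cF : continuous F.
  by move=> y; apply: differentiable_continuous; apply/derivable1_diffP; apply: ex_derive.
have cf : continuous (fun y => 2 * y * expR (- (l * y ^+ 2))).
  by move=> y; apply: cvgM; [apply: cvgMr; exact: cvg_id|exact: continuous_gauss].
rewrite (@continuous_FTC2 _ _ F).
- rewrite -EFinB /F expr0n mulr0 oppr0 expR0; congr EFin; field; by rewrite gt_eqF.
- by [].
- exact: continuous_subspaceT.
- split.
  + by move=> y _; apply: ex_derive.
  + exact: cvg_at_right_filter (cF 0).
  + exact: cvg_at_left_filter (cF z).
- by move=> y _; rewrite derive1E derive_val.
Qed.

End half_gaussian.

Section densities.
Context {R : realType}.
Local Notation mu := (@lebesgue_measure R).
Local Notation halfline := (`[(0 : R), +oo[%classic).
Implicit Types l y z : R.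

(** One factor z is the length of [0, z]. Exchanging the integrals leaves the tail integral of z
    e^(-l z^2), which is explicit, and then a Gaussian integral. *)
Lemma integral_sq_gauss l : 0 < l ->
  (\int[mu]_(z in halfline) (z ^+ 2 * expR (- (l * z ^+ 2)))%:E =
   ((2 * l)^-1 * (2^-1 * Num.sqrt (pi / l)))%:E)%E.
Proof.
move=> l0; have l20 : 0 <= (2 * l)^-1 by rewrite invr_ge0 mulr_ge0// ltW.
have mb : measurable_fun setT (fun z => z * expR (- (l * z ^+ 2))).
  by apply: measurable_funM => //; exact: measurable_gauss_rate.
have := @triangle_tonelli R (fun=> 1) (fun z => z * expR (- (l * z ^+ 2)))
  (measurable_cst _) mb (fun _ _ => ler01) (fun z hz => mulr_ge0 hz (expR_ge0 _)).
rewrite [X in X = _ -> _](_ : _ = ((2 * l)^-1 * (2^-1 * Num.sqrt (pi / l)))%:E); last first.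
  transitivity (\int[mu]_(y in halfline) ((2 * l)^-1%:E * (expR (- (l * y ^+ 2)))%:E))%E.
    apply: eq_integral => y; rewrite inE/= in_itv/= andbT => y0.
    by rewrite mul1e integral_tail_gauss1// EFinM.
  rewrite ge0_integralZl_EFin//.
  - by rewrite integral_half_gauss// EFinM.
  - by apply/measurable_EFinP/measurable_funTS; exact: measurable_gauss_rate.
move=> ->; apply: eq_integral => z; rewrite inE/= in_itv/= andbT => z0.
rewrite integral_cst//= lebesgue_measure_itv/= lte_fin.
case: ltP => [_|zle0].
  by rewrite -EFinB subr0 mul1e -EFinM; congr EFin; ring.
by rewrite mule0 mule0 (_ : z = 0) ?expr0n ?mul0r//; apply/eqP; rewrite eq_le zle0.
Qed.

Lemma gauss_natE n y : expR (- y ^+ 2) ^+ n = expR (- (n%:R * y ^+ 2)).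
Proof. by rewrite -expRM_natl mulrN. Qed.

Definition bessel_density y : R :=
  if 0 <= y then Num.sqrt (2 / pi) * y ^+ 2 * expR (- y ^+ 2 / 2) else 0.

Lemma half_gaussE y : expR (- y ^+ 2 / 2) = expR (- (2^-1 * y ^+ 2)).
Proof. by rewrite mulNr mulrC. Qed.

Lemma measurable_restrict_ge0 (f : R -> R) : measurable_fun setT f ->
  measurable_fun setT (fun y => if 0 <= y then f y else 0).
Proof.
move=> mf; rewrite (_ : (fun y => _) = fun y => f y * \1_halfline y).
  by apply: measurable_funM => //; exact: measurable_indic.
by apply/funext => y; rewrite indicE mem_setE in_itv/= andbT; case: ifP; rewrite ?mulr1 ?mulr0.
Qed.

Lemma measurable_bessel_density : measurable_fun setT bessel_density.
Proof.
apply: (measurable_restrict_ge0 (f := fun y => Num.sqrt (2 / pi) * y ^+ 2 * expR (- y ^+ 2 / 2))).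
under eq_fun do rewrite half_gaussE.
apply: measurable_funM; last exact: measurable_gauss_rate.
by apply: measurable_funM => //; exact: measurable_funX.
Qed.

Lemma bessel_density_ge0 y : 0 <= bessel_density y.
Proof.
by rewrite /bessel_density; case: ifP => // y0; rewrite !mulr_ge0 ?sqrtr_ge0 ?expR_ge0.
Qed.

Lemma bessel_density_le y : bessel_density y <= Num.sqrt (2 / pi) * 2.
Proof.
rewrite /bessel_density; case: ifP => _; last by rewrite mulr_ge0 ?sqrtr_ge0.
rewrite half_gaussE -mulrA ler_wpM2l ?sqrtr_ge0// expRN ler_pdivrMr ?expR_gt0//.
have : 1 + 2^-1 * y ^+ 2 <= expR (2^-1 * y ^+ 2) by exact: expR_ge1Dx.
by move: (expR _) => e h; lra.
Qed.

Lemma sqrt_const (l : R) : 0 < l ->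
  Num.sqrt (2 / pi) * (2^-1 * Num.sqrt (pi / l)) = (Num.sqrt (2 * l))^-1.
Proof.
move=> l0; have pi0 := pi_gt0 R.
rewrite mulrCA -sqrtrM ?divr_ge0 ?(ltW pi0)//.
have cancel (p : R) : p != 0 -> 2 / p * (p / l) = 2 ^+ 2 * (2 * l)^-1.
  by move=> p0; field; rewrite p0 gt_eqF.
rewrite cancel ?gt_eqF//.
rewrite sqrtrM ?sqr_ge0// sqrtr_sqr ger0_norm// mulrA mulVf// mul1r.
by rewrite sqrtrV// mulr_ge0// ltW.
Qed.

Lemma bessel_density_gauss (m : R) : 0 <= m ->
  (\int[mu]_y (bessel_density y * expR (- (m * y ^+ 2)))%:E =
   ((1 + 2 * m)^-1 * (Num.sqrt (1 + 2 * m))^-1)%:E)%E.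
Proof.
move=> m0; pose l : R := 2^-1 + m.
have l0 : 0 < l by rewrite ltr_pwDl.
have D : 1 + 2 * m = 2 * l :> R by rewrite /l; field.
rewrite D -sqrt_const// mulrCA EFinM -integral_sq_gauss//.
rewrite -ge0_integralZl_EFin//.
- rewrite [RHS]integral_mkcond; apply: eq_integral => y _.
  rewrite patchE mem_setE in_itv/= andbT /bessel_density; case: ifP => _; last by rewrite mul0r.
  rewrite half_gaussE; congr EFin.
  rewrite -[LHS]mulrA -[LHS]mulrA -expRD; congr (_ * (_ * expR _)).
  by rewrite /l; ring.
- by move=> y _; rewrite lee_fin mulr_ge0 ?sqr_ge0 ?expR_ge0.
- apply/measurable_EFinP/measurable_funTS/measurable_funM; last exact: measurable_gauss_rate.
  exact: measurable_funX.
Qed.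

Definition gauss_tail y : R := \int[mu]_(z in `[y, +oo[) expR (- z ^+ 2 / 2).

Lemma gauss_tailE y : 0 <= y ->
  (gauss_tail y)%:E = (\int[mu]_(z in `[y, +oo[) (expR (- (2^-1 * z ^+ 2)))%:E)%E.
Proof.
move=> y0; rewrite /gauss_tail.
under eq_Rintegral do rewrite half_gaussE.
rewrite /Rintegral fineK// ge0_fin_numE; last by apply: integral_ge0 => z _; rewrite lee_fin expR_ge0.
have half0 : 0 < 2^-1 :> R by [].
apply: (@le_lt_trans _ _ (\int[mu]_(z in halfline) (expR (- (2^-1 * z ^+ 2)))%:E)%E);
  last by rewrite integral_half_gauss// ltry.
apply: ge0_subset_integral => //.
- by apply/measurable_EFinP/measurable_funTS; exact: measurable_gauss_rate.
- by move=> z; rewrite /= !in_itv/= !andbT => /(le_trans y0).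
Qed.

(** Up to the factor sqrt(2 pi), the tail is the normal measure of a section of the set z.1 <= z.2,
    so Fubini provides measurability. *)
Lemma measurable_gauss_tail : measurable_fun setT gauss_tail.
Proof.
pose D : set (R * R) := [set z | z.1 <= z.2].
have mD : measurable D.
  rewrite (_ : D = (fun p => p.2 - p.1) @^-1` halfline).
    by apply: measurable_preimageT => //; exact: measurable_funB.
  by apply/seteqP; split => p; rewrite /D /= in_itv/= andbT subr_ge0.
have [m _] := bmeas_E1 (normal_prob (0:R) 1) (normal_prob (0:R) 1) (bmeas_indic mD).
rewrite (_ : gauss_tail =
  fun y => Num.sqrt (2 * pi) * \int[normal_prob (0:R) 1]_z (\1_D (y, z) : R)).
  exact: measurable_funM.
have s0 : 0 < Num.sqrt (2 * pi) :> R by rewrite sqrtr_gt0 mulr_gt0// pi_gt0.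
apply/funext => y.
have mDy : measurable [set z | D (y, z)].
  by apply: (measurable_preimageT (f := fun z => (y, z)) _ mD); exact: pair1_measurable.
have -> : \int[normal_prob (0:R) 1]_z (\1_D (y, z) : R) = \int[mu]_(z in `[y, +oo[) normal_pdf 0 1 z.
  rewrite /Rintegral; congr fine.
  transitivity (\int[normal_prob (0:R) 1]_z (\1_[set z | D (y, z)] z)%:E)%E => //.
  rewrite integral_indic// setIT /normal_prob.
  by congr (integral _ _ _); apply/seteqP; split => z; rewrite /D/= in_itv/= andbT.
rewrite /gauss_tail -RintegralZl//.
  apply: eq_Rintegral => z _.
  rewrite normal_pdfE ?oner_neq0// /normal_peak /normal_fun subr0 expr1n mul1r mulrA.
  by rewrite mulr_natl divff ?gt_eqF ?mul1r// -mulr_natl.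
by apply: (integrableS measurableT) => //; exact: integrable_normal_pdf.
Qed.

Definition sampled_density y : R :=
  if 0 <= y then 2 * Num.sqrt (2 / pi) * y * gauss_tail y else 0.

Lemma measurable_sampled_density : measurable_fun setT sampled_density.
Proof.
apply: (measurable_restrict_ge0 (f := fun y => 2 * Num.sqrt (2 / pi) * y * gauss_tail y)).
apply: measurable_funM; last exact: measurable_gauss_tail.
exact: measurable_funM.
Qed.

Lemma gauss_tail_ge0 y : 0 <= gauss_tail y.
Proof. by apply: Rintegral_ge0 => z _; rewrite expR_ge0. Qed.

Lemma sampled_density_ge0 y : 0 <= sampled_density y.
Proof.
by rewrite /sampled_density; case: ifP => // y0; rewrite !mulr_ge0 ?sqrtr_ge0 ?gauss_tail_ge0.
Qed.

(** On the range of integration y <= z, and z e^(-z^2/2) has tail integral e^(-y^2/2). This gives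
    the boundedness of the density that [density_from_laplace] requires. *)
Lemma mul_gauss_tail_le1 y : 0 <= y -> y * gauss_tail y <= 1.
Proof.
move=> y0; rewrite -lee_fin EFinM gauss_tailE//.
have half0 : 0 < 2^-1 :> R by [].
have mg : measurable_fun setT (fun z : R => (expR (- (2^-1 * z ^+ 2)))%:E).
  by apply/measurable_EFinP; exact: measurable_gauss_rate.
rewrite -ge0_integralZl_EFin//; last exact: measurable_funTS.
apply: (@le_trans _ _ (\int[mu]_(z in `[y, +oo[) (z * expR (- (2^-1 * z ^+ 2)))%:E)%E).
  apply: ge0_le_integral => //.
  - by move=> z _; rewrite -EFinM lee_fin mulr_ge0 ?expR_ge0.
  - by apply: measurable_funTS; apply: emeasurable_funM.
  - apply/measurable_EFinP/measurable_funTS/measurable_funM => //.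
    exact: measurable_gauss_rate.
  - by move=> z; rewrite /= in_itv/= andbT => yz; rewrite -EFinM lee_fin ler_wpM2r ?expR_ge0.
rewrite integral_tail_gauss1// lee_fin divff// invr1 mul1r.
by rewrite -[leRHS]expR0 ler_expR oppr_le0 mulr_ge0 ?sqr_ge0.
Qed.

Lemma sampled_density_le y : sampled_density y <= 2 * Num.sqrt (2 / pi).
Proof.
rewrite /sampled_density; case: ifP => y0; last by rewrite mulr_ge0 ?sqrtr_ge0.
by rewrite -mulrA -[leRHS]mulr1 ler_wpM2l ?mul_gauss_tail_le1// mulr_ge0 ?sqrtr_ge0.
Qed.

(** Exchanging y and z leaves the integral of 2 y e^(-l y^2) over [0, z], equal to (1 - e^(-l z^2))
    / l. Two Gaussian integrals, of rates 1/2 and 1/2 + l, remain. *)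
Lemma sampled_density_gauss l : 0 < l ->
  (\int[mu]_y (sampled_density y * expR (- (l * y ^+ 2)))%:E =
   ((1 - (Num.sqrt (1 + 2 * l))^-1) / l)%:E)%E.
Proof.
move=> l0; have half0 : 0 < 2^-1 :> R by [].
have [c cE] : exists c : R, c = Num.sqrt (2 / pi) by eexists.
have c0 : 0 <= c by rewrite cE sqrtr_ge0.
pose a y : R := 2 * y * expR (- (l * y ^+ 2)).
pose b z : R := expR (- (2^-1 * z ^+ 2)).
have ma : measurable_fun setT a.
  by apply: measurable_funM; [exact: measurable_funM|exact: measurable_gauss_rate].
have mb : measurable_fun setT b by exact: measurable_gauss_rate.
have a0 y : 0 <= y -> 0 <= a y by move=> y0; rewrite !mulr_ge0 ?expR_ge0.
have b0 y : 0 <= y -> 0 <= b y by rewrite expR_ge0.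
have e0 z : 0 <= z -> 0 <= 1 - expR (- (l * z ^+ 2)).
  by move=> _; rewrite subr_ge0 -[leRHS]expR0 ler_expR oppr_le0 mulr_ge0 ?sqr_ge0 ?(ltW l0).
pose I := (\int[mu]_(z in halfline) (b z * (1 - expR (- (l * z ^+ 2))))%:E)%E.
have lhs : (\int[mu]_y (sampled_density y * expR (- (l * y ^+ 2)))%:E = (c / l)%:E * I)%E.
  transitivity (c%:E * \int[mu]_(y in halfline)
      ((a y)%:E * \int[mu]_(z in `[(y:R), +oo[) (b z)%:E))%E.
    rewrite -ge0_integralZl_EFin//.
    - rewrite [RHS]integral_mkcond; apply: eq_integral => y _.
      rewrite patchE mem_setE in_itv/= andbT /sampled_density.
      case: ifP => y0; last by rewrite mul0r.
      by rewrite -gauss_tailE// -!EFinM; congr EFin; rewrite -cE /a; ring.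
    - move=> y; rewrite /= in_itv/= andbT => y0; rewrite mule_ge0 ?lee_fin ?a0//.
      by apply: integral_ge0 => z _; rewrite lee_fin expR_ge0.
    - apply: (@eq_measurable_fun _ _ _ _ _ (fun y => (a y * gauss_tail y)%:E)).
        by move=> y; rewrite inE/= in_itv/= andbT => y0; rewrite EFinM gauss_tailE.
      apply/measurable_EFinP/measurable_funTS/measurable_funM => //.
      exact: measurable_gauss_tail.
  rewrite (triangle_tonelli ma mb a0 b0) EFinM -muleA; congr (_ * _)%E.
  rewrite /I -ge0_integralZl_EFin ?invr_ge0 ?(ltW l0)//.
  - apply: eq_integral => z; rewrite inE/= in_itv/= andbT => z0.
    by rewrite integral_head_gauss1// -!EFinM; congr EFin; ring.
  - by move=> z; rewrite /= in_itv/= andbT => z0; rewrite lee_fin mulr_ge0 ?e0 ?b0.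
  - apply/measurable_EFinP/measurable_funTS/measurable_funM => //.
    by apply: measurable_funB => //; exact: measurable_gauss_rate.
(* The difference of two Gaussian integrals is first stated as a sum, an identity between integrals
   of nonnegative functions. *)
have IE : (I + (2^-1 * Num.sqrt (pi / (2^-1 + l)))%:E = (2^-1 * Num.sqrt (pi / 2^-1))%:E)%E.
  rewrite -!integral_half_gauss ?addr_gt0// /I -ge0_integralD//.
  - apply: eq_integral => z _; rewrite -EFinD mulrBr mulr1 /b -expRD.
    by rewrite (_ : - _ + - (l * _) = - ((2^-1 + l) * z ^+ 2)) ?subrK//; ring.
  - by move=> z; rewrite /= in_itv/= andbT => z0; rewrite lee_fin mulr_ge0 ?e0 ?b0.
  - apply/measurable_EFinP/measurable_funTS/measurable_funM => //.
    by apply: measurable_funB => //; exact: measurable_gauss_rate.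
  - by apply/measurable_EFinP/measurable_funTS; exact: measurable_gauss_rate.
have {}IE : I = (2^-1 * Num.sqrt (pi / 2^-1) - 2^-1 * Num.sqrt (pi / (2^-1 + l)))%:E.
  by rewrite EFinB -IE addeK.
rewrite lhs IE -EFinM; congr EFin.
have s1 := sqrt_const half0; have s2 : _ = _ := sqrt_const (addr_gt0 half0 l0).
rewrite divff// sqrtr1 invr1 -cE in s1; rewrite -cE in s2.
rewrite (_ : 2 * (2^-1 + l) = 1 + 2 * l) in s2; last by field.
rewrite mulrAC mulrBr s1 s2//.
Qed.

End densities.

Section expectation_zero.
Context {R : realType} {d} {T : measurableType d} (P : probability T R).

Lemma E_eq0_ae (f : T -> R) : bounded_measurable f -> (forall w, 0 <= f w) ->
  \int[P]_w f w = 0 -> {ae P, forall w, f w = 0}.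
Proof.
move=> bf f0 If.
have mf : measurable_fun setT (EFin \o f) by apply/measurable_EFinP; case: bf.
have h : ae_eq P setT (EFin \o f) (cst 0%E).
  apply/(ae_eq_integral_abs P measurableT mf).
  rewrite -[RHS]/(0%R%:E) -If EFinE//; apply: eq_integral => w _.
  by rewrite /= ger0_norm.
by apply: filterS h => w /(_ Logic.I) /= [].
Qed.

Lemma ae_prob0 (N : set T) : measurable N -> P N = 0%E -> {ae P, forall w, ~ N w}.
Proof. by move=> mN N0; exists N; split => // w /= /contrapT. Qed.

Lemma prob0_ae (N : set T) : measurable N -> {ae P, forall w, ~ N w} -> P N = 0%E.
Proof.
move=> mN [M [mM M0 sub]]; apply/eqP; rewrite eq_le measure_ge0 andbT -M0.
by apply: le_measure; rewrite ?inE// => w Nw; apply: sub => /= h; exact: h.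
Qed.

End expectation_zero.

Section law_extensionality.
Context {R : realType} {d d'} {T : measurableType d} {T' : measurableType d'}.
Variables (P : probability T R) (P' : probability T' R) (Y : T -> R) (Y' : T' -> R).
Hypotheses (mY : measurable_fun setT Y) (mY' : measurable_fun setT Y')
  (Y0 : {ae P, forall w, 0 <= Y w}) (Y'0 : {ae P', forall w, 0 <= Y' w}).

Lemma law_from_laplace :
  (forall l, 0 <= l -> \int[P]_w expR (- (l * Y w ^+ 2)) =
                       \int[P']_w expR (- (l * Y' w ^+ 2))) ->
  forall A, measurable A -> P (Y @^-1` A) = P' (Y' @^-1` A).
Proof.
move=> lap A mA.
have eA d1 (T1 : measurableType d1) (Q : probability T1 R) (Z : T1 -> R) :
    measurable_fun setT Z -> {ae Q, forall w, 0 <= Z w} ->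
    \int[Q]_w (1 * (\1_A `|Z w| * \1_setT `|Z w|)) = fine (Q (Z @^-1` A)).
  move=> mZ Z0; rewrite -Eindic; last exact: measurable_preimageT.
  have mnZ : measurable_fun setT (fun w => `|Z w|) by exact: measurableT_comp.
  apply: Eae.
  - suff [] : bounded_measurable (fun w => 1 * (\1_A `|Z w| * \1_setT `|Z w|) : R) by [].
    apply: bmeasM; first exact: bmeas_cst.
    by apply: bmeasM; apply: (bmeas_comp mnZ); exact: bmeas_indic.
  - by apply: measurable_indic; exact: measurable_preimageT.
  - by apply: filterS Z0 => w Zw; rewrite ger0_norm// mul1r indicT mulr1.
have h d1 (T1 : measurableType d1) (Q : probability T1 R) (Z : T1 -> R) :
    forall i j : nat, \int[Q]_w (1 * (expR (- Z w ^+ 2) ^+ i * expR (- Z w ^+ 2) ^+ j)) =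
    \int[Q]_w expR (- ((i + j)%:R * Z w ^+ 2)).
  by move=> i j; apply: eq_Rintegral => w _; rewrite mul1r -exprD gauss_natE.
have lap' i j := etrans (h _ _ P Y i j) (etrans (lap (i + j)%:R (ler0n _ _)) (esym (h _ _ P' Y' i j))).
have e := @laplace_unique_E R _ _ _ _ P Y Y (fun=> 1) P' Y' Y' (fun=> 1) A setT
  mY mY (bmeas_cst 1) (fun=> ler01) mY' mY' (bmeas_cst 1) (fun=> ler01) lap' mA measurableT.
rewrite (eA _ _ P Y mY Y0) (eA _ _ P' Y' mY' Y'0) in e.
rewrite -[LHS]fineK ?fin_num_measure//; last exact: measurable_preimageT.
rewrite -[RHS]fineK ?fin_num_measure//; last exact: measurable_preimageT.
by rewrite e.
Qed.

End law_extensionality.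

(** * Mixing the transform over a uniform time *)

Section bessel_laplace_facts.
Context {R : realType}.
Implicit Types u l m : R.

Lemma bessel_den_ge1 u l m : 0 <= u <= 1 -> 0 <= l -> 0 <= m ->
  1 <= 1 + 2 * m + 2 * u * l + 4 * u * (1 - u) * l * m.
Proof.
move=> /andP[u0 u1] l0 m0; rewrite -!addrA lerDl !addr_ge0// !mulr_ge0//.
by rewrite subr_ge0.
Qed.

Lemma bessel_laplace_itv u l m : 0 <= u <= 1 -> 0 <= l -> 0 <= m ->
  0 <= bessel_laplace u l m <= 1.
Proof. by move=> u01 l0 m0; exact: (mul_inv_sqrt_le1 (bessel_den_ge1 u01 l0 m0)). Qed.

(** Outside [0, 1] the quantity D may vanish or be negative, hence the indicator. On [0, 1] the
    transform is exp(-3/2 ln D), which is visibly measurable. *)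
Lemma bmeas_bessel_laplace l m : 0 <= l -> 0 <= m ->
  bounded_measurable (fun u => \1_(`[0, 1]%classic : set R) u * bessel_laplace u l m).
Proof.
move=> l0 m0; apply: (@bmeas_le _ _ _ 1); last first.
  move=> u; rewrite indicE mem_setE in_itv/=.
  case: (boolP (0 <= u <= 1)) => [u01|_]; last by rewrite mul0r normr0.
  by have /andP[b0 b1] := bessel_laplace_itv u01 l0 m0; rewrite mul1r ger0_norm.
pose D u := 1 + 2 * m + 2 * u * l + 4 * u * (1 - u) * l * m.
rewrite (_ : (fun u => _) =
    fun u => \1_(`[0, 1]%classic : set R) u * expR (- (3 / 2 * ln (D u)))).
  apply: measurable_funM; first exact: measurable_indic.
  apply: measurableT_comp => //; apply: measurableT_comp => //.
  apply: measurable_funM => //; apply: (measurableT_comp (@measurable_ln R)).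
  apply: measurable_funD.
    by apply: measurable_funD => //; apply: measurable_funM => //; exact: measurable_funM.
  apply: measurable_funM => //; apply: measurable_funM => //.
  by apply: measurable_funM; [exact: measurable_funM|exact: measurable_funB].
apply/funext => u; rewrite indicE mem_setE in_itv/=.
case: (boolP (0 <= u <= 1)) => [u01|_]; last by rewrite !mul0r.
have := bessel_den_ge1 u01 l0 m0; rewrite -/(D u) /bessel_laplace -/(D u) !mul1r.
move: (D u) => {}D D1.
have D0 : 0 < D by lra.
rewrite -[D in LHS](lnK (x := D)) ?posrE//; set x := ln D.
have -> : expR x = expR (x / 2) ^+ 2 by rewrite -expRM_natl; congr expR; field.
rewrite sqrtr_sqr ger0_norm ?expR_ge0// -!expRN -exprVn -!expRN -exprSr -expRM_natl.
by congr expR; field.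
Qed.

Lemma E_bessel_laplace {d} {T : measurableType d} (P : probability T R) (U : T -> R) l m :
  (forall w, 0 <= U w <= 1) ->
  \int[P]_w bessel_laplace (U w) l m =
  \int[P]_w (\1_(`[0, 1]%classic : set R) (U w) * bessel_laplace (U w) l m).
Proof.
by move=> U01; apply: eq_Rintegral => w _; rewrite indicE mem_setE in_itv/= U01 mul1r.
Qed.

Lemma uniform_bessel_laplace {d1 d2} {T1 : measurableType d1} {T2 : measurableType d2}
    (P1 : probability T1 R) (P2 : probability T2 R) (U : {RV P1 >-> R}) (V : {RV P2 >-> R}) l m :
  uniform01 U -> uniform01 V -> 0 <= l -> 0 <= m ->
  \int[P1]_w bessel_laplace (U w) l m = \int[P2]_w bessel_laplace (V w) l m.
Proof.
move=> [U01 Ulaw] [V01 Vlaw] l0 m0; rewrite !E_bessel_laplace//.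
have b := bmeas_bessel_laplace l0 m0.
rewrite (E_law (Q := distribution P2 V) (measurable_funP U) _ b); last first.
  by move=> A mA; exact: (etrans (Ulaw A mA) (esym (Vlaw A mA))).
by rewrite (E_law (Q := distribution P2 V) (measurable_funP V) _ b).
Qed.

(** A primitive of (1 + 2 l u)^(-3/2) is -(1/l) (1 + 2 l u)^(-1/2). The value is the transform of
    [sampled_density], so this identifies the density of R(U). *)
Lemma integral_bessel_laplace l : 0 < l ->
  (\int[@lebesgue_measure R]_(u in `[(0%R : R), 1%R]) (bessel_laplace u l 0)%:E =
   ((1 - (Num.sqrt (1 + 2 * l))^-1) / l)%:E)%E.
Proof.
move=> l0.
pose D (u : R) := 1 + 2 * l * u.
pose F (u : R) := - l^-1 * (Num.sqrt (D u))^-1.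
pose f (u : R) := (D u)^-1 * (Num.sqrt (D u))^-1.
have bE u : bessel_laplace u l 0 = f u.
  by rewrite /bessel_laplace /f /D; congr (_^-1 * (Num.sqrt _)^-1); ring.
under eq_integral do rewrite bE.
have dom u : - (4 * l)^-1 < u -> 0 < D u.
  move=> ul; have := ltr_pM2l (x := 2 * l) (mulr_gt0 (ltr0n _ 2) l0) (- (4 * l)^-1) u.
  rewrite ul => /idP.
  rewrite (_ : 2 * l * - (4 * l)^-1 = - 2^-1); last by field; rewrite gt_eqF.
  by rewrite /D; lra.
have h0 u : 0 <= u -> - (4 * l)^-1 < u.
  by move=> u0; rewrite (lt_le_trans _ u0)// oppr_lt0 invr_gt0 mulr_gt0.
have dD u : is_derive u (1 : R) D (2 * l).
  by rewrite /D; apply: is_derive_eq; rewrite /GRing.scale/=; ring.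
have dF u : 0 <= u -> is_derive u (1 : R) F (f u).
  move=> u0; have Du := dom u (h0 u u0).
  have s0 : 0 < Num.sqrt (D u) by rewrite sqrtr_gt0.
  have ds : is_derive u (1 : R) (fun u => Num.sqrt (D u)) ((2 * Num.sqrt (D u))^-1 * (2 * l)).
    have hs := is_derive1_sqrt Du.
    have := @is_derive1_comp R Num.sqrt D u _ _ hs (dD u).
    by rewrite mulrC.
  have sn : Num.sqrt (D u) != 0 by rewrite gt_eqF.
  have dV := @is_deriveV R (fun u => Num.sqrt (D u)) u _ _ sn ds.
  rewrite /F; apply: is_derive_eq.
  have sD : Num.sqrt (D u) ^+ 2 = D u by rewrite sqr_sqrtr// ltW.
  rewrite /GRing.scale/= /f -[X in _ = X^-1 * _]sD; move: (Num.sqrt (D u)) sn => x xn.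
  by field; rewrite xn gt_eqF.
have cF u : 0 <= u -> {for u, continuous F}.
  move=> u0; apply: differentiable_continuous; apply/derivable1_diffP.
  by have := dF u u0 => ?; apply: ex_derive.
rewrite (@continuous_FTC2 _ _ F).
- rewrite -EFinB /F /D mulr0 addr0 sqrtr1 mulr1; congr EFin.
  by rewrite invr1; move: (Num.sqrt _)^-1 => x; field; rewrite gt_eqF.
- exact: ltr01.
- apply: continuous_in_subspaceT => u; rewrite inE/= in_itv/= => /andP[u0 _].
  have Du := dom u (h0 u u0).
  have cD : {for u, continuous D}.
    apply: differentiable_continuous; apply/derivable1_diffP.
    by have := dD u => ?; apply: ex_derive.
  apply: cvgM; apply: cvgV; rewrite ?gt_eqF ?sqrtr_gt0//.
  by apply: continuous_comp => //; exact: sqrt_continuous.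
- split.
  + by move=> u; rewrite in_itv/= => /andP[/ltW u0 _]; have := dF u u0 => ?; apply: ex_derive.
  + exact: cvg_at_right_filter (cF 0 (lexx 0)).
  + exact: cvg_at_left_filter (cF 1 ler01).
- by move=> u; rewrite in_itv/= => /andP[/ltW u0 _]; rewrite derive1E; have := dF u u0 => ?; rewrite derive_val.
Qed.

End bessel_laplace_facts.

Section process_laws.
Context {R : realType} {d d'} {Omega : measurableType d} {Omega' : measurableType d'}.
Variables (P : probability Omega R) (P' : probability Omega' R).
Variables (I : set R) (X : R -> Omega -> R) (X' : R -> Omega' -> R).
Hypotheses (law : same_process_law I P X P' X')
  (mX : forall t, I t -> measurable_fun setT (X t))
  (mX' : forall t, I t -> measurable_fun setT (X' t)).

Lemma process_law_ae t (A : set R) : I t -> measurable A ->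
  {ae P', forall w, A (X' t w)} -> {ae P, forall w, A (X t w)}.
Proof.
move=> It mA X'A.
have mcA : measurable (~` A) by exact: measurableC.
have cC : cylinder I [set f | (~` A) (f t)].
  by apply: sub_sigma_algebra; exists t => //; exists (~` A).
have := law cC; rewrite [RHS]prob0_ae.
- move=> /ae_prob0 h; apply: filterS (h (measurable_preimageT (mX It) mcA)) => w.
  by rewrite /path_event/= => /contrapT.
- exact: (measurable_preimageT (mX' It) mcA).
- by apply: filterS X'A => w Aw; rewrite /path_event/=; exact.
Qed.

End process_laws.

Section random_time.
Context {R : realType} {d} {Omega : measurableType d} (P : probability Omega R).
Variables (I : set R) (X : R -> Omega -> R) (U : {RV P >-> R}).
Hypotheses (I01 : `[0, 1] `<=` I) (cX : continuous_process I X)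
  (U01 : forall w, 0 <= U w <= 1) (XU : process_indep_rv P I X U)
  (X0 : forall t, 0 <= t <= 1 -> {ae P, forall w, 0 <= X t w}).

Let mX t : 0 <= t <= 1 -> measurable_fun setT (X t).
Proof. by move=> t01; case: cX => + _; apply; apply: I01; rewrite /= in_itv. Qed.

(* |x| - x vanishes exactly for x >= 0; the Gaussian factor makes it bounded. *)
Lemma random_time_ge0 : {ae P, forall w, 0 <= at_random_time X U w}.
Proof.
pose f (x : R) := (`|x| - x) * expR (- (1 * x ^+ 2)).
have cf : continuous f.
  move=> x; apply: cvgM; last exact: continuous_gauss.
  by apply: cvgB; [exact: norm_continuous|exact: cvg_id].
have f0 x : 0 <= f x by rewrite mulr_ge0 ?expR_ge0// subr_ge0 ler_norm.
have bf : bounded_measurable f.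
  apply: (@bmeas_le _ _ _ 2); first exact: continuous_measurable_fun.
  move=> x; rewrite normrM (ger0_norm (expR_ge0 _)).
  apply: (@le_trans _ _ (2 * (`|x| * expR (- (1 * x ^+ 2))))).
    rewrite mulrA ler_wpM2r ?expR_ge0// (le_trans (ler_normB _ _))// normr_id.
    by rewrite mulr2n mulrDl mul1r.
  by rewrite -[leRHS]mulr1 ler_wpM2l// norm_mul_gauss_le1.
have f_eq0 x : (f x == 0) = (0 <= x).
  by rewrite mulf_eq0 (gt_eqF (expR_gt0 _)) orbF subr_eq0 -ger0_def.
have mt := measurable_random_time I01 cX U01.
have bft : bounded_measurable (fun w => f (at_random_time X U w)) by exact: bmeas_comp bf.
have h := E_eq0_ae (P := P) bft (fun w => f0 _).
apply: filterS (h _) => [w /eqP|]; first by rewrite f_eq0.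
have bphi : bounded_measurable (fun z : R * R => f z.1).
  by apply: (bmeas_comp _ bf); exact: measurable_fst.
rewrite (random_time_expectation I01 cX U01 XU bphi) => //=.
rewrite -[RHS](Ecst P 0); apply: eq_Rintegral => w' _.
rewrite -[RHS](Ecst P 0); apply: Eae.
- by have [] : bounded_measurable (fun w => f (X (U w') w)) by apply: bmeas_comp bf; exact: mX.
- exact: measurable_cst.
- by apply: filterS (X0 (U01 w')) => w Xw; apply/eqP; rewrite f_eq0.
Qed.

End random_time.

(** * The Bessel process at time 1 and at a uniform time *)

Section bessel.
Context {R : realType}.
Local Notation halfline := (`[(0 : R), +oo[%classic).

Lemma measurable_euclidean_norm {d} {Omega : measurableType d} (P : probability Omega R)
    (W : 'I_3 -> R -> Omega -> R) t : brownian_motion_vec P W -> 0 <= t ->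
  measurable_fun setT (euclidean_norm_process W t).
Proof.
move=> [BW _] t0; apply: (measurableT_comp (f := @Num.sqrt R)).
  by apply: continuous_measurable_fun; exact: sqrt_continuous.
apply: measurable_sum => i; apply: measurable_funX.
by apply: brownian_measurable t0; exact: BW.
Qed.

Section laplace.
Context {d} {Omega : measurableType d} (P : probability Omega R) (X : R -> Omega -> R).
Hypothesis hX : bessel3 P X.

Lemma bessel3_measurable t : 0 <= t -> measurable_fun setT (X t).
Proof. by move=> t0; case: hX => -[mX _] _; apply: mX; rewrite /= in_itv/= t0. Qed.

Lemma bessel3_laplace u l m : 0 <= u <= 1 -> 0 <= l -> 0 <= m ->
  \int[P]_w (expR (- (l * X u w ^+ 2)) * expR (- (m * X 1 w ^+ 2))) = bessel_laplace u l m.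
Proof.
move=> u01 l0 m0; case: (hX) => [_ [d1 [T1 [P1 [W [BW law]]]]]].
have /andP[u0 _] := u01.
rewrite -(bessel_laplaceE BW u01 l0 m0).
pose phi (f : path_space halfline) := expR (- (l * f u ^+ 2)) * expR (- (m * f 1 ^+ 2)).
have It (t : R) : 0 <= t -> halfline t by rewrite /= in_itv/= andbT.
apply: (process_law_expectation (phi := phi) _ _ law).
- by move=> t; rewrite /= in_itv/= andbT => t0; exact: bessel3_measurable.
- by move=> t; rewrite /= in_itv/= andbT => t0; exact: measurable_euclidean_norm BW t0.
- apply: bmeasM.
    exact: (bmeas_comp (measurable_eval (It u u0)) (bmeas_even_gauss l0)).
  exact: (bmeas_comp (measurable_eval (It 1 ler01)) (bmeas_even_gauss m0)).
Qed.

(** Only the law of X is that of a norm, so nonnegativity at a given time holds up to a null set. *)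
Lemma bessel3_ge0 t : 0 <= t -> {ae P, forall w, 0 <= X t w}.
Proof.
move=> t0; case: (hX) => [_ [d1 [T1 [P1 [W [BW law]]]]]].
have := @process_law_ae _ _ _ _ _ _ _ _ _ _ law _ _ t `[0, +oo[%classic.
rewrite /= => h; apply: filterS (h _ _ _ _ _) => [w|s|s||//|].
- by rewrite /= in_itv/= andbT.
- by rewrite /= in_itv/= andbT; exact: bessel3_measurable.
- by rewrite /= in_itv/= andbT => s0; exact: measurable_euclidean_norm BW s0.
- by rewrite in_itv/= t0.
- by apply: aeW => w; rewrite /= in_itv/= andbT; exact: sqrtr_ge0.
Qed.

Lemma bessel3_laplace1 m : 0 <= m ->
  \int[P]_w expR (- (m * X 1 w ^+ 2)) = (1 + 2 * m)^-1 * (Num.sqrt (1 + 2 * m))^-1.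
Proof.
move=> m0; have := bessel3_laplace (u := 0) (l := 0) (m := m) _ (lexx 0) m0.
rewrite lexx ler01 => /(_ isT) h.
rewrite (_ : \int[P]_w _ = \int[P]_w (expR (- (0 * X 0 w ^+ 2)) * expR (- (m * X 1 w ^+ 2)))).
  by rewrite h /bessel_laplace !(mulr0, mul0r, addr0).
by apply: eq_Rintegral => w _; rewrite mul0r oppr0 expR0 mul1r.
Qed.

Lemma bessel3_density : has_density P (X 1) (@bessel_density R).
Proof.
have m1 := bessel3_measurable ler01.
split => //; [exact: measurable_bessel_density|exact: bessel_density_ge0|].
move=> A mA; apply: (density_from_laplace m1 (bessel3_ge0 ler01)
  (@measurable_bessel_density R) (@bessel_density_ge0 R) (@bessel_density_le R)) => //.
- by move=> y y0; rewrite /bessel_density leNgt y0.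
- move=> n; under eq_Rintegral do rewrite gauss_natE.
  under eq_integral do rewrite gauss_natE.
  by rewrite bessel3_laplace1// bessel_density_gauss.
Qed.

Variable U : {RV P >-> R}.
Hypotheses (hU : uniform01 U) (hXU : process_indep_rv P halfline X U).

Let U01 w : 0 <= U w <= 1. Proof. by case: hU. Qed.

Let I01 : `[(0:R), 1] `<=` halfline.
Proof. by move=> x; rewrite /= !in_itv/= => /andP[->]. Qed.

Lemma bessel3_sample_measurable : measurable_fun setT (at_random_time X U).
Proof. by apply: (measurable_random_time I01) => //; case: hX. Qed.

Lemma bessel3_sample_ge0 : {ae P, forall w, 0 <= at_random_time X U w}.
Proof.
apply: (random_time_ge0 I01) => //; first by case: hX.
by move=> t /andP[t0 _]; exact: bessel3_ge0.
Qed.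

Lemma bessel3_sample_laplace l m : 0 <= l -> 0 <= m ->
  \int[P]_w (expR (- (l * at_random_time X U w ^+ 2)) * expR (- (m * X 1 w ^+ 2))) =
  \int[P]_w bessel_laplace (U w) l m.
Proof.
move=> l0 m0.
pose phi (z : R * R) := expR (- (l * z.1 ^+ 2)) * expR (- (m * z.2 ^+ 2)).
have bphi : bounded_measurable phi.
  apply: bmeasM.
    exact: (bmeas_comp measurable_fst (bmeas_even_gauss l0)).
  exact: (bmeas_comp measurable_snd (bmeas_even_gauss m0)).
have cX : continuous_process halfline X by case: hX.
transitivity (\int[P]_w phi (at_random_time X U w, X 1 w)) => //.
rewrite (random_time_expectation I01 cX U01 hXU bphi).
  by apply: eq_Rintegral => w _; rewrite -bessel3_laplace.
by move=> y x; rewrite /phi/=; apply: cvgMl; exact: continuous_gauss.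
Qed.

Lemma bessel3_sample_laplace1 l : 0 <= l ->
  \int[P]_w expR (- (l * at_random_time X U w ^+ 2)) = \int[P]_w bessel_laplace (U w) l 0.
Proof.
move=> l0; rewrite -(bessel3_sample_laplace l0 (lexx 0)); apply: eq_Rintegral => w _.
by rewrite mul0r oppr0 expR0 mulr1.
Qed.

(** [bessel_laplace u l 0] depends on u and l through u l only, and it is the transform of R(1) at
    rate u l. Averaging over an independent U gives the same transform for both variables. *)
Lemma bessel3_scaling :
  same_law P (at_random_time X U) (fun w => Num.sqrt (U w) * X 1 w).
Proof.
have m1 := bessel3_measurable ler01.
have mZ : measurable_fun setT (fun w => Num.sqrt (U w) * X 1 w).
  apply: measurable_funM => //; apply: (measurableT_comp (f := @Num.sqrt R)) => //.
  by apply: continuous_measurable_fun; exact: sqrt_continuous.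
split=> //; first exact: bessel3_sample_measurable.
apply: law_from_laplace; [exact: bessel3_sample_measurable|exact: mZ|exact: bessel3_sample_ge0| |].
  by apply: filterS (bessel3_ge0 ler01) => w X1; rewrite mulr_ge0 ?sqrtr_ge0.
move=> l l0; rewrite bessel3_sample_laplace1//.
have ind A B : measurable A -> measurable B ->
    P (U @^-1` A `&` X 1 @^-1` B) = (P (U @^-1` A) * P (X 1 @^-1` B))%E.
  move=> mA mB; rewrite setIC muleC.
  apply: (hXU (C := [set f | B (f 1)])) mA; apply: sub_sigma_algebra.
  by exists 1; [rewrite /= in_itv/= ler01|exists B].
pose phi (z : R * R) := expR (- (l * (Num.sqrt z.1 * z.2) ^+ 2)).
have bphi : bounded_measurable phi.
  apply: (bmeas_comp (h := fun z : R * R => Num.sqrt z.1 * z.2) _ (bmeas_even_gauss l0)).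
  apply: measurable_funM => //; apply: (measurableT_comp (f := @Num.sqrt R)) => //.
  by apply: continuous_measurable_fun; exact: sqrt_continuous.
transitivity (\int[P]_w phi (U w, X 1 w)) => //.
rewrite (E_indep (measurable_funP U) m1 ind bphi); apply: eq_Rintegral => w _.
have /andP[u0 u1] := U01 w.
transitivity (\int[P]_w' expR (- (l * U w * X 1 w' ^+ 2))).
  rewrite bessel3_laplace1 ?mulr_ge0// /bessel_laplace.
  by congr (_^-1 * (Num.sqrt _)^-1); ring.
by apply: eq_Rintegral => w' _; rewrite /phi/= exprMn sqr_sqrtr// -(mulrA l (U w)).
Qed.

Lemma bessel3_sample_density : has_density P (at_random_time X U) (@sampled_density R).
Proof.
have mt := bessel3_sample_measurable.
split => //; [exact: measurable_sampled_density|exact: sampled_density_ge0|].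
move=> A mA; apply: (density_from_laplace mt bessel3_sample_ge0
  (@measurable_sampled_density R) (@sampled_density_ge0 R) (@sampled_density_le R)) => //.
- by move=> y y0; rewrite /sampled_density leNgt y0.
- move=> n; under eq_Rintegral do rewrite gauss_natE.
  under eq_integral do rewrite gauss_natE.
  rewrite sampled_density_gauss// -integral_bessel_laplace//.
  rewrite bessel3_sample_laplace1// E_bessel_laplace//.
  have b := bmeas_bessel_laplace (ler0n R n.+1) (lexx 0).
  case: hU => _ Ulaw.
  rewrite (E_law (Q := uniform_prob (@ltr01 R)) (measurable_funP U) Ulaw b) EFinE//.
  rewrite integral_uniform.
  + rewrite subr0 invr1 mul1e; apply: eq_integral => u; rewrite inE/= in_itv/= => u01.
    by rewrite indicE mem_set ?mul1r//= in_itv.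
  + by apply/measurable_EFinP; case: b.
  + move=> u; rewrite lee_fin indicE mem_setE in_itv/=.
    case: (boolP (0 <= u <= 1)) => [u01|_]; last by rewrite mul0r.
    by have /andP[h _] := bessel_laplace_itv u01 (ler0n R n.+1) (lexx 0); rewrite mul1r.
Qed.

End laplace.

End bessel.

(** * The meander at fixed times and at a uniform time *)

Lemma bmeas_abs_gauss {R : realType} :
  bounded_measurable (fun y : R => `|y| * expR (- y ^+ 2)).
Proof.
have := bmeas_norm (bmeas_odd_gauss (ltr01 : 0 < 1 :> R)).
by under eq_fun do rewrite mul1r normrM (ger0_norm (expR_ge0 _)).
Qed.

Section meander_process.
Context {R : realType} {d} {Omega : measurableType d}.
Variables (P : probability Omega R) (B : R -> Omega -> R).
Hypothesis BM : brownian_motion P B.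

Lemma brownian_neq0 : {ae P, forall w, B 1 w <> 0}.
Proof.
have m1 : measurable_fun setT (B 1) by exact: (brownian_measurable BM).
have mS : measurable (B 1 @^-1` [set 0]) by exact: measurable_preimageT.
apply: (ae_prob0 mS); case: BM => _ B0 /(_ 0 1 (lexx 0) ltr01 [set 0] (measurable_set1 _)) + _.
rewrite (_ : B 1 \- B 0 = B 1); last by apply/funext => w; rewrite /= B0 subr0.
move=> ->; have /null_content_dominatesP := @normal_prob_dominates R 0 (Num.sqrt (1 - 0)).
by apply => //; exact: lebesgue_measure_set1.
Qed.

Lemma meander_process1_gt0 : {ae P, forall w, 0 < meander_process B 1 w}.
Proof.
apply: filterS brownian_neq0 => w B1.
have [/andP[g0 g1] Bg _] := last_zero_spec BM w.
have {}g1 : last_zero B w < 1.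
  by rewrite lt_neqAle g1 andbT; apply/eqP => e; apply: B1; rewrite -e.
rewrite /meander_process mul1r subrKC divr_gt0 ?sqrtr_gt0 ?subr_gt0// normr_gt0.
exact/eqP.
Qed.

Lemma meander_process_ge0 u w : 0 <= meander_process B u w.
Proof. by rewrite divr_ge0// sqrtr_ge0. Qed.

Lemma meander_mass_gt0 :
  0 < \int[P]_w (meander_process B 1 w * expR (- (meander_process B 1 w ^+ 2))).
Proof.
have m1 : measurable_fun setT (meander_process B 1).
  by apply: (measurable_meander_process BM); rewrite ler01 lexx.
have b : bounded_measurable (fun w => meander_process B 1 w * expR (- (meander_process B 1 w ^+ 2))).
  have := bmeas_comp m1 (bmeas_odd_gauss (ltr01 : 0 < 1 :> R)).
  by under eq_fun do rewrite mul1r.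
have b0 w : 0 <= meander_process B 1 w * expR (- (meander_process B 1 w ^+ 2)).
  by rewrite mulr_ge0 ?meander_process_ge0 ?expR_ge0.
rewrite lt_neqAle Rintegral_ge0 ?andbT; last by move=> w _.
apply/eqP => /esym /(E_eq0_ae b b0) h.
have : P setT = 0%E.
  apply: prob0_ae => //; apply: filterS2 meander_process1_gt0 h => w m0.
  by move/eqP; rewrite mulf_eq0 (gt_eqF m0) (gt_eqF (expR_gt0 _)).
by rewrite probability_setT => /eqP; rewrite onee_eq0.
Qed.

End meander_process.

Section meander.
Context {R : realType} {d} {Omega : measurableType d} (P : probability Omega R).
Variable m : R -> Omega -> R.
Hypothesis hm : brownian_meander P m.
Local Notation I01 := (`[(0 : R), 1]%classic).

Let I0E (t : R) : 0 <= t <= 1 -> I01 t. Proof. by rewrite /= in_itv. Qed.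

Lemma meander_measurable t : 0 <= t <= 1 -> measurable_fun setT (m t).
Proof. by move=> t01; case: hm => -[mm _] _; apply: mm; exact: I0E. Qed.

Lemma meander_ae t A : 0 <= t <= 1 -> measurable A ->
  (forall d1 (T1 : measurableType d1) (P1 : probability T1 R) B, brownian_motion P1 B ->
     {ae P1, forall w, A (meander_process B t w)}) ->
  {ae P, forall w, A (m t w)}.
Proof.
move=> t01 mA h; case: (hm) => [_ [d1 [T1 [P1 [B [BM law]]]]]].
apply: (process_law_ae law) => //.
- by move=> s; rewrite /= in_itv/=; exact: meander_measurable.
- by move=> s; rewrite /= in_itv/=; exact: (measurable_meander_process BM).
- exact: h.
Qed.

Lemma meander_ge0 t : 0 <= t <= 1 -> {ae P, forall w, 0 <= m t w}.
Proof.
move=> t01; have := @meander_ae t `[0, +oo[%classic t01 (measurable_itv _) _.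
move=> h; apply: filterS (h _) => [w|d1 T1 P1 B BM].
  by rewrite /= in_itv/= andbT.
by apply: aeW => w; rewrite /= in_itv/= andbT; exact: meander_process_ge0.
Qed.

Lemma meander1_gt0 : {ae P, forall w, 0 < m 1 w}.
Proof.
have t01 : 0 <= (1:R) <= 1 by rewrite ler01 lexx.
have := @meander_ae 1 `]0, +oo[%classic t01 (measurable_itv _) _.
move=> h; apply: filterS (h _) => [w|d1 T1 P1 B BM].
  by rewrite /= in_itv/= andbT.
by apply: filterS (meander_process1_gt0 BM) => w; rewrite /= in_itv/= andbT.
Qed.

(** The factor e^(-x^2) makes the weight x bounded and raises the rate at time 1 from n to 1 + n, so
    the transform of the meander is available for all n >= 0. The absolute value makes the weight
    nonnegative on every path, as m is so only almost surely. *)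
Lemma meander_laplace_rate : exists2 kappa : R, 0 < kappa &
  forall u l n, 0 <= u <= 1 -> 0 <= l -> 0 <= n ->
  \int[P]_w (`|m 1 w| * expR (- m 1 w ^+ 2) *
    (expR (- (l * m u w ^+ 2)) * expR (- (n * m 1 w ^+ 2)))) =
  kappa * bessel_laplace u l (1 + n).
Proof.
case: (hm) => [_ [d1 [T1 [P1 [B [BM law]]]]]].
have o01 : 0 <= (1:R) <= 1 by rewrite ler01 lexx.
exists ((bessel_laplace 0 0 1)^-1 *
  \int[P1]_w (meander_process B 1 w * expR (- (meander_process B 1 w ^+ 2)))).
  rewrite mulr_gt0 ?meander_mass_gt0// invr_gt0 /bessel_laplace.
  by rewrite mulr_gt0 ?invr_gt0 ?sqrtr_gt0// !mulr0 !mul0r !addr0.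
move=> u l n u01 l0 n0.
have n1 : 1 <= 1 + n by rewrite lerDl.
rewrite -(meander_laplace BM u01 l0 n1).
pose phi (f : path_space I01) := `|f 1| * expR (- f 1 ^+ 2) *
    (expR (- (l * f u ^+ 2)) * expR (- (n * f 1 ^+ 2))).
have bphi : bounded_measurable phi.
  apply: bmeasM; last first.
    apply: bmeasM.
      exact: (bmeas_comp (measurable_eval (I0E u01)) (bmeas_even_gauss l0)).
    exact: (bmeas_comp (measurable_eval (I0E o01)) (bmeas_even_gauss n0)).
  exact: (bmeas_comp (measurable_eval (I0E o01)) bmeas_abs_gauss).
transitivity (\int[P1]_w phi (meander_process B ^~ w)).
  apply: (process_law_expectation (phi := phi) _ _ law) => //.
  - by move=> t; rewrite /= in_itv/=; exact: meander_measurable.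
  - by move=> t; rewrite /= in_itv/=; exact: (measurable_meander_process BM).
apply: eq_Rintegral => w _; rewrite /phi ger0_norm ?meander_process_ge0//.
rewrite mulrDl mul1r opprD expRD; ring.
Qed.

Variable V : {RV P >-> R}.
Hypotheses (hV : uniform01 V) (hmV : process_indep_rv P I01 m V).

Let V01 w : 0 <= V w <= 1. Proof. by case: hV. Qed.

Let sub01 : I01 `<=` I01. Proof. by []. Qed.

Lemma meander_sample_measurable : measurable_fun setT (at_random_time m V).
Proof. by apply: (measurable_random_time sub01) => //; case: hm. Qed.

Lemma meander_sample_ge0 : {ae P, forall w, 0 <= at_random_time m V w}.
Proof.
apply: (random_time_ge0 sub01) => //; first by case: hm.
by move=> t; exact: meander_ge0.
Qed.

Lemma meander_sample_laplace : exists2 kappa : R, 0 < kappa &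
  forall l n, 0 <= l -> 0 <= n ->
  \int[P]_w (`|m 1 w| * expR (- m 1 w ^+ 2) *
    (expR (- (l * at_random_time m V w ^+ 2)) * expR (- (n * m 1 w ^+ 2)))) =
  kappa * \int[P]_w bessel_laplace (V w) l (1 + n).
Proof.
have [kappa k0 kE] := meander_laplace_rate; exists kappa => // l n l0 n0.
pose phi (z : R * R) := `|z.2| * expR (- z.2 ^+ 2) *
  (expR (- (l * z.1 ^+ 2)) * expR (- (n * z.2 ^+ 2))).
have bphi : bounded_measurable phi.
  apply: bmeasM; last first.
    apply: bmeasM.
      exact: (bmeas_comp measurable_fst (bmeas_even_gauss l0)).
    exact: (bmeas_comp measurable_snd (bmeas_even_gauss n0)).
  exact: (bmeas_comp measurable_snd bmeas_abs_gauss).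
have cm : continuous_process I01 m by case: hm.
transitivity (\int[P]_w phi (at_random_time m V w, m 1 w)) => //.
rewrite (random_time_expectation sub01 cm V01 hmV bphi); last first.
  move=> y x; rewrite /phi/=; apply: cvgMr; apply: cvgMl; exact: continuous_gauss.
under eq_Rintegral do rewrite kE//.
rewrite !E_bessel_laplace//.
transitivity (\int[P]_w (kappa * (\1_I01 (V w) * bessel_laplace (V w) l (1 + n)))).
  by apply: eq_Rintegral => w _; rewrite indicE mem_set ?mul1r//= in_itv/= V01.
have n1 : 0 <= 1 + n by rewrite addr_ge0.
by rewrite EZ//; exact: (bmeas_comp (measurable_funP V) (bmeas_bessel_laplace l0 n1)).
Qed.

End meander.

(** * The conditional laws *)

Section bridge.
Context {R : realType}.

Lemma bessel_laplace00 (n : R) :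
  bessel_laplace 0 0 n = (1 + 2 * n)^-1 * (Num.sqrt (1 + 2 * n))^-1.
Proof. by rewrite /bessel_laplace !(mulr0, mul0r, addr0). Qed.

(** Given R(1) = r, the value R(u) is the norm of a Gaussian vector with mean of length u r and
    variance u (1 - u) in each coordinate; its transform is D^(-3/2) exp(-(l / D) u^2 r^2).
    Averaging over R(1) shifts the rate n by l u^2 / D, and the product of the two denominators is
    that of the joint transform. *)
Lemma bessel_laplace_bridge (u l n : R) : 0 <= u <= 1 -> 0 <= l -> 0 <= n ->
  let D := 1 + 2 * l * (u * (1 - u)) in
  D^-1 * (Num.sqrt D)^-1 * bessel_laplace 0 0 (n + l / D * u ^+ 2) = bessel_laplace u l n.
Proof.
move=> /andP[u0 u1] l0 n0 D; rewrite bessel_laplace00.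
have uu : 0 <= u * (1 - u) by rewrite mulr_ge0// subr_ge0.
have D0 : 0 < D by rewrite ltr_pwDl// mulr_ge0// mulr_ge0.
have E0 : 0 <= 1 + 2 * (n + l / D * u ^+ 2).
  by rewrite addr_ge0// mulr_ge0// addr_ge0// mulr_ge0 ?sqr_ge0// divr_ge0// ltW.
have DE : D * (1 + 2 * (n + l / D * u ^+ 2)) = 1 + 2 * n + 2 * u * l + 4 * u * (1 - u) * l * n.
  have -> : D * (1 + 2 * (n + l / D * u ^+ 2)) = D + 2 * n * D + 2 * l * u ^+ 2 * (D / D) by ring.
  by rewrite divff ?gt_eqF// /D; ring.
by rewrite mulrACA -!invfM -sqrtrM ?(ltW D0)// DE invfM.
Qed.

Section bridge_kernel.
Context {d1 d2} {T1 : measurableType d1} {T2 : measurableType d2}.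
Variables (P1 : probability T1 R) (P2 : probability T2 R).
Variables (U : T1 -> R) (W : 'I_3 -> R -> T2 -> R).
Hypotheses (mU : measurable_fun setT U) (U01 : forall w, 0 <= U w <= 1)
  (BW : brownian_motion_vec P2 W).

Let i0 : 'I_3 := @Ordinal 3 0 isT.
Let i1 : 'I_3 := @Ordinal 3 1 isT.
Let i2 : 'I_3 := @Ordinal 3 2 isT.

(* The norm at the uniform time U of a three dimensional Brownian bridge from
   the origin to a point at distance r. *)
Definition bridge_norm (z : R * (T1 * T2)) : R :=
  let u := U z.2.1 in let s := Num.sqrt (u * (1 - u)) in
  Num.sqrt ((u * z.1 + s * W i0 1 z.2.2) ^+ 2 + (s * W i1 1 z.2.2) ^+ 2 +
            (s * W i2 1 z.2.2) ^+ 2).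

Let msqrt : measurable_fun setT (@Num.sqrt R).
Proof. by apply: continuous_measurable_fun; exact: sqrt_continuous. Qed.

Lemma measurable_bridge_norm : measurable_fun setT bridge_norm.
Proof.
have mu : measurable_fun setT (fun z : R * (T1 * T2) => U z.2.1).
  exact: (measurableT_comp mU (measurableT_comp measurable_fst measurable_snd)).
have mw i : measurable_fun setT (fun z : R * (T1 * T2) => W i 1 z.2.2).
  apply: (measurableT_comp (f := W i 1) (brownian_measurable (BW.1 i) ler01)).
  exact: (measurableT_comp measurable_snd measurable_snd).
have ms : measurable_fun setT (fun z : R * (T1 * T2) => Num.sqrt (U z.2.1 * (1 - U z.2.1))).
  by apply: (measurableT_comp msqrt); apply: measurable_funM => //; exact: measurable_funB.
apply: (measurableT_comp msqrt); apply: measurable_funD; [apply: measurable_funD|];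
  apply: measurable_funX; [|exact: measurable_funM..].
by apply: measurable_funD; apply: measurable_funM => //; exact: measurable_fst.
Qed.

Lemma bridge_norm_ge0 z : 0 <= bridge_norm z. Proof. exact: sqrtr_ge0. Qed.

Lemma bridge_norm_laplace r w l : 0 <= l ->
  let D := 1 + 2 * l * (U w * (1 - U w)) in
  \int[P2]_w' expR (- (l * bridge_norm (r, (w, w')) ^+ 2)) =
  D^-1 * (Num.sqrt D)^-1 * expR (- (l / D * U w ^+ 2 * r ^+ 2)).
Proof.
move=> l0 D; have /andP[u0 u1] := U01 w.
have uu : 0 <= U w * (1 - U w) by rewrite mulr_ge0// subr_ge0.
have := shifted_norm_laplace BW (U w * r) (sqrtr_ge0 (U w * (1 - U w))) l0.
rewrite sqr_sqrtr// -/D exprMn -(mulrA (l / D)) => <-.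
apply: eq_Rintegral => w' _; rewrite /bridge_norm/= sqr_sqrtr//.
by rewrite !addr_ge0// sqr_ge0.
Qed.

(** Common to both processes: (h, c) is (1, 0) for the Bessel process and (|x| e^(-x^2), 1) for the
    meander. The kernel involves neither h nor c nor kappa, so the same one serves twice. *)
Lemma bridge_conditional_law {d} {T : measurableType d} (P : probability T R)
    (Y Z : T -> R) (h : R -> R) (c kappa : R) (k : R.-pker R ~> R) :
  measurable_fun setT Y -> measurable_fun setT Z ->
  bounded_measurable h -> (forall x, 0 <= h x) -> 0 <= c ->
  {ae P, forall w, 0 <= Y w} -> {ae P, forall w, 0 <= Z w} -> {ae P, forall w, 0 < h (Z w)} ->
  (forall l n, 0 <= l -> 0 <= n ->
    \int[P]_w (h (Z w) * (expR (- (l * Y w ^+ 2)) * expR (- (n * Z w ^+ 2)))) =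
    kappa * \int[P1]_w bessel_laplace (U w) l (c + n)) ->
  (forall r C, k r C = (P1 \x P2)%E ((fun z => bridge_norm (r, z)) @^-1` C)) ->
  conditional_law P Y Z k.
Proof.
move=> mY mZ bh h0 c0 Y0 Z0 hZ joint kE.
have mb := measurable_bridge_norm.
apply: (conditional_law_from_laplace mY mZ mb bridge_norm_ge0 bh h0 Y0 Z0 hZ _ kE) => i j.
under eq_Rintegral do rewrite !gauss_natE.
rewrite joint//.
(* At l = 0 the transform does not depend on the time, which gives the weighted law of Z alone. *)
have base n : 0 <= n -> \int[P]_w (h (Z w) * expR (- (n * Z w ^+ 2))) =
    kappa * bessel_laplace 0 0 (c + n).
  move=> n0; transitivity (\int[P]_w (h (Z w) *
      (expR (- (0 * Y w ^+ 2)) * expR (- (n * Z w ^+ 2))))).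
    by apply: eq_Rintegral => w _; rewrite mul0r oppr0 expR0 mul1r.
  rewrite joint//; congr (_ * _).
  rewrite -[RHS](Ecst P1); apply: eq_Rintegral => w _.
  by rewrite bessel_laplace00 /bessel_laplace !(mulr0, mul0r, addr0).
have mZb : measurable_fun setT (fun z : (T * T1) * T2 => bridge_norm (Z z.1.1, (z.1.2, z.2))).
  apply: (measurableT_comp mb); apply/measurable_fun_pair.
    exact: (measurableT_comp mZ (measurableT_comp measurable_fst measurable_fst)).
  apply/measurable_fun_pair => //.
  exact: (measurableT_comp measurable_snd measurable_fst).
have mZ1 : measurable_fun setT (fun z : (T * T1) * T2 => Z z.1.1).
  exact: (measurableT_comp mZ (measurableT_comp measurable_fst measurable_fst)).
pose F (z : (T * T1) * T2) := h (Z z.1.1) * expR (- Z z.1.1 ^+ 2) ^+ j *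
  expR (- bridge_norm (Z z.1.1, (z.1.2, z.2)) ^+ 2) ^+ i.
have bF : bounded_measurable F.
  apply: bmeasM; last exact: bmeas_gauss mZb.
  by apply: bmeasM; [exact: (bmeas_comp mZ1 bh)|exact: bmeas_gauss mZ1].
pose H (z : T * T1) := \int[P2]_w' F (z, w').
have bH : bounded_measurable H by exact: (bmeas_E1 (P \x P1)%E P2 bF).
have mZr r : measurable_fun setT (fun z => bridge_norm (r, z)).
  exact: (measurableT_comp mb (pair1_measurable r)).
have HE w w1 : H (w, w1) = h (Z w) * expR (- Z w ^+ 2) ^+ j *
    \int[P2]_w' expR (- bridge_norm (Z w, (w1, w')) ^+ 2) ^+ i.
  rewrite /H /F /= EZ//; apply: bmeas_gauss.
  exact: (measurableT_comp (mZr (Z w)) (pair1_measurable w1)).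
transitivity (\int[P]_w \int[P1]_w1 H (w, w1)); last first.
  apply: eq_Rintegral => w _.
  rewrite (E_fubini1 P1 P2 (f := fun z => expR (- bridge_norm (Z w, z) ^+ 2) ^+ i));
    last by apply: bmeas_gauss; exact: mZr.
  rewrite -EZ; last first.
    apply: (bmeas_E1 P1 P2 (f := fun z => expR (- bridge_norm (Z w, z) ^+ 2) ^+ i)).
    by apply: bmeas_gauss; exact: mZr.
  by apply: eq_Rintegral => w1 _; rewrite HE.
(* The integral over the random time moves outside, so that the bridge identity can be used at a
   fixed time. *)
rewrite -(E_fubini1 P P1 bH) (E_fubini2 P P1 bH).
rewrite !E_bessel_laplace//.
rewrite -EZ; last first.
  apply: (bmeas_comp mU (bmeas_bessel_laplace (ler0n R i) _)).
  by rewrite addr_ge0.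
apply: eq_Rintegral => w1 _.
rewrite indicE mem_set/= ?in_itv/= ?U01// mul1r.
have /andP[u0 u1] := U01 w1.
pose D : R := 1 + 2 * i%:R * (U w1 * (1 - U w1)).
pose a : R := i%:R / D * U w1 ^+ 2.
have uu : 0 <= U w1 * (1 - U w1) by rewrite mulr_ge0// subr_ge0.
have D0 : 0 < D by rewrite ltr_pwDl// mulr_ge0// mulr_ge0.
have a0 : 0 <= a by rewrite mulr_ge0 ?sqr_ge0// divr_ge0// ltW.
transitivity (\int[P]_w (D^-1 * (Num.sqrt D)^-1 *
    (h (Z w) * expR (- ((j%:R + a) * Z w ^+ 2))))).
  rewrite EZ; last first.
    apply: bmeasM; first exact: (bmeas_comp mZ bh).
    by apply: (bmeas_comp mZ (bmeas_even_gauss _)); rewrite addr_ge0.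
  rewrite base ?addr_ge0// addrA.
  by rewrite -(bessel_laplace_bridge (U01 w1) (ler0n R i) (addr_ge0 c0 (ler0n R j))) mulrCA.
apply: eq_Rintegral => w _; rewrite HE.
under eq_Rintegral do rewrite gauss_natE.
rewrite bridge_norm_laplace// -/D -/a gauss_natE mulrDl opprD expRD; ring.
Qed.

End bridge_kernel.

End bridge.

(** * Uniqueness of conditional laws and comparison of null sets *)

Section kernel_uniqueness.
Context {R : realType}.

(** A countable determining class: two kernels that agree almost surely on each member then agree on
    all Borel sets off a single null set. *)
Lemma rational_half_line_unique (mu nu : {measure set R -> \bar R}) :
  (forall q : rat, mu `]ratr q, +oo[%classic = nu `]ratr q, +oo[%classic) ->
  (mu setT < +oo)%E ->
  forall A, measurable A -> mu A = nu A.
Proof.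
move=> munu muT.
pose G : set (set R) := [set `]ratr q, +oo[%classic | q in [set: rat]].
apply: half_line_unique => // a.
have inG b : (<<s G >>) `]b, +oo[%classic.
  have -> : `]b, +oo[%classic = \bigcup_(q : rat)
      (if b < ratr q then `]ratr q, +oo[%classic else set0) :> set R.
    apply/seteqP; split => x /=.
      rewrite in_itv/= andbT => bx.
      have [q] := rat_in_itvoo bx; rewrite in_itv/= => /andP[bq qx].
      by exists q => //; rewrite bq /= in_itv/= qx.
    move=> [q _]; case: ifPn => // bq; rewrite /= !in_itv/= !andbT.
    exact: lt_trans.
  apply: (@bigcupT_measurable_rat _ (g_sigma_algebraType G)) => q.
  case: ifPn => _; last exact: measurable0.
  by apply: sub_sigma_algebra; exists q.
apply: (@measure_unique _ R R G (fun n : nat => `]ratr (- n%:R), +oo[%classic) _ _ _ _ mu nu) => //.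
- transitivity (<<s @RGenOInfty.G R >>); first exact: RGenOInfty.measurableE.
  apply/seteqP; split => A.
    apply: smallest_sub A; first exact: smallest_sigma_algebra.
    by move=> _ [b ->]; exact: inG.
  apply: smallest_sub A; first exact: smallest_sigma_algebra.
  by move=> _ [q _ <-]; apply: sub_sigma_algebra; eexists.
- move=> _ _ [q _ <-] [s _ <-]; exists (Num.max q s) => //.
  apply/seteqP; split => z; rewrite /= !in_itv/= !andbT.
    by rewrite maxEle; case: ifPn => // qs zs; split => //; 
      [apply: le_lt_trans zs; rewrite ler_rat|apply: lt_trans zs; rewrite ltr_rat ltNge].
  by rewrite maxEle => -[h1 h2]; case: ifPn.
- by move=> n; exists (- n%:R).
- apply/seteqP; split => // x _; exists (Num.truncn `|x|).+1 => //=.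
  rewrite in_itv/= andbT rmorphN/= ratr_nat ltrNl (le_lt_trans (ler_norm _))// normrN.
  by have := truncn_itv (normr_ge0 x); case/andP.
- by move=> _ [q _ <-]; exact: munu.
- by move=> n; apply: le_lt_trans muT; apply: le_measure; rewrite ?inE.
Qed.

(** On each rational half-line the two kernels have equal integrals over all sets, with respect to
    the law of Z, so they agree almost everywhere. The union of these countably many exceptional
    sets is null. *)
Lemma conditional_law_unique {d} {T : measurableType d} (P : probability T R)
    (Y Z : T -> R) (k k' : R.-pker R ~> R) :
  conditional_law P Y Z k -> conditional_law P Y Z k' ->
  exists N : set R, [/\ measurable N, P (Z @^-1` N) = 0%E &
    forall r, ~ N r -> forall B, measurable B -> k r B = k' r B].
Proof.
move=> [mY mZ kE] [_ _ k'E].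
pose mu := measure_function_pushforward__canonical__measure_function_Measure P mZ.
have half (q : rat) : {ae mu, forall r, k r `]ratr q, +oo[%classic = k' r `]ratr q, +oo[%classic}.
  pose B : set R := `]ratr q, +oo[%classic.
  have mk (l : R.-pker R ~> R) : measurable_fun setT (l ^~ B) by apply: measurable_kernel; exact: measurable_itv.
  have pk (l : R.-pker R ~> R) C : measurable C ->
     (\int[mu]_(r in C) l r B = \int[P]_(w in Z @^-1` C) l (Z w) B)%E.
    move=> mC; rewrite ge0_integral_pushforward//.
    exact: measurable_funTS.
  have : ae_eq mu setT (k ^~ B) (k' ^~ B).
    apply: integral_ae_eq => //.
    + apply/integrableP; split => //.
      apply: (@le_lt_trans _ _ (\int[mu]_r 1)%E).
        apply: ge0_le_integral => //; first exact: measurableT_comp.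
        move=> r _; rewrite gee0_abs//; apply: (@le_trans _ _ (k r setT)).
          by apply: le_measure; rewrite ?inE//; exact: measurable_itv.
        by rewrite prob_kernel.
      have -> : (\int[mu]_r 1 = P setT)%E by rewrite integral_cst// mul1e.
      by rewrite probability_setT ltry.
    + have mB : measurable B by exact: measurable_itv.
      by move=> C _ mC; rewrite (pk k C mC) (pk k' C mC) -(kE C B mC mB) -(k'E C B mC mB).
  by apply: filterS => r; exact.
(* The rationals are enumerated by [unpickle], which turns the countable family into one indexed by
   natural numbers. *)
have : {ae mu, forall r, forall n q, unpickle n = Some q ->
    k r `]ratr q, +oo[%classic = k' r `]ratr q, +oo[%classic}.
  apply: ae_foralln => n; case: (unpickle n) => [q|]; last by apply: aeW.
  by apply: filterS (half q) => r e q' [<-].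
move=> [N [mN N0 sub]]; exists N; split => // r Nr B mB.
have {}Nr : forall q : rat, k r `]ratr q, +oo[%classic = k' r `]ratr q, +oo[%classic.
  move=> q; apply: contrapT => h; apply: Nr; apply: sub => /= h'; apply: h.
  exact: (h' (pickle q) q (pickleK q)).
by apply: rational_half_line_unique => //; rewrite prob_kernel ltry.
Qed.

End kernel_uniqueness.

Section null_sets.
Context {R : realType}.

(** The density of R(1) is positive on r > 0, so a set that is null for its law meets this half-line
    in a Lebesgue null set. *)
Lemma bessel_density_ae {d} {T : measurableType d} (P : probability T R) (Y : T -> R)
    (N : set R) (Q : R -> Prop) : has_density P Y (@bessel_density R) -> measurable N ->
  P (Y @^-1` N) = 0%E -> (forall r, ~ N r -> Q r) ->
  {ae @lebesgue_measure R, forall r, 0 < r -> Q r}.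
Proof.
move=> [mY mf f0 fE] mN; rewrite fE// => I0 NQ.
have mfN : measurable_fun N (EFin \o @bessel_density R).
  by apply/measurable_EFinP; exact: measurable_funTS.
have : ae_eq (@lebesgue_measure R) N (EFin \o @bessel_density R) (cst 0%E).
  apply/ae_eq_integral_abs => //; rewrite -I0; apply: eq_integral => y _.
  by rewrite /= ger0_norm.
apply: filterS => r h r0; apply: NQ => Nr; have /= [] := h Nr.
rewrite /bessel_density (ltW r0) => /eqP; apply/negP.
by rewrite !mulf_neq0 ?expf_neq0 ?gt_eqF ?expR_gt0// sqrtr_gt0 divr_gt0// pi_gt0.
Qed.

(* The law of m(1) weighted by x e^(-x^2) is a multiple of the law of R(1)
   weighted by e^(-x^2). *)
Lemma meander_null {d1 d2} {T1 : measurableType d1} {T2 : measurableType d2}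
    (P1 : probability T1 R) (X : R -> T1 -> R) (P2 : probability T2 R) (m : R -> T2 -> R)
    (N : set R) : bessel3 P1 X -> brownian_meander P2 m -> measurable N ->
  P2 (m 1 @^-1` N) = 0%E -> P1 (X 1 @^-1` N) = 0%E.
Proof.
move=> hX hm mN N0.
have o01 : 0 <= (1:R) <= 1 by rewrite ler01 lexx.
have z01 : 0 <= (0:R) <= 1 by rewrite ler01 lexx.
have mX : measurable_fun setT (X 1) := bessel3_measurable hX ler01.
have mm : measurable_fun setT (m 1) := meander_measurable hm o01.
have mnX : measurable_fun setT (fun w => `|X 1 w|) by exact: measurableT_comp.
have mnm : measurable_fun setT (fun w => `|m 1 w|) by exact: measurableT_comp.
have [kappa k0 kE] := meander_laplace_rate hm.
have bN : bounded_measurable (\1_N : R -> R) by exact: bmeas_indic.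
have gX : bounded_measurable (fun w => expR (- X 1 w ^+ 2)).
  by have := bmeas_gauss 1 mX; under eq_fun do rewrite expr1.
pose rho1 w := kappa * expR (- X 1 w ^+ 2).
have b1 : bounded_measurable rho1 by apply: bmeasM => //; exact: bmeas_cst.
pose rho2 w := `|m 1 w| * expR (- m 1 w ^+ 2).
have b2 : bounded_measurable rho2 by exact: (bmeas_comp mm bmeas_abs_gauss).
have p1 w : 0 <= rho1 w by rewrite mulr_ge0 ?expR_ge0 ?(ltW k0).
have p2 w : 0 <= rho2 w by rewrite mulr_ge0 ?expR_ge0.
have e := @laplace_unique_E R _ _ _ _ P1 (X 1) (X 1) rho1 P2 (m 1) (m 1) rho2 N setT
  mX mX b1 p1 mm mm b2 p2 _ mN measurableT.
have {}e : \int[P1]_w (rho1 w * (\1_N `|X 1 w| * \1_setT `|X 1 w|)) =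
    \int[P2]_w (rho2 w * (\1_N `|m 1 w| * \1_setT `|m 1 w|)).
  apply: e => i j.
  transitivity (kappa * \int[P1]_w expR (- ((1 + (i + j)%:R) * X 1 w ^+ 2))).
    rewrite -EZ; last by apply: (bmeas_comp mX (bmeas_even_gauss _)); rewrite addr_ge0.
    apply: eq_Rintegral => w _.
    by rewrite -exprD gauss_natE -mulrA -expRD; congr (_ * expR _); ring.
  rewrite bessel3_laplace1 ?addr_ge0// -bessel_laplace00 -(kE 0 0 (i + j)%:R)//.
  apply: eq_Rintegral => w _; rewrite mul0r oppr0 expR0 mul1r -exprD gauss_natE.
  by [].
have mmN : measurable (m 1 @^-1` N) by exact: measurable_preimageT.
have e2 : \int[P2]_w (rho2 w * (\1_N `|m 1 w| * \1_setT `|m 1 w|)) = 0.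
  rewrite -[RHS](Ecst P2); apply: Eae.
  - suff [] : bounded_measurable (fun w => rho2 w * (\1_N `|m 1 w| * \1_setT `|m 1 w|)) by [].
    apply: bmeasM => //; apply: bmeasM; first exact: (bmeas_comp mnm bN).
    by apply: (bmeas_comp mnm); exact: bmeas_indic.
  - exact: measurable_cst.
  - apply: filterS2 (ae_prob0 mmN N0) (meander_ge0 hm o01) => w Nw m0.
    by rewrite ger0_norm// [\1_N _]indicE memNset// mul0r mulr0.
have b3 : bounded_measurable (fun w => rho1 w * (\1_N `|X 1 w| * \1_setT `|X 1 w|)).
  apply: bmeasM => //; apply: bmeasM; first exact: (bmeas_comp mnX bN).
  by apply: (bmeas_comp mnX); exact: bmeas_indic.
rewrite e2 in e.
have p3 w : 0 <= rho1 w * (\1_N `|X 1 w| * \1_setT `|X 1 w|).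
  by rewrite mulr_ge0// mulr_ge0// indicE.
have h := E_eq0_ae b3 p3 e.
apply: prob0_ae; first exact: measurable_preimageT.
apply: filterS2 h (bessel3_ge0 hX ler01) => w /eqP + X0 Nw.
rewrite ger0_norm// indicT [\1_N _]indicE mem_set// !mulr1 mulf_eq0.
by rewrite (gt_eqF k0) (gt_eqF (expR_gt0 _)).
Qed.

End null_sets.

Theorem corollary4p2 (R : realType)
    (d1 : measure_display) (Omega1 : measurableType d1)
    (P1 : probability Omega1 R) (X : R -> Omega1 -> R) (U : {RV P1 >-> R})
    (d2 : measure_display) (Omega2 : measurableType d2)
    (P2 : probability Omega2 R) (m : R -> Omega2 -> R) (V : {RV P2 >-> R})
    (hX : bessel3 P1 X) (hU : uniform01 U)
    (hXU : process_indep_rv P1 `[0, +oo[ X U)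
    (hm : brownian_meander P2 m) (hV : uniform01 V)
    (hmV : process_indep_rv P2 `[0, 1] m V) :
  [/\ has_density P1 (X 1) (fun y : R =>
        if 0 <= y then Num.sqrt (2 / pi) * y ^+ 2 * expR (- y ^+ 2 / 2)
        else 0),
      same_law P1 (at_random_time X U) (fun w => Num.sqrt (U w) * X 1 w) /\
      has_density P1 (at_random_time X U) (fun y : R =>
        if 0 <= y then
          2 * Num.sqrt (2 / pi) * y *
          (\int[lebesgue_measure]_(z in `[y, +oo[) expR (- z ^+ 2 / 2))
        else 0) &
      [/\ exists k : R.-pker R ~> R,
            conditional_law P1 (at_random_time X U) (X 1) k,
          exists k : R.-pker R ~> R,
            conditional_law P2 (at_random_time m V) (m 1) k &
          forall k1 k2 : R.-pker R ~> R,
            conditional_law P1 (at_random_time X U) (X 1) k1 ->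
            conditional_law P2 (at_random_time m V) (m 1) k2 ->
            {ae lebesgue_measure, forall r : R, 0 < r ->
               forall B : set R, measurable B -> k1 r B = k2 r B}]].
Proof.
have mX : measurable_fun setT (X 1) := bessel3_measurable hX ler01.
have o01 : 0 <= (1:R) <= 1 by rewrite ler01 lexx.
have mm : measurable_fun setT (m 1) := meander_measurable hm o01.
have [U01 _] := hU.
have [k [kX km]] : exists k : R.-pker R ~> R,
    conditional_law P1 (at_random_time X U) (X 1) k /\
    conditional_law P2 (at_random_time m V) (m 1) k.
  (* The three dimensional Brownian motion behind X also drives the bridge, and U is its time; the
     resulting kernel is used for both processes. *)
  case: (hX) => [_ [d [T [P [W [BW _]]]]]].
  have mU : measurable_fun setT U by exact: measurable_funP.
  have mb := measurable_bridge_norm mU BW.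
  have [k kE] := exists_law_kernel (P1 \x P)%E mb.
  exists k; split.
    apply: (bridge_conditional_law (P1 := P1) (P2 := P) (h := fun=> 1) (c := 0) (kappa := 1)
      mU U01 BW) => //.
    - exact: bessel3_sample_measurable.
    - exact: bmeas_cst.
    - exact: bessel3_sample_ge0.
    - exact: bessel3_ge0.
    - by apply: aeW.
    - move=> l n l0 n0; rewrite mul1r add0r -(bessel3_sample_laplace hX hU hXU l0 n0).
      by apply: eq_Rintegral => w _; rewrite mul1r.
  have [kappa k0 kappaE] := meander_sample_laplace hm hV hmV.
  apply: (bridge_conditional_law (P1 := P1) (P2 := P) (h := fun x => `|x| * expR (- x ^+ 2))
      (c := 1) (kappa := kappa) mU U01 BW) => //.
  - exact: meander_sample_measurable.
  - exact: bmeas_abs_gauss.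
  - exact: (meander_sample_ge0 hm hV hmV).
  - exact: (meander_ge0 hm o01).
  - by apply: filterS (meander1_gt0 hm) => w m0; rewrite mulr_gt0 ?expR_gt0// normr_gt0 gt_eqF.
  (* U and V live on different spaces, but the mixed transform depends on their common uniform law
     only. *)
  - move=> l n l0 n0; rewrite kappaE//; congr (_ * _).
    by apply: uniform_bessel_laplace => //; rewrite addr_ge0.
split; first exact: bessel3_density.
  by split; [exact: bessel3_scaling|exact: bessel3_sample_density].
split; [by exists k|by exists k|move=> k1 k2 h1 h2].
(* Each kernel agrees with k off a set that is null for the law of R(1) or of m(1). [meander_null]
   carries the second set over to the law of R(1), whose density then gives almost every r > 0. *)
have [N1 [mN1 N10 e1]] := conditional_law_unique h1 kX.
have [N2 [mN2 N20 e2]] := conditional_law_unique h2 km.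
have mN : measurable (N1 `|` N2) by exact: measurableU.
have N0 : P1 (X 1 @^-1` (N1 `|` N2)) = 0%E.
  by rewrite preimage_setU measureU0//; [exact: measurable_preimageT..|exact: meander_null N20].
apply: (bessel_density_ae (bessel3_density hX) mN N0) => r /not_orP[r1 r2] B mB.
by rewrite (e1 r r1 B mB) (e2 r r2 B mB).
Qed.
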